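(* Let $k$ be a kernel on $\mathbb{X}$ and $(\tilde P_1,\tilde P_2)$ a pair of random probability measures on $\mathbb{X}$ with $\mathrm{Var}_k(\tilde P_i)>0$ for $i=1,2$. Let $\big(X^{(t)}_{1,1},X^{(t)}_{2,1},X^{(t)}_{1,2},X^{(t)}_{2,2}\big)$, $t=1,2,\dots$, be i.i.d. copies of a vector $(X_{1,1},X_{2,1},X_{1,2},X_{2,2})$ whose entries are, conditionally on $(\tilde P_1,\tilde P_2)$, independent with $X_{i,j}\sim\tilde P_i$. For $M\ge2$ define $$\widehat{\mathrm{Cov}}_{k,M}=\frac{1}{M-1}\sum_{t=1}^{M}k\big(X^{(t)}_{1,1},X^{(t)}_{2,1}\big)-\frac{1}{(M-1)M}\sum_{t=1}^{M}\sum_{s=1}^{M}k\big(X^{(t)}_{1,1},X^{(s)}_{2,1}\big),$$ $$\widehat{\mathrm{Var}}_{k,M}(\tilde P_i)=\frac{1}{M-1}\sum_{t=1}^{M}k\big(X^{(t)}_{i,1},X^{(t)}_{i,2}\big)-\frac{1}{(M-1)M}\sum_{t=1}^{M}\sum_{s=1}^{M}k\big(X^{(t)}_{i,1},X^{(s)}_{i,2}\big),\quad i=1,2,$$ $$\widehat{\mathrm{Corr}}_{k,M}=\frac{\widehat{\mathrm{Cov}}_{k,M}}{\sqrt{\widehat{\mathrm{Var}}_{k,M}(\tilde P_1)}\sqrt{\widehat{\mathrm{Var}}_{k,M}(\tilde P_2)}}.$$ Then $\widehat{\mathrm{Corr}}_{k,M}$ is an asymptotically normal estimator of the kernel correlation: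 as $M\to+\infty$, $\sqrt{M}\big(\widehat{\mathrm{Corr}}_{k,M}-\mathrm{Corr}_k(\tilde P_1,\tilde P_2)\big)$ converges in distribution to a centred Gaussian distribution.
   Context: $\mathbb{X}$ is a locally compact Polish space with Borel $\sigma$-algebra $\mathcal{X}$. $\mathcal{P}(\mathbb{X})$ is the set of probability measures on $\mathbb{X}$, with the $\sigma$-algebra generated by the evaluation maps $\xi\mapsto\xi(A)$, $A\in\mathcal{X}$. A kernel on $\mathbb{X}$ is a measurable function $k:\mathbb{X}\times\mathbb{X}\to\mathbb{R}$ that is bounded, symmetric and positive-definite ($\sum_{i,j=1}^m a_ia_jk(x_i,x_j)\ge 0$ for all $m$, $x_i\in\mathbb{X}$, $a_i\in\mathbb{R}$). $\mathbb{H}_k$ is its reproducing kernel Hilbert space. The kernel mean embedding of $P\in\mathcal{P}(\mathbb{X})$ is $\mu_k(P)\in\mathbb{H}_k$, $\mu_k(P)(y)=\int k(x,y)\,dP(x)$; it satisfies $\langle\mu_k(P_1),\mu_k(P_2)\rangle_{\mathbb{H}_k}=\iint k\,dP_1\,dP_2$. A random probability is a random element of $\mathcal{P}(\mathbb{X})$. $\mathrm{Cov}_k(\tilde P_1,\tilde P_2)=\mathbb{E}\big[\langle\mu_k(\tilde P_1)-\mathbb{E}[\mu_k(\tilde P_1)],\mu_k(\tilde P_2)-\mathbb{E}[\mu_k(\tilde P_2)]\rangle_{\mathbb{H}_k}\big]$, where the expectation of an $\mathbb{H}_k$-valued random element $V$ is characterised by $\langle h,\mathbb{E}[V]\rangle=\mathbb{E}\langle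 h,V\rangle$ for all $h\in\mathbb{H}_k$. $\mathrm{Var}_k(\tilde P)=\mathrm{Cov}_k(\tilde P,\tilde P)$, and $\mathrm{Corr}_k(\tilde P_1,\tilde P_2)=\mathrm{Cov}_k(\tilde P_1,\tilde P_2)/\big(\sqrt{\mathrm{Var}_k(\tilde P_1)}\sqrt{\mathrm{Var}_k(\tilde P_2)}\big)$. Conventions: a centred Gaussian distribution may have zero variance (Dirac mass at $0$); on the event where an estimated variance is not positive, $\widehat{\mathrm{Corr}}_{k,M}$ is given an arbitrary (measurable) value, e.g. $0$. *)

(* Defs.v *)
From HB Require Import structures.
From mathcomp Require Import all_boot all_order all_algebra.
From mathcomp Require Import finmap.
From mathcomp Require Import all_classical all_reals all_analysis.
Set Implicit Arguments.
Unset Strict Implicit.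
Unset Printing Implicit Defensive.
Import Order.TTheory GRing.Theory Num.Theory.
Import numFieldNormedType.Exports.
Local Open Scope classical_set_scope.
Local Open Scope ring_scope.

Definition is_distance (R : realType) (X : Type) (dist : X -> X -> R) :=
  [/\ forall x y, 0 <= dist x y,
      forall x y, dist x y = 0 <-> x = y,
      forall x y, dist x y = dist y x &
      forall x y z, dist x z <= dist x y + dist y z].

Definition complete_distance (R : realType) (X : Type) (dist : X -> X -> R) :=
  forall u : nat -> X,
    (forall e, 0 < e ->
       exists N, forall m n, (N <= m)%N -> (N <= n)%N ->
         dist (u m) (u n) < e) ->
    exists x, dist x (u n) @[n --> \oo] --> (0 : R).

Definition polish (R : realType) (X : topologicalType) :=
  (exists dist : X -> X -> R,
     [/\ is_distance dist,
         forall x, nbhs x =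
           filter_from [set e | 0 < e] (fun e => [set y | dist x y < e]) &
         complete_distance dist]) /\
  (exists2 D : set X, countable D & dense D).

Definition borel (X : ptopologicalType) : measurableType (@open X).-sigma :=
  g_sigma_algebraType (@open X).

(* Measurability is with respect to the product sigma-algebra on T * T; when T
   carries the Borel sigma-algebra of a second countable space, this is the
   Borel sigma-algebra of the product. *)
Definition is_kernel (R : realType) (d : measure_display)
    (T : measurableType d) (k : T -> T -> R) :=
  [/\ measurable_fun [set: T * T] (fun z => k z.1 z.2),
      exists C, forall x y, `|k x y| <= C,
      forall x y, k x y = k y x &
      forall (m : nat) (a : 'I_m -> R) (x : 'I_m -> T),
        0 <= \sum_(i < m) \sum_(j < m) a i * a j * k (x i) (x j)].

(* A Hilbert space of functions on T with reproducing kernel k: the carrier is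
   a set of functions, and rkhs_ip is meaningful on that set only.  For a
   symmetric positive-definite k such a space exists, and its carrier and the
   inner product on it are unique (Moore-Aronszajn). *)
Record rkhs (R : realType) (T : Type) (k : T -> T -> R) := Rkhs {
  rkhs_set : set (T -> R);
  rkhs_ip : (T -> R) -> (T -> R) -> R;
  rkhs_zero : rkhs_set (fun=> 0);
  rkhs_lincomb : forall a f g, rkhs_set f -> rkhs_set g ->
    rkhs_set (fun x => a * f x + g x);
  rkhs_ipC : forall f g, rkhs_set f -> rkhs_set g ->
    rkhs_ip f g = rkhs_ip g f;
  rkhs_ip_linear : forall a f g h, rkhs_set f -> rkhs_set g -> rkhs_set h ->
    rkhs_ip (fun x => a * f x + g x) h = a * rkhs_ip f h + rkhs_ip g h;
  rkhs_ip_ge0 : forall f, rkhs_set f -> 0 <= rkhs_ip f f;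
  rkhs_ip_eq0 : forall f, rkhs_set f -> rkhs_ip f f = 0 -> f = (fun=> 0);
  rkhs_complete : forall u : nat -> T -> R,
    (forall n, rkhs_set (u n)) ->
    (forall e, 0 < e ->
       exists N, forall m n, (N <= m)%N -> (N <= n)%N ->
         rkhs_ip (u m \- u n) (u m \- u n) < e) ->
    exists2 f, rkhs_set f &
      rkhs_ip (u n \- f) (u n \- f) @[n --> \oo] --> (0 : R);
  rkhs_kernel : forall x, rkhs_set (k x);
  rkhs_reproducing : forall f x, rkhs_set f -> rkhs_ip f (k x) = f x
}.
Arguments rkhs_ip {R T k}.

Definition kmean (R : realType) (d : measure_display) (T : measurableType d)
    (k : T -> T -> R) (Q : pprobability T R) : T -> R :=
  fun y => \int[Q]_x k x y.

(* Weak expectation: m is characterised by <h, m> = E <h, V>, h in H. *)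
Definition is_rkhs_expectation (R : realType) (T : Type) (k : T -> T -> R)
    (H : rkhs k) (d : measure_display) (Omega : measurableType d)
    (P : probability Omega R) (V : Omega -> T -> R) (m : T -> R) :=
  rkhs_set H m /\
  forall h, rkhs_set H h ->
    P.-integrable [set: Omega] (fun w => (rkhs_ip H h (V w))%:E) /\
    rkhs_ip H h m = \int[P]_w rkhs_ip H h (V w).

(* The expectation is unique when it exists; the value is 0 otherwise. *)
Definition rkhs_expectation (R : realType) (T : Type) (k : T -> T -> R)
    (H : rkhs k) (d : measure_display) (Omega : measurableType d)
    (P : probability Omega R) (V : Omega -> T -> R) : T -> R :=
  xget (fun=> 0) [set m | is_rkhs_expectation H P V m].

Section kernel_correlation.
Context (R : realType) (dT : measure_display) (T : measurableType dT).
Context (k : T -> T -> R) (H : rkhs k).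
Context (d : measure_display) (Omega : measurableType d).
Context (P : probability Omega R).

Definition kcov (Q1 Q2 : Omega -> pprobability T R) : R :=
  let V1 w := kmean k (Q1 w) in
  let V2 w := kmean k (Q2 w) in
  \int[P]_w rkhs_ip H (V1 w \- rkhs_expectation H P V1)
                      (V2 w \- rkhs_expectation H P V2).

Definition kvar (Q : Omega -> pprobability T R) : R := kcov Q Q.

Definition kcorr (Q1 Q2 : Omega -> pprobability T R) : R :=
  kcov Q1 Q2 / (Num.sqrt (kvar Q1) * Num.sqrt (kvar Q2)).

End kernel_correlation.

Section conditioning.
Context (R : realType) (d : measure_display) (Omega : measurableType d).
Context (P : probability Omega R).

Definition generated_sigma_algebra (d' : measure_display)
    (T' : measurableType d') (Z : Omega -> T') : set (set Omega) :=
  preimage_set_system setT Z measurable.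

Definition is_cond_prob (G : set (set Omega)) (A : set Omega)
    (f : Omega -> R) :=
  [/\ generated_sigma_algebra f `<=` G,
      P.-integrable [set: Omega] (fun w => (f w)%:E) &
      forall B, G B -> P (A `&` B) = (\int[P]_(w in B) (f w)%:E)%E].

(* Independence of (Z i)_i conditionally on G:
   P(Z i \in A i for all i | G) = \prod_i P(Z i \in A i | G) a.s. *)
Definition cond_independent (G : set (set Omega)) (I : finType)
    (d' : measure_display) (T' : measurableType d') (Z : I -> Omega -> T') :=
  forall (A : I -> set T') (f : I -> Omega -> R),
    (forall i, measurable (A i)) ->
    (forall i, is_cond_prob G (Z i @^-1` A i) (f i)) ->
    is_cond_prob G (\bigcap_i (Z i @^-1` A i)) (fun w => \prod_(i : I) f i w).

Definition is_cond_law (G : set (set Omega))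
    (d' : measure_display) (T' : measurableType d') (Z : Omega -> T')
    (Q : Omega -> pprobability T' R) :=
  forall A : set T', measurable A ->
    is_cond_prob G (Z @^-1` A) (fun w => fine (Q w A)).

Definition mutually_independent (d' : measure_display)
    (T' : measurableType d') (Z : nat -> Omega -> T') :=
  forall (J : {fset nat}) (A : nat -> set T'),
    (forall t, measurable (A t)) ->
    P (\bigcap_(t in [set` J]) (Z t @^-1` A t)) =
      (\prod_(t <- enum_fset J) P (Z t @^-1` A t))%E.

End conditioning.

Definition same_law (R : realType) (d1 d2 d' : measure_display)
    (Omega1 : measurableType d1) (Omega2 : measurableType d2)
    (T' : measurableType d') (P1 : probability Omega1 R)
    (P2 : probability Omega2 R) (Z1 : Omega1 -> T') (Z2 : Omega2 -> T') :=
  forall A : set T', measurable A -> P1 (Z1 @^-1` A) = P2 (Z2 @^-1` A).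

(* (X_{1,1}, X_{2,1}, X_{1,2}, X_{2,2}), the indices 1, 2 being 0, 1 : 'I_2 *)
Definition vec4 (Omega T : Type) (X : 'I_2 -> 'I_2 -> Omega -> T) :
    Omega -> T * T * T * T :=
  fun w => (X 0 0 w, X 1 0 w, X 0 1 w, X 1 1 w).

(* The samples t = 1, ..., M are indexed by t < M. *)
Definition cov_est (R : realType) (T : Type) (k : T -> T -> R) (M : nat)
    (x y : nat -> T) : R :=
  (M%:R - 1)^-1 * (\sum_(t < M) k (x t) (y t)) -
  ((M%:R - 1) * M%:R)^-1 * (\sum_(t < M) \sum_(s < M) k (x t) (y s)).

(* c is the value given to the estimator where an estimated variance is not
   positive *)
Definition corr_est (R : realType) (T : Type) (k : T -> T -> R) (M : nat)
    (x : nat -> 'I_2 -> 'I_2 -> T) (c : R) : R :=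
  let C := cov_est k M (fun t => x t 0 0) (fun t => x t 1 0) in
  let V i := cov_est k M (fun t => x t i 0) (fun t => x t i 1) in
  if (0 < V 0) && (0 < V 1) then C / (Num.sqrt (V 0) * Num.sqrt (V 1)) else c.

Definition cvg_in_distribution (R : realType) (d : measure_display)
    (Omega : measurableType d) (P : probability Omega R)
    (Y : nat -> Omega -> R) (nu : probability (measurableTypeR R) R) :=
  (forall n, measurable_fun [set: Omega] (Y n)) /\
  forall f : R -> R, continuous f -> (exists C, forall x, `|f x| <= C) ->
    \int[P]_w f (Y n w) @[n --> \oo] --> \int[nu]_x f x.

(* s is the standard deviation; normal_prob 0 0 is the uniform distribution on
   [0, 1], hence the special case. *)
Definition centred_gaussian (R : realType) (s : R) :
    probability (measurableTypeR R) R :=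
  if s == 0 then [the probability (measurableTypeR R) R of \d_(0 : measurableTypeR R)]
  else [the probability (measurableTypeR R) R of normal_prob 0 s].

(* Main.v *)
(** The kernel mean embedding m = kmean k Q satisfies <h, m> = int h dQ on the
    RKHS, so that Cov_k(P1, P2) = E k(X11, X21) - E k(X11, X21') with X21' an
    independent copy of X21.  The Hoeffding decomposition
    k(x, y) = g1 x + g2 y - b + h(x, y) with h degenerate turns the estimator of
    the covariance into the mean of the i.i.d. bounded variables h(X_t, Y_t) up
    to a remainder (M (M - 1))^-1 sum_(t != s) h(X_t, Y_s), whose second moment
    is O(M^-2).  The three estimators have mean squared error O(1/M), so a
    second order expansion of c / (sqrt v1 * sqrt v2) replaces
    sqrt M (Corr_hat - Corr) by M^(-1/2) times a sum of centred bounded i.i.d.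
    variables xi_t, up to O(M^(-1/2)) when tested against a smooth bounded
    function.  The central limit theorem for this sum follows from Lindeberg's
    method: partial sums are replaced one term at a time by Gaussian variables,
    and the third order Taylor inequality required of the test functions is
    preserved by averaging translates, so no derivative of an integral is ever
    needed.  Finally, smooth steps built from the truncated cube x_+^3 satisfy
    this inequality and are numerous enough to approximate every bounded
    continuous function. *)
Require Import Defs.
From HB Require Import structures.
From mathcomp Require Import all_boot all_order all_algebra.
From mathcomp Require Import finmap.
From mathcomp Require Import all_classical all_reals all_analysis.
From mathcomp Require Import measurable_realfun giry ring lra.
Set Implicit Arguments.
Unset Strict Implicit.
Unset Printing Implicit Defensive.
Import Order.TTheory GRing.Theory Num.Theory.
Import numFieldNormedType.Exports.
Local Open Scope classical_set_scope.
Local Open Scope ring_scope.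

(** * Bounded measurable functions *)

Section bounded_measurable.
Context (R : realType) (d : measure_display) (T : measurableType d).
Implicit Types f g : T -> R.

(** Boundedness of [k] keeps the analysis elementary: nearly every integrand is bounded and
    measurable, hence integrable against every probability. Three obstacles shape the rest.
    Conditional independence enters through P(Z1 in A, Z2 in B) = E[Q1(A) Q2(B)], which identifies
    the law of a pair as a mixture of product measures. Finally, the ratio is singular where an
    estimated variance is small or negative. No event of high probability is carried along: test
    functions are bounded, so the bad event costs at most a constant times the mean squared error,
    as in Markov's inequality, and this also absorbs the arbitrary default value. *)

Definition bounded_measurable f :=
  measurable_fun [set: T] f /\ exists C, forall x, `|f x| <= C.

Lemma bounded_measurable_bound f : bounded_measurable f ->
  exists2 C, 0 < C & forall x, `|f x| <= C.
Proof.
move=> [_ [C fC]]; exists (`|C| + 1); first by rewrite ltr_wpDl.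
by move=> x; rewrite (le_trans (fC x))// (le_trans (ler_norm C))// lerDl.
Qed.

Lemma bounded_measurable_cst (c : R) : bounded_measurable (fun=> c).
Proof. by split => //; exists `|c|. Qed.

Lemma bounded_measurableD f g : bounded_measurable f -> bounded_measurable g ->
  bounded_measurable (fun x => f x + g x).
Proof.
move=> [mf [C fC]] [mg [D gD]]; split; first exact: measurable_funD.
by exists (C + D) => x; rewrite (le_trans (ler_normD _ _))// lerD.
Qed.

Lemma bounded_measurableM f g : bounded_measurable f -> bounded_measurable g ->
  bounded_measurable (fun x => f x * g x).
Proof.
move=> [mf [C fC]] [mg [D gD]]; split; first exact: measurable_funM.
by exists (C * D) => x; rewrite normrM ler_pM.
Qed.

Lemma bounded_measurableN f :
  bounded_measurable f -> bounded_measurable (fun x => - f x).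
Proof.
move=> [mf [C fC]]; split; first exact: measurable_funN.
by exists C => x; rewrite normrN.
Qed.

Lemma bounded_measurableB f g : bounded_measurable f -> bounded_measurable g ->
  bounded_measurable (fun x => f x - g x).
Proof.
by move=> bf bg; apply: bounded_measurableD => //; exact: bounded_measurableN.
Qed.

Lemma bounded_measurableZ (c : R) f :
  bounded_measurable f -> bounded_measurable (fun x => c * f x).
Proof. by move=> bf; apply: bounded_measurableM => //; exact: bounded_measurable_cst. Qed.

Lemma bounded_measurableX f n :
  bounded_measurable f -> bounded_measurable (fun x => f x ^+ n).
Proof.
move=> bf; elim: n => [|n IH].
  by under eq_fun do rewrite expr0; exact: bounded_measurable_cst.
by under eq_fun do rewrite exprS; exact: bounded_measurableM.
Qed.

Lemma bounded_measurable_norm f :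
  bounded_measurable f -> bounded_measurable (fun x => `|f x|).
Proof.
move=> [mf [C fC]]; split; first exact: measurableT_comp.
by exists C => x; rewrite normr_id.
Qed.

Lemma bounded_measurable_sum (I : Type) (r : seq I) (F : I -> T -> R) :
  (forall i, bounded_measurable (F i)) ->
  bounded_measurable (fun x => \sum_(i <- r) F i x).
Proof.
move=> bF; elim: r => [|i r IH].
  by under eq_fun do rewrite big_nil; exact: bounded_measurable_cst.
by under eq_fun do rewrite big_cons; exact: bounded_measurableD.
Qed.

End bounded_measurable.
Arguments bounded_measurable_cst {R d T} c.

Lemma bounded_measurable_comp (R : realType) (d d' : measure_display)
    (T : measurableType d) (T' : measurableType d') (f : T' -> R) (h : T -> T') :
  bounded_measurable f -> measurable_fun setT h ->
  bounded_measurable (fun x => f (h x)).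
Proof.
move=> [mf [C fC]] mh; split; first exact: measurableT_comp mf mh.
by exists C => x.
Qed.

Section bounded_integral.
Context (R : realType) (d : measure_display) (T : measurableType d).
Context (P : probability T R).
Implicit Types f g : T -> R.

Lemma bounded_measurable_integrable f :
  bounded_measurable f -> P.-integrable setT (EFin \o f).
Proof.
move=> [mf [C fC]]; apply: (@le_integrable _ _ _ P setT _ _ (EFin \o cst C)) => //.
- exact/measurable_EFinP.
- by move=> x _ /=; rewrite lee_fin (le_trans (fC x))// ler_norm.
- exact: finite_measure_integrable_cst.
Qed.

Lemma bounded_integral_cst (c : R) : \int[P]_x c = c.
Proof.
rewrite Rintegral_cst//.
by rewrite [X in _ * fine X](_ : _ = 1%E) ?mulr1//; exact: probability_setT.
Qed.

Lemma bounded_integralD f g : bounded_measurable f -> bounded_measurable g ->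
  \int[P]_x (f x + g x) = \int[P]_x f x + \int[P]_x g x.
Proof. by move=> bf bg; rewrite RintegralD//; exact: bounded_measurable_integrable. Qed.

Lemma bounded_integralB f g : bounded_measurable f -> bounded_measurable g ->
  \int[P]_x (f x - g x) = \int[P]_x f x - \int[P]_x g x.
Proof. by move=> bf bg; rewrite RintegralB//; exact: bounded_measurable_integrable. Qed.

Lemma bounded_integralZ (c : R) f : bounded_measurable f ->
  \int[P]_x (c * f x) = c * \int[P]_x f x.
Proof. by move=> bf; rewrite RintegralZl//; exact: bounded_measurable_integrable. Qed.

Lemma bounded_integral_sum (I : Type) (r : seq I) (F : I -> T -> R) :
  (forall i, bounded_measurable (F i)) ->
  \int[P]_x (\sum_(i <- r) F i x) = \sum_(i <- r) \int[P]_x F i x.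
Proof.
move=> bF; elim: r => [|i r IH].
  rewrite big_nil -[RHS](bounded_integral_cst 0).
  by apply: eq_Rintegral => x _; rewrite big_nil.
rewrite big_cons -IH -bounded_integralD//; last exact: bounded_measurable_sum.
by apply: eq_Rintegral => x _; rewrite big_cons.
Qed.

Lemma le_bounded_integral f g : bounded_measurable f -> bounded_measurable g ->
  (forall x, f x <= g x) -> \int[P]_x f x <= \int[P]_x g x.
Proof. by move=> bf bg fg; apply: le_Rintegral => //; exact: bounded_measurable_integrable. Qed.

Lemma bounded_integral_le f (C : R) : bounded_measurable f ->
  (forall x, f x <= C) -> \int[P]_x f x <= C.
Proof.
move=> bf fC; rewrite -[leRHS]bounded_integral_cst.
by apply: le_bounded_integral => //; exact: bounded_measurable_cst.
Qed.

Lemma norm_bounded_integral_le f g : bounded_measurable f -> bounded_measurable g ->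
  (forall x, `|f x| <= g x) -> `|\int[P]_x f x| <= \int[P]_x g x.
Proof.
move=> bf bg fg; apply: (le_trans (le_normr_Rintegral _ _)) => //.
  exact: bounded_measurable_integrable.
by apply: le_bounded_integral => //; exact: bounded_measurable_norm.
Qed.

Lemma norm_bounded_integral f (C : R) : bounded_measurable f ->
  (forall x, `|f x| <= C) -> `|\int[P]_x f x| <= C.
Proof.
move=> bf fC; rewrite -[leRHS]bounded_integral_cst.
by apply: norm_bounded_integral_le => //; exact: bounded_measurable_cst.
Qed.

Lemma EFin_bounded_integral f : bounded_measurable f ->
  (\int[P]_x (f x)%:E)%E = (\int[P]_x f x)%:E.
Proof.
move=> bf; rewrite /Rintegral fineK//.
by apply: integrable_fin_num => //; exact: bounded_measurable_integrable.
Qed.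

End bounded_integral.

Section bounded_fubini.
Context (R : realType) (d1 d2 : measure_display) (T1 : measurableType d1)
  (T2 : measurableType d2).
Implicit Types F : T1 * T2 -> R.

Lemma bounded_measurable_pair1 F y : bounded_measurable F ->
  bounded_measurable (fun x => F (x, y)).
Proof.
by move=> [mF [C FC]]; split; [exact: measurable_fun_pair1|exists C => x].
Qed.

Lemma bounded_measurable_pair2 F x : bounded_measurable F ->
  bounded_measurable (fun y => F (x, y)).
Proof.
by move=> [mF [C FC]]; split; [exact: measurable_fun_pair2|exists C => y].
Qed.

Lemma bounded_measurable_integral2 (P2 : probability T2 R) F :
  bounded_measurable F -> bounded_measurable (fun x => \int[P2]_y F (x, y)).
Proof.
move=> bF; have [_ [C FC]] := bF; split; last first.
  exists C => x; apply: norm_bounded_integral => //.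
  exact: bounded_measurable_pair2.
(* The partial integral does not depend on the first marginal; a Dirac mass supplies the product
   measure that Fubini's theorem asks for. *)
pose P1 : probability T1 R := \d_point.
have intF : (P1 \x P2)%E.-integrable setT (EFin \o F).
  exact: bounded_measurable_integrable.
apply/measurable_EFinP; apply: eq_measurable_fun (measurable_fubini_F intF) => x _.
by rewrite /fubini_F/= EFin_bounded_integral//; exact: bounded_measurable_pair2.
Qed.

Lemma bounded_measurable_integral1 (P1 : probability T1 R) F :
  bounded_measurable F -> bounded_measurable (fun y => \int[P1]_x F (x, y)).
Proof.
move=> bF; have [_ [C FC]] := bF; split; last first.
  exists C => x; apply: norm_bounded_integral => //.
  exact: bounded_measurable_pair1.
pose P2 : probability T2 R := \d_point.
have intF : (P1 \x P2)%E.-integrable setT (EFin \o F).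
  exact: bounded_measurable_integrable.
apply/measurable_EFinP; apply: eq_measurable_fun (measurable_fubini_G intF) => x _.
by rewrite /fubini_G/= EFin_bounded_integral//; exact: bounded_measurable_pair1.
Qed.

Lemma bounded_integral_prod (P1 : probability T1 R) (P2 : probability T2 R) F :
  bounded_measurable F ->
  fine (\int[(P1 \x P2)%E]_z (F z)%:E) = \int[P1]_x \int[P2]_y F (x, y) /\
  fine (\int[(P1 \x P2)%E]_z (F z)%:E) = \int[P2]_y \int[P1]_x F (x, y).
Proof.
move=> bF; have intF : (P1 \x P2)%E.-integrable setT (EFin \o F).
  exact: bounded_measurable_integrable.
split.
- rewrite -(integral12_prod_meas1 intF); congr fine; apply: eq_integral => x _.
  by rewrite /fubini_F EFin_bounded_integral//; exact: bounded_measurable_pair2.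
- rewrite -(integral21_prod_meas1 intF); congr fine; apply: eq_integral => y _.
  by rewrite /fubini_G EFin_bounded_integral//; exact: bounded_measurable_pair1.
Qed.

Lemma bounded_fubini (P1 : probability T1 R) (P2 : probability T2 R) F :
  bounded_measurable F ->
  \int[P1]_x \int[P2]_y F (x, y) = \int[P2]_y \int[P1]_x F (x, y).
Proof. by move=> bF; have [<- <-] := bounded_integral_prod P1 P2 bF. Qed.

End bounded_fubini.

(** * Laws of random elements *)

Section law.
Context (R : realType) (d d' : measure_display) (T : measurableType d)
  (T' : measurableType d') (P : probability T R) (X : T -> T').
Hypothesis mX : measurable_fun [set: T] X.

(* The measurability of X is an argument so that law can carry a canonical
   probability structure. *)
Definition law : set T' -> \bar R := let _ := mX in pushforward P X.

Let law0 : law set0 = 0%E.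
Proof. by rewrite /law /pushforward preimage_set0 measure0. Qed.

Let law_ge0 A : (0 <= law A)%E.
Proof. exact: measure_ge0. Qed.

Let law_sigma_additive : semi_sigma_additive law.
Proof. exact: (@measure_semi_sigma_additive _ _ _ (pushforward P X)). Qed.

HB.instance Definition _ := isMeasure.Build _ _ _ law law0 law_ge0 law_sigma_additive.

Let law_setT : law setT = 1%E.
Proof. by rewrite /law /pushforward preimage_setT probability_setT. Qed.

HB.instance Definition _ := Measure_isProbability.Build _ _ _ law law_setT.

Lemma integral_law (f : T' -> R) : bounded_measurable f ->
  \int[law]_x f x = \int[P]_w f (X w).
Proof.
move=> bf; rewrite /Rintegral; congr fine.
rewrite (@integral_pushforward _ _ _ _ _ X mX P setT (EFin \o f))//.
- by case: bf => mf _; exact/measurable_EFinP.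
- rewrite preimage_setT.
  exact: (@bounded_measurable_integrable _ _ _ P _ (bounded_measurable_comp bf mX)).
Qed.

End law.

(** * Independence of a term of the sequence from the previous ones *)

Section independence.
Context (R : realType) (d d' : measure_display) (Omega : measurableType d)
  (T' : measurableType d') (P : probability Omega R) (W : nat -> Omega -> T').
Hypothesis mW : forall t, measurable_fun [set: Omega] (W t).

(** Finite index sets match the form of [mutually_independent] and make this a pi-system, so that
    measures on the generated sigma-algebra are determined by their values here. *)
Definition past_cylinder (n : nat) : set (set Omega) :=
  [set B | exists2 J : {fset nat}, (forall t, t \in J -> (t < n)%N) &
    exists2 A : nat -> set T', (forall t, measurable (A t)) &
      B = \bigcap_(t in [set` J]) (W t @^-1` A t)].

(* Omega equipped with the sigma-algebra generated by the W t, t < n. *)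
Definition past (n : nat) : measurableType (past_cylinder n).-sigma :=
  g_sigma_algebraType (past_cylinder n).

Lemma measurable_preimageT t A : measurable A -> measurable (W t @^-1` A).
Proof. by move=> mA; rewrite -[X in measurable X]setTI; exact: mW. Qed.

Lemma past_cylinder_measurable n : past_cylinder n `<=` @measurable _ Omega.
Proof.
move=> _ [J _ [A mA ->]]; apply: fin_bigcap_measurable => // t _.
exact: measurable_preimageT.
Qed.

Lemma past_measurable n (B : set Omega) :
  (@measurable _ (past n)) B -> measurable B.
Proof.
move=> mB; apply: (smallest_sub _ _ mB); first exact: sigma_algebra_measurable.
exact: past_cylinder_measurable.
Qed.

Lemma past_cylinderI n : setI_closed (past_cylinder n).
Proof.
move=> _ _ [J Jn [A mA ->]] [J' J'n [A' mA' ->]].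
exists (J `|` J')%fset.
  by move=> t; rewrite in_fsetU => /orP[/Jn//|/J'n].
exists (fun t => (if t \in J then A t else setT) `&`
                 (if t \in J' then A' t else setT)).
  by move=> t; apply: measurableI; case: ifP.
apply/seteqP; split => [w [hJ hJ'] t /= _|w h]; first split.
- by case: ifP => // tJ; exact: hJ.
- by case: ifP => // tJ; exact: hJ'.
split => t /= tJ; have /= := h t; rewrite !in_fsetU tJ ?orbT => /(_ isT)[] //.
Qed.

Lemma past_cylinderT n : past_cylinder n setT.
Proof.
exists fset0 => //; exists (fun=> setT) => //.
by apply/seteqP; split => // w _ t /=; rewrite inE.
Qed.

Lemma measurable_past n t : (t < n)%N -> measurable_fun [set: past n] (W t).
Proof.
move=> tn _ A mA; rewrite setTI; apply: sub_sigma_algebra.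
exists [fset t]%fset; first by move=> s; rewrite inE => /eqP ->.
exists (fun=> A) => //; apply/seteqP; split => [w /= wA s /=|w /(_ t)/=].
  by rewrite inE => /eqP ->.
by apply; rewrite inE.
Qed.

Lemma measurable_fun_past n d2 (T2 : measurableType d2) (f : Omega -> T2) :
  measurable_fun [set: past n] f -> measurable_fun [set: Omega] f.
Proof.
by move=> mf _ A mA; apply: (@past_measurable n); exact: mf.
Qed.

Lemma measurable_id_past n : measurable_fun [set: Omega] (id : Omega -> past n).
Proof. by move=> _ A mA; rewrite setTI; exact: past_measurable mA. Qed.

Lemma bounded_measurable_past n (f : Omega -> R) :
  bounded_measurable (f : past n -> R) -> bounded_measurable f.
Proof. by move=> [/measurable_fun_past mf bf]; split. Qed.

Hypothesis indepW : mutually_independent P W.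

(** As functions of [B] both sides are finite measures, and by independence they agree on the
    pi-system of cylinders. *)
Lemma independent_past n A B : measurable A -> (@measurable _ (past n)) B ->
  P (W n @^-1` A `&` B) = (P (W n @^-1` A) * P B)%E.
Proof.
move=> mA mB; have mWA := measurable_preimageT n mA.
pose m1 : {measure set Omega -> \bar R} := mrestr P mWA.
have p0 : 0 <= fine (P (W n @^-1` A)) by rewrite fine_ge0.
pose m2 : {measure set Omega -> \bar R} := mscale (NngNum p0) P.
have pE : (fine (P (W n @^-1` A)))%:E = P (W n @^-1` A).
  by rewrite fineK// fin_num_measure.
suff -> : P (W n @^-1` A `&` B) = m2 B by rewrite /m2/= /mscale/= pE.
rewrite setIC -[LHS]/(m1 B).
apply: (@g_sigma_algebra_measure_unique _ _ _ (past_cylinder n) _ (fun=> setT)) => //.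
- exact: past_cylinder_measurable.
- by move=> _; exact: past_cylinderT.
- by apply/seteqP; split => // w _; exists 0%N.
- exact: past_cylinderI.
- move=> _ [J Jn [A' mA' ->]].
  rewrite /m1 /m2/= /mscale/= /mrestr pE.
  pose C t := if t == n then A else A' t.
  have nJ : n \notin J by apply/negP => /Jn; rewrite ltnn.
  have mC t : measurable (C t) by rewrite /C; case: ifP.
  have CA' t : t \in J -> C t = A' t.
    by move=> /Jn tn; rewrite /C ltn_eqF.
  have -> : \bigcap_(t in [set` J]) W t @^-1` A' t `&` W n @^-1` A =
            \bigcap_(t in [set` (n |` J)%fset]) W t @^-1` C t.
    apply/seteqP; split => [w [h1 h2] t /=|w h].
      rewrite in_fset1U => /orP[/eqP ->|tJ]; first by rewrite /C eqxx.
      by rewrite CA'//; exact: h1.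
    split => [t /= tJ|].
      by rewrite -CA'//; apply: h => /=; rewrite in_fset1U tJ orbT.
    by have := h n; rewrite /= in_fset1U eqxx/= /C eqxx; exact.
  rewrite !indepW// big_fsetU1//= {1}/C eqxx; congr (_ * _)%E.
  by rewrite !big_seq; apply: eq_bigr => t tJ; rewrite CA'.
- move=> _; apply: le_lt_trans (ltry 1%R); apply: probability_le1.
  exact: measurableI.
Qed.

(** The pair ([W n], identity into [past n]) has a product law, so Fubini applies. Taking [past n]
    itself as second factor lets [F] depend on the earlier terms without listing them. Both orders
    are needed: freezing the past to use that the new term is centred, freezing the new term to sum
    over the past. *)
Lemma integral_independent_past n (F : T' * past n -> R) :
  bounded_measurable F ->
  \int[P]_w F (W n w, w) = \int[P]_w \int[P]_w' F (W n w', w) /\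
  \int[P]_w F (W n w, w) = \int[P]_w' \int[P]_w F (W n w', w).
Proof.
move=> bF.
have mpair : measurable_fun [set: Omega] (fun w => (W n w, w : past n)).
  by apply: measurable_fun_pair; [exact: mW|exact: measurable_id_past].
rewrite -(integral_law P mpair bF).
pose Q1 := law P (mW n); pose Q2 := law P (@measurable_id_past n).
have -> : \int[law P mpair]_z F z = fine (\int[(Q1 \x Q2)%E]_z (F z)%:E)%E.
  congr fine; apply: eq_measure_integral => A mA _; apply/esym.
  apply: product_measure_unique => // A1 A2 mA1 mA2.
  by rewrite /law/= /pushforward -independent_past.
have [E1 E2] := bounded_integral_prod Q1 Q2 bF.
split.
- rewrite E2 integral_law; last exact: bounded_measurable_integral1.
  by apply: eq_Rintegral => w _; rewrite integral_law//; exact: bounded_measurable_pair1.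
- rewrite E1 integral_law; last exact: bounded_measurable_integral2.
  by apply: eq_Rintegral => w _; rewrite integral_law//; exact: bounded_measurable_pair2.
Qed.

End independence.

(** * Kernel mean embeddings and the kernel covariance *)

(** Evaluation at the minimizer -b/a. Besides Cauchy-Schwarz, it serves below to measure how far a
    near-minimizer is from solving the Euler equation. *)
Lemma discriminant_le0 (R : realFieldType) (a b c : R) : 0 <= a ->
  (forall t, 0 <= t ^+ 2 * a + 2 * t * b + c) -> b ^+ 2 <= a * c.
Proof.
rewrite le_eqVlt => /predU1P[<-|a0] h.
  have [->|bn0] := eqVneq b 0; first by rewrite expr0n mul0r.
  (* With a = 0 the expression is affine in t; here it takes the value -1. *)
  have := h (- (c + 1) / (2 * b)).
  suff -> : (- (c + 1) / (2 * b)) ^+ 2 * 0 + 2 * (- (c + 1) / (2 * b)) * b + c = - 1.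
    by rewrite ler0N1.
  by field.
have := h (- b / a).
have -> : (- b / a) ^+ 2 * a + 2 * (- b / a) * b + c = (a * c - b ^+ 2) / a.
  by field; rewrite gt_eqF.
by rewrite pmulr_lge0 ?invr_gt0// subr_ge0.
Qed.

Section rkhs_theory.
Context (R : realType) (T : Type) (k : T -> T -> R) (H : rkhs k).
Implicit Types (f g h : T -> R) (a t : R).
Local Notation S := (rkhs_set H).
Local Notation ip := (rkhs_ip H).
Local Notation lincomb a f g := (fun x => a * f x + g x).

Lemma rkhs_setB f g : S f -> S g -> S (f \- g).
Proof.
move=> Sf Sg; rewrite (_ : f \- g = lincomb (-1) g f); first exact: rkhs_lincomb.
by apply/funext => x /=; ring.
Qed.

Lemma rkhs_ipBl f g h : S f -> S g -> S h -> ip (f \- g) h = ip f h - ip g h.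
Proof.
move=> Sf Sg Sh; rewrite (_ : f \- g = lincomb (-1) g f).
  by rewrite rkhs_ip_linear//; ring.
by apply/funext => x /=; ring.
Qed.

Lemma rkhs_ipBr f g h : S f -> S g -> S h -> ip h (f \- g) = ip h f - ip h g.
Proof.
by move=> Sf Sg Sh; rewrite !(rkhs_ipC Sh)//; [exact: rkhs_ipBl|exact: rkhs_setB].
Qed.

Lemma rkhs_ip_lincomb t f g : S f -> S g ->
  ip (lincomb t f g) (lincomb t f g) =
  t ^+ 2 * ip f f + 2 * t * ip g f + ip g g.
Proof.
move=> Sf Sg; have Sl := rkhs_lincomb t Sf Sg.
rewrite rkhs_ip_linear// !(rkhs_ipC _ Sl)// !rkhs_ip_linear//.
by rewrite (rkhs_ipC Sf Sg); ring.
Qed.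

Lemma rkhs_cauchy_schwarz f g : S f -> S g -> ip f g ^+ 2 <= ip f f * ip g g.
Proof.
move=> Sf Sg; rewrite mulrC; apply: discriminant_le0; first exact: rkhs_ip_ge0.
by move=> t; rewrite -rkhs_ip_lincomb//; apply/rkhs_ip_ge0/rkhs_lincomb.
Qed.

Lemma rkhs_eval_le f x : S f -> f x ^+ 2 <= k x x * ip f f.
Proof.
move=> Sf; have Sk := rkhs_kernel H x.
rewrite -(rkhs_reproducing x Sf) -(rkhs_reproducing x Sk) mulrC.
exact: rkhs_cauchy_schwarz.
Qed.

(** Such a [V] is a Hilbert space in its own right. Working in a subspace allows linear forms that
    are known to be linear only on measurable functions. *)
Definition rkhs_closed_subspace (V : set (T -> R)) :=
  [/\ V `<=` S, V (fun=> 0),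
      forall a f g, V f -> V g -> V (lincomb a f g) &
      forall (u : nat -> T -> R) f, (forall n, V (u n)) -> S f ->
        ip (u n \- f) (u n \- f) @[n --> \oo] --> (0 : R) -> V f].

(* The representer is the limit of a minimizing sequence of <f, f> - 2 L f,
   which is Cauchy by the parallelogram law. *)
Lemma rkhs_riesz (V : set (T -> R)) (L : (T -> R) -> R) (C : R) :
  rkhs_closed_subspace V ->
  (forall a f g, V f -> V g -> L (lincomb a f g) = a * L f + L g) ->
  (forall f, V f -> L f ^+ 2 <= C * ip f f) ->
  exists2 m, V m & forall h, V h -> ip h m = L h.
Proof.
move=> [VS V0 Vl Vc] Llin Lb.
pose J f := ip f f - 2 * L f.
have JE t f g : V f -> V g ->
    J (lincomb t f g) = t ^+ 2 * ip f f + 2 * t * (ip g f - L f) + J g.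
  move=> Vf Vg; rewrite /J rkhs_ip_lincomb ?Llin//; [ring|exact: VS|exact: VS].
(* With N = <f, f> and D = |C|: if 2 L f > N + D + 1, squaring gives (N + D + 1)^2 < 4 D N, against
   4 D N <= (N + D)^2. *)
have Jlb f : V f -> - (`|C| + 1) <= J f.
  move=> Vf; have := Lb _ Vf; have := ler_norm C.
  have := rkhs_ip_ge0 (VS _ Vf); have := normr_ge0 C.
  rewrite /J; move: (ip f f) (L f) `|C| => N l D D0 N0 CD lCN.
  have lDN : l ^+ 2 <= D * N by rewrite (le_trans lCN)// ler_wpM2r.
  rewrite leNgt; apply/negP => lt_l.
  have : (N + D + 1) * (N + D + 1) < (2 * l) * (2 * l) by apply: ltr_pM; lra.
  have := sqr_ge0 (N - D); rewrite !expr2 in lDN *; lra.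
pose A := [set J f | f in V].
have infA : has_inf A.
  by split; [exists (J (fun=> 0)), (fun=> 0)|exists (- (`|C| + 1)) => _ [f Vf <-]; exact: Jlb].
have infle f : V f -> inf A <= J f by move=> Vf; apply: ge_inf; [case: infA|exists f].
have /choice[u uP] : forall n : nat, exists f, V f /\ J f < inf A + n.+1%:R^-1.
  move=> n; have [|_ [f Vf <-] Jf] := @inf_adherent _ A n.+1%:R^-1 _ infA.
    by rewrite invr_gt0.
  by exists f.
have Vu n : V (u n) by case: (uP n).
have Su n : S (u n) by exact: VS.
(* Approximate Euler equation: [u n] minimizes [J] up to 1/(n+1), so a quadratic in t with constant
   term 1/(n+1) is nonnegative along the direction [h]. *)
have uD n h : V h -> (ip (u n) h - L h) ^+ 2 <= ip h h * n.+1%:R^-1.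
  move=> Vh; apply: discriminant_le0; first by apply: rkhs_ip_ge0; exact: VS.
  move=> t; have := infle _ (Vl t _ _ Vh (Vu n)); rewrite JE//.
  have [_] := uP n.
  by move: (_^-1) (J _) (_ - L h) (ip h h) (inf A) => q j D N i h1 h2; lra.
have [|m Sm um] := rkhs_complete Su.
  move=> e e0.
  have [N _ hN] : \forall n \near \oo, n.+1%:R^-1 < e / 4.
    apply: (@cvgr_lt _ _ _ _ (fun n : nat => n.+1%:R^-1) (0 : R)) (@cvg_harmonic R) _ _.
    by rewrite divr_gt0.
  exists N => i j Ni Nj.
  have small n : (N <= n)%N -> J (u n) < inf A + e / 4.
    by move=> Nn; have [_ Jn] := uP n; rewrite (lt_trans Jn)// ltrD2l; exact: hN.
  have := small _ Ni; have := small _ Nj.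
  have Vw := Vl (-1) _ _ (Vu j) (Vu i).
  (* The midpoint of [u i] and [u j] has [J] equal to the mean of the two values minus |u i - u j|^2
     / 4. As this is at least the infimum, the margin e/4 gives |u i - u j|^2 < e. *)
  have := infle _ (Vl 2^-1 _ _ Vw (Vu j)); rewrite (JE 2^-1 _ _ Vw (Vu j)).
  have -> : ip (lincomb (-1) (u j) (u i)) (lincomb (-1) (u j) (u i)) =
      ip (u i) (u i) - 2 * ip (u i) (u j) + ip (u j) (u j).
    by rewrite rkhs_ip_lincomb//; ring.
  have -> : ip (u j) (lincomb (-1) (u j) (u i)) = ip (u i) (u j) - ip (u j) (u j).
    by rewrite (rkhs_ipC (Su j)) ?rkhs_ip_linear//; [ring|exact: VS].
  have -> : ip (u i \- u j) (u i \- u j) =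
      ip (u i) (u i) - 2 * ip (u i) (u j) + ip (u j) (u j).
    rewrite rkhs_ipBl ?rkhs_ipBr//; last exact: rkhs_setB.
    by rewrite (rkhs_ipC (Su j) (Su i)); ring.
  rewrite Llin// /J.
  move: (ip (u i) (u i)) (ip (u i) (u j)) (ip (u j) (u j)) (L _) (L _) (inf A).
  move=> a b c p q r; lra.
have Vm := Vc u m Vu Sm um.
exists m => // h Vh; have Sh := VS _ Vh.
rewrite rkhs_ipC//; apply/eqP; rewrite -subr_eq0 -sqrf_eq0; apply/negPn/negP => D0.
have {}D0 : 0 < (ip m h - L h) ^+ 2 by rewrite lt_neqAle eq_sym D0 sqr_ge0.
set D := _ ^+ 2 in D0; set N := ip h h.
have N0 : 0 <= N by exact: rkhs_ip_ge0.
(* For large n, D is at most 2 N e from the Euler equation plus 2 e N from the convergence of [u] to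
   [m]; the sum 4 N e is less than 4 (N + 1) e = D. *)
pose e := D / (4 * (N + 1)).
have e0 : 0 < e by rewrite divr_gt0// mulr_gt0// ltr_wpDl.
have : \forall n \near \oo, ip (u n \- m) (u n \- m) < e.
  by apply: (cvgr_lt (0 : R)).
have : \forall n \near \oo, n.+1%:R^-1 < e.
  exact: (@cvgr_lt _ _ _ _ (fun n : nat => n.+1%:R^-1) (0 : R) (@cvg_harmonic R)).
move=> h1 h2; have [n [/= n1 n2]] := @filter_ex _ _ _ _ (filterI h1 h2).
have : (ip (u n \- m) h) ^+ 2 <= ip (u n \- m) (u n \- m) * N.
  by apply: rkhs_cauchy_schwarz => //; exact: rkhs_setB.
have := uD n _ Vh; rewrite -/N rkhs_ipBl//.
have DE : D = e * (4 * (N + 1)) by rewrite /e divfK// gt_eqF// mulr_gt0// ltr_wpDl.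
have : D <= 2 * (ip (u n) h - L h) ^+ 2 + 2 * (ip (u n) h - ip m h) ^+ 2.
  rewrite /D; move: (ip m h) (ip (u n) h) (L h) => a b l.
  by have := sqr_ge0 ((b - l) + (b - a)); lra.
set x := (_ - L h) ^+ 2; set y := (_ - ip m h) ^+ 2.
set p := ip (_ \- _) _ in n2 *.
set q := _^-1 in n1 *.
have : N * q <= N * e by rewrite ler_wpM2l// ltW.
have : p * N <= e * N by rewrite ler_wpM2r// ltW.
rewrite DE; nra.
Qed.

End rkhs_theory.

Section kernel_mean_embedding.
Context (R : realType) (dT : measure_display) (T : measurableType dT).
Context (k : T -> T -> R) (kker : is_kernel k) (H : rkhs k).
Local Notation S := (rkhs_set H).
Local Notation ip := (rkhs_ip H).

Lemma kernel_bounded_measurable :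
  bounded_measurable (fun z : T * T => k z.1 z.2).
Proof. by case: kker => mk [C kC] _ _; split => //; exists C => z. Qed.

Lemma kernelC x y : k x y = k y x.
Proof. by case: kker. Qed.

Lemma bounded_measurable_kernelr x : bounded_measurable (k x).
Proof.
apply: (bounded_measurable_comp kernel_bounded_measurable (h := fun y => (x, y))).
by apply: measurable_fun_pair.
Qed.

Lemma bounded_measurable_kernell y : bounded_measurable (k^~ y).
Proof.
by under eq_fun do rewrite kernelC; exact: bounded_measurable_kernelr.
Qed.

Lemma rkhs_eval_bound : exists2 C, 0 < C &
  forall f x, S f -> f x ^+ 2 <= C * ip f f.
Proof.
have [C C0 kC] := bounded_measurable_bound kernel_bounded_measurable.
exists C => // f x Sf; apply: (le_trans (rkhs_eval_le x Sf)).
by rewrite ler_wpM2r ?rkhs_ip_ge0// (le_trans (ler_norm _))// (kC (x, x)).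
Qed.

Lemma rkhs_cvg_pointwise (u : nat -> T -> R) f x :
  (forall n, S (u n)) -> S f ->
  ip (u n \- f) (u n \- f) @[n --> \oo] --> (0 : R) ->
  u n x @[n --> \oo] --> f x.
Proof.
move=> Su Sf uf; have [C C0 evC] := rkhs_eval_bound.
apply/cvgrPdist_lt => e e0.
have eC : 0 < e ^+ 2 / C by rewrite divr_gt0// exprn_gt0.
near=> n; rewrite -ltr_sqr ?nnegrE ?normr_ge0 ?(ltW e0)// real_normK ?num_real//.
have := evC _ x (rkhs_setB (Su n) Sf); rewrite -sqrrN opprB => /le_lt_trans; apply.
rewrite mulrC -ltr_pdivlMr//.
near: n; exact: (cvgr_lt (0 : R)).
Unshelve. all: by end_near. Qed.

(** Evaluations are continuous, so norm limits are pointwise limits, and these preserve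
    measurability. *)
Lemma rkhs_measurable_closed :
  rkhs_closed_subspace H [set f | S f /\ measurable_fun setT f].
Proof.
split.
- by move=> f [].
- by split; [exact: rkhs_zero|].
- move=> a f g [Sf mf] [Sg mg]; split; first exact: rkhs_lincomb.
  by apply: measurable_funD => //; exact: measurable_funM.
- move=> u f uP Sf uf; split => //.
  apply: (measurable_fun_cvg (h := u)); first by move=> n; case: (uP n).
  by move=> x _; apply: rkhs_cvg_pointwise => // n; case: (uP n).
Qed.

(* The orthogonal projection of an element on the measurable ones has the same
   values, by the reproducing property. *)
Lemma rkhs_bounded_measurable f : S f -> bounded_measurable f.
Proof.
move=> Sf; split; last first.
  have [C C0 evC] := rkhs_eval_bound.
  exists (Num.sqrt (C * ip f f)) => x.
  by rewrite -sqrtr_sqr ler_wsqrtr// evC.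
have [||m [Sm mm] mE] := @rkhs_riesz _ _ _ H _ (fun g => ip g f) (ip f f)
    rkhs_measurable_closed.
- by move=> a g h [Sg _] [Sh _]; rewrite rkhs_ip_linear.
- by move=> g [Sg _]; rewrite mulrC rkhs_cauchy_schwarz.
suff -> : f = m by [].
apply/funext => x; have Sk := rkhs_kernel H x.
have mk : measurable_fun setT (k x) by case: (bounded_measurable_kernelr x).
rewrite -(rkhs_reproducing x Sf) -(rkhs_reproducing x Sm).
by rewrite (rkhs_ipC Sf Sk) (rkhs_ipC Sm Sk) mE.
Qed.

(** Since |f| <= sqrt(C <f, f>) pointwise, integration against [Q] is a bounded linear form. Testing
    its representer against [k y] gives int k(y, x) dQ(x), which is the embedding at y; the
    embedding thus belongs to the space. *)
Lemma kmeanP (Q : pprobability T R) :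
  S (kmean k Q) /\ forall h, S h -> ip h (kmean k Q) = \int[Q]_x h x.
Proof.
have [C C0 evC] := rkhs_eval_bound.
have [||m [Sm mm] mE] := @rkhs_riesz _ _ _ H _ (fun g => \int[Q]_x g x) C
    rkhs_measurable_closed.
- move=> a f g [/rkhs_bounded_measurable bf _] [/rkhs_bounded_measurable bg _].
  by rewrite bounded_integralD ?bounded_integralZ//; exact: bounded_measurableZ.
- move=> f [Sf _]; have bf := rkhs_bounded_measurable Sf.
  have fC x : `|f x| <= Num.sqrt (C * ip f f).
    by rewrite -sqrtr_sqr ler_wsqrtr// evC.
  have N0 : 0 <= C * ip f f by rewrite mulr_ge0 ?rkhs_ip_ge0// ltW.
  rewrite -[leRHS]sqr_sqrtr// -[leLHS]real_normK ?num_real//.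
  by rewrite ler_sqr ?nnegrE ?sqrtr_ge0//; exact: norm_bounded_integral.
suff -> : kmean k Q = m.
  by split => // h Sh; apply: mE; split => //; case: (rkhs_bounded_measurable Sh).
apply/funext => y; have Sk := rkhs_kernel H y.
have mk : measurable_fun setT (k y) by case: (bounded_measurable_kernelr y).
rewrite -(rkhs_reproducing y Sm) (rkhs_ipC Sm Sk) mE//.
by apply: eq_Rintegral => x _; rewrite kernelC.
Qed.

End kernel_mean_embedding.

(** * Mixtures of product measures *)

Section cond_independent_integral.
Context (R : realType) (dT : measure_display) (T : measurableType dT).
Context (d : measure_display) (Omega : measurableType d).
Context (P : probability Omega R).
Context (Q1 Q2 : Omega -> pprobability T R).
Hypothesis mQ1 : measurable_fun setT Q1.
Hypothesis mQ2 : measurable_fun setT Q2.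
Context (Z1 Z2 : Omega -> T).
Hypothesis mZ1 : measurable_fun setT Z1.
Hypothesis mZ2 : measurable_fun setT Z2.
Hypothesis Z12 : forall A B, measurable A -> measurable B ->
  P (Z1 @^-1` A `&` Z2 @^-1` B) = (\int[P]_w (fine (Q1 w A) * fine (Q2 w B))%:E)%E.

(** Seen in the Giry monad, the random probabilities have measurable products, and integrals are
    measurable functions of the measure. *)
Let giryQ (Q : Omega -> pprobability T R) : Omega -> giry T R := fun w => Q w.

Let measurable_giryQ (Q : Omega -> pprobability T R) :
  measurable_fun setT Q -> measurable_fun setT (giryQ Q).
Proof.
move=> mQ; apply: measurable_giry_codensity => // B mB.
exact: (measurable_kernel (kprobability mQ)).
Qed.

Let mprodQ : measurable_fun [set: Omega]
  (fun w => giry_prod (giryQ Q1 w, giryQ Q2 w)).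
Proof.
apply: (measurableT_comp measurable_giry_prod).
by apply: measurable_fun_pair; exact: measurable_giryQ.
Qed.

(** The law of (Z1, Z2) is the Giry bind of [P] with the kernel w -> Q1 w x Q2 w: by [Z12] the two
    measures agree on rectangles, which form a generating pi-system. *)
Lemma cond_independent_ge0_integral (F : T * T -> \bar R) :
  measurable_fun setT F -> (forall z, 0 <= F z)%E ->
  (\int[P]_w F (Z1 w, Z2 w) = \int[P]_w \int[Q1 w]_x \int[Q2 w]_y F (x, y))%E.
Proof.
move=> mF F0.
have mZ : measurable_fun setT (fun w => (Z1 w, Z2 w)) by exact: measurable_fun_pair.
pose m : giry (T * T)%type R := giry_bind (P : giry Omega R) mprodQ.
transitivity (\int[law P mZ]_z F z)%E.
  rewrite (@ge0_integral_pushforward _ _ _ _ _ _ mZ P setT F)//.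
transitivity (giry_int m F).
  apply: eq_measure_integral => A mA _.
  apply: (@g_sigma_algebra_measure_unique _ _ _
    [set A `*` B | A in measurable & B in measurable] _ (fun=> setT)) => //.
  - by move=> _ [B mB [C mC <-]]; exact: measurableX.
  - by move=> _; exists setT => //; exists setT => //; rewrite setXTT.
  - by apply/seteqP; split => // w _; exists 0%N.
  - move=> _ _ [A1 mA1 [A2 mA2 <-]] [B1 mB1 [B2 mB2 <-]].
    exists (A1 `&` B1); first exact: measurableI.
    exists (A2 `&` B2); first exact: measurableI.
    by rewrite setXI.
  - move=> _ [B mB [C mC <-]].
    rewrite /= /law /pushforward.
    transitivity (\int[P]_w (Q1 w B * Q2 w C))%E.
      rewrite [LHS]Z12//; apply: eq_integral => w _.
      by rewrite EFinM !fineK// fin_num_measure.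
    transitivity (giry_int m (EFin \o \1_(B `*` C))); last first.
      by rewrite /giry_int integral_indic ?setIT//; exact: measurableX.
    apply/esym; rewrite giry_int_bind//.
      apply: eq_integral => w _.
      rewrite /giry_int integral_indic ?setIT//; last exact: measurableX.
      by apply: product_measure1E.
      by apply/measurable_EFinP; apply: measurable_indic; exact: measurableX.
    by move=> z; rewrite lee_fin.
  - by move=> n; rewrite -ge0_fin_numE// fin_num_measure.
  - by rewrite -measurable_prod_measurableType.
rewrite giry_int_bind//; apply: eq_integral => w _.
by rewrite giry_int_prod1.
Qed.

(** Adding a bound [C] of |F| reduces to the nonnegative case, from which the measurability in w is
    also inherited. *)
Lemma bounded_measurable_iterated_integral (F : T * T -> R) :
  bounded_measurable F ->
  bounded_measurable (fun w => \int[Q1 w]_x \int[Q2 w]_y F (x, y)) /\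
  \int[P]_w F (Z1 w, Z2 w) = \int[P]_w \int[Q1 w]_x \int[Q2 w]_y F (x, y).
Proof.
move=> bF; have [mF _] := bF; have [C C0 FC] := bounded_measurable_bound bF.
pose F' z := (F z + C)%:E.
have mF' : measurable_fun setT F' by apply/measurable_EFinP; exact: measurable_funD.
have F'0 z : (0 <= F' z)%E.
  by rewrite lee_fin -lerBlDr sub0r; have := FC z; rewrite ler_norml => /andP[].
have bF2 x : bounded_measurable (fun y => F (x, y)).
  by split; [exact: measurable_fun_pair2|exists C => y].
have bF1 (q : probability T R) := bounded_measurable_integral2 q bF.
have F'E w : (\int[Q1 w]_x \int[Q2 w]_y F' (x, y))%E =
    (\int[Q1 w]_x \int[Q2 w]_y F (x, y) + C)%:E.
  transitivity (\int[Q1 w]_x (\int[Q2 w]_y F (x, y) + C)%:E)%E.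
    apply: eq_integral => x _.
    rewrite EFin_bounded_integral; last first.
      exact: bounded_measurableD (bF2 x) (bounded_measurable_cst _).
    rewrite bounded_integralD ?bounded_integral_cst//.
    exact: bounded_measurable_cst.
  rewrite EFin_bounded_integral; last first.
    exact: bounded_measurableD (bF1 _) (bounded_measurable_cst _).
  rewrite bounded_integralD ?bounded_integral_cst//.
  exact: bounded_measurable_cst.
have bG : bounded_measurable (fun w => \int[Q1 w]_x \int[Q2 w]_y F (x, y)).
  split; last first.
    exists C => w; apply: norm_bounded_integral => // x.
    exact: norm_bounded_integral.
  have mG : measurable_fun setT (fun w => (\int[Q1 w]_x \int[Q2 w]_y F' (x, y))%E).
    have := measurableT_comp (measurable_giry_int mF' F'0) mprodQ.
    by apply: eq_measurable_fun => w _ /=; rewrite giry_int_prod1.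
  apply/measurable_EFinP.
  have := emeasurable_funB mG (measurable_cst C%:E).
  by apply: eq_measurable_fun => w _; rewrite /= F'E -EFinB addrK.
split => //.
apply: (@addIr _ C); apply: EFin_inj.
rewrite -[X in _ + X](bounded_integral_cst P C) -[X in _ = (_ + X)%:E](bounded_integral_cst P C).
have bFZ : bounded_measurable (fun w => F (Z1 w, Z2 w)).
  by apply: (bounded_measurable_comp bF); exact: measurable_fun_pair.
rewrite -!bounded_integralD//; [|exact: bounded_measurable_cst..].
rewrite -!EFin_bounded_integral.
- rewrite (cond_independent_ge0_integral mF' F'0).
  by apply: eq_integral => w _; rewrite F'E.
- exact: bounded_measurableD bG (bounded_measurable_cst _).
- exact: bounded_measurableD bFZ (bounded_measurable_cst _).
Qed.

End cond_independent_integral.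

Section kcov_formula.
Context (R : realType) (dT : measure_display) (T : measurableType dT).
Context (k : T -> T -> R) (kker : is_kernel k) (H : rkhs k).
Context (d : measure_display) (Omega : measurableType d).
Context (P : probability Omega R).
Context (Q1 Q2 : Omega -> pprobability T R).
Hypothesis mQ1 : measurable_fun setT Q1.
Hypothesis mQ2 : measurable_fun setT Q2.
Context (Z1 Z2 : Omega -> T).
Hypothesis mZ1 : measurable_fun setT Z1.
Hypothesis mZ2 : measurable_fun setT Z2.
Hypothesis Z12 : forall A B, measurable A -> measurable B ->
  P (Z1 @^-1` A `&` Z2 @^-1` B) = (\int[P]_w (fine (Q1 w A) * fine (Q2 w B))%:E)%E.
Local Notation S := (rkhs_set H).
Local Notation ip := (rkhs_ip H).

(** [m] acts as the mean measure of [Q]. The weak expectation is unique because testing it against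
    [k x] recovers its value at x, so the choice made by [xget] is forced. *)
Lemma rkhs_expectation_kmean (Q : Omega -> pprobability T R) (m : pprobability T R) :
  (forall h, S h -> bounded_measurable (fun w => \int[Q w]_x h x) /\
     \int[m]_x h x = \int[P]_w \int[Q w]_x h x) ->
  rkhs_expectation H P (fun w => kmean k (Q w)) = kmean k m.
Proof.
move=> hQ; have [Sm mE] := kmeanP kker H m.
apply: xget_unique => [|f [Sf fE]].
  split => // h Sh; have [bh hE] := hQ _ Sh.
  have ipE w : ip h (kmean k (Q w)) = \int[Q w]_x h x.
    by have [_ ->] := kmeanP kker H (Q w).
  rewrite mE//; split.
    by under eq_fun => w do rewrite ipE; apply: bounded_measurable_integrable bh.
  by under [RHS]eq_Rintegral do rewrite ipE.
apply/funext => x; have Sk := rkhs_kernel H x.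
rewrite -(rkhs_reproducing x Sf) -(rkhs_reproducing x Sm).
rewrite (rkhs_ipC Sf Sk) (rkhs_ipC Sm Sk) mE// (fE _ Sk).2 (hQ _ Sk).2.
by apply: eq_Rintegral => w _; have [_ ->] := kmeanP kker H (Q w).
Qed.

(** The mean measure of [Qi] is the law of [Zi]. Expanding the inner product of the centred
    embeddings, both cross terms integrate to <m1, m2>, and one copy of it remains with a minus
    sign. *)
Lemma kcovE : kcov H P Q1 Q2 = \int[P]_w k (Z1 w) (Z2 w) -
  \int[P]_w \int[P]_w' k (Z1 w) (Z2 w').
Proof.
have mean1 h : S h -> bounded_measurable (fun w => \int[Q1 w]_x h x) /\
     \int[law P mZ1]_x h x = \int[P]_w \int[Q1 w]_x h x.
  move=> Sh; have bh := rkhs_bounded_measurable kker Sh.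
  have bF : bounded_measurable (fun z : T * T => h z.1).
    by apply: (bounded_measurable_comp bh); exact: measurable_fst.
  (* A function of one variable is viewed as a function on pairs, so that the two-variable formula
     yields the marginal one. *)
  have E : (fun w => \int[Q1 w]_x h x) =
      (fun w => \int[Q1 w]_x \int[Q2 w]_y (fun z : T * T => h z.1) (x, y)).
    apply/funext => w; apply: eq_Rintegral => x _.
    by rewrite /= bounded_integral_cst.
  have [b1 b2] := bounded_measurable_iterated_integral mQ1 mQ2 mZ1 mZ2 Z12 bF.
  by rewrite E integral_law// -b2.
have mean2 h : S h -> bounded_measurable (fun w => \int[Q2 w]_x h x) /\
     \int[law P mZ2]_x h x = \int[P]_w \int[Q2 w]_x h x.
  move=> Sh; have bh := rkhs_bounded_measurable kker Sh.
  have bF : bounded_measurable (fun z : T * T => h z.2).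
    by apply: (bounded_measurable_comp bh); exact: measurable_snd.
  have E : (fun w => \int[Q2 w]_x h x) =
      (fun w => \int[Q1 w]_x \int[Q2 w]_y (fun z : T * T => h z.2) (x, y)).
    by apply/funext => w; rewrite /= bounded_integral_cst.
  have [b1 b2] := bounded_measurable_iterated_integral mQ1 mQ2 mZ1 mZ2 Z12 bF.
  by rewrite E integral_law// -b2.
rewrite /kcov (rkhs_expectation_kmean mean1) (rkhs_expectation_kmean mean2).
set m1 := kmean k (law P mZ1); set m2 := kmean k (law P mZ2).
have [Sm1 m1E] := kmeanP kker H (law P mZ1 : pprobability T R).
have [Sm2 m2E] := kmeanP kker H (law P mZ2 : pprobability T R).
have [bG GE] := bounded_measurable_iterated_integral mQ1 mQ2 mZ1 mZ2 Z12
  (kernel_bounded_measurable kker).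
have ipE w : ip (kmean k (Q1 w) \- m1) (kmean k (Q2 w) \- m2) =
    \int[Q1 w]_x \int[Q2 w]_y k x y - \int[Q2 w]_y m1 y - \int[Q1 w]_x m2 x
    + ip m1 m2.
  have [S1 h1] := kmeanP kker H (Q1 w); have [S2 h2] := kmeanP kker H (Q2 w).
  rewrite rkhs_ipBl ?rkhs_ipBr//; last exact: rkhs_setB.
  rewrite (rkhs_ipC S1 S2) (rkhs_ipC S1 Sm2) !h1// h2//.
  rewrite (_ : kmean k (Q2 w) = (fun x => \int[Q2 w]_y k x y)); first by ring.
  by apply/funext => x; apply: eq_Rintegral => y _; rewrite kernelC.
have [b1 i1] := mean1 _ Sm2; have [b2 i2] := mean2 _ Sm1.
transitivity (\int[P]_w (\int[Q1 w]_x \int[Q2 w]_y k x y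
  - \int[Q2 w]_y m1 y - \int[Q1 w]_x m2 x + ip m1 m2)).
  by apply: eq_Rintegral => w _; rewrite ipE.
have bB1 := bounded_measurableB bG b2.
have bB2 := bounded_measurableB bB1 b1.
rewrite bounded_integralD// ?bounded_integral_cst; last exact: bounded_measurable_cst.
rewrite bounded_integralB// bounded_integralB//.
rewrite -[X in _ - X + _]i1 -[X in _ - X - _ + _]i2 -GE.
rewrite -m1E// -m2E// (rkhs_ipC Sm2 Sm1) /= addrNK; congr (_ - _).
rewrite (rkhs_ipC Sm1 Sm2) m1E// integral_law; last by have := rkhs_bounded_measurable kker Sm2.
apply: eq_Rintegral => w _; rewrite /m2/= /kmean.
transitivity (\int[law P mZ2]_x k x (Z1 w)) => //.
rewrite integral_law; last exact: bounded_measurable_kernell.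
by apply: eq_Rintegral => w' _; rewrite kernelC.
Qed.

End kcov_formula.

(** * Linearization of the covariance estimator *)

(** Grouping (t, s) with (s, t) orders the double sum by its larger index, which prepares
    conditioning on the past. *)
Lemma sum_offdiag (V : nmodType) (h : nat -> nat -> V) n :
  \sum_(t < n) \sum_(s < n) h t s =
  \sum_(t < n) h t t + \sum_(t < n) \sum_(s < t) (h t s + h s t).
Proof.
elim: n => [|n IH]; first by rewrite !big_ord0 addr0.
rewrite [LHS]big_ord_recr/=.
under eq_bigr do rewrite big_ord_recr/=.
rewrite big_split/= IH big_ord_recr/= !(@big_ord_recr _ _ _ n)/= big_split/=.
by rewrite (AC (3*2) ((1*5)*(2*(4*3)))).
Qed.

(* The marginal terms of the Hoeffding decomposition cancel. *)
Lemma cov_est_hoeffding (R : realFieldType) (h : nat -> nat -> R)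
    (g1 g2 : nat -> R) (b : R) (M : nat) : (1 < M)%N ->
  (M%:R - 1)^-1 * (\sum_(t < M) (h t t + g1 t + g2 t - b)) -
  ((M%:R - 1) * M%:R)^-1 *
    (\sum_(t < M) \sum_(s < M) (h t s + g1 t + g2 s - b)) =
  M%:R^-1 * (\sum_(t < M) h t t) -
  ((M%:R - 1) * M%:R)^-1 * (\sum_(t < M) \sum_(s < t) (h t s + h s t)).
Proof.
move=> M1.
have M0 : M%:R != 0 :> R by rewrite pnatr_eq0 -lt0n ltnW.
have M10 : M%:R - 1 != 0 :> R by rewrite subr_eq0 pnatr_eq1 gtn_eqF.
have -> : \sum_(t < M) \sum_(s < M) (h t s + g1 t + g2 s - b) =
    \sum_(t < M) \sum_(s < M) h t s + M%:R * (\sum_(t < M) g1 t) +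
    M%:R * (\sum_(t < M) g2 t) - M%:R * M%:R * b.
  have row t : \sum_(s < M) (h t s + g1 t + g2 s - b) =
      \sum_(s < M) h t s + M%:R * g1 t + \sum_(s < M) g2 s + M%:R * - b.
    by rewrite !big_split/= !sumr_const card_ord -(mulr_natl (g1 t)) -(mulr_natl (- b)).
  under eq_bigr do rewrite row.
  rewrite !big_split/= -mulr_sumr !sumr_const card_ord.
  by rewrite -[(\sum_(_ < _) _) *+ M]mulr_natl -[(_ * - b) *+ M]mulr_natl; ring.
have -> : \sum_(t < M) (h t t + g1 t + g2 t - b) = \sum_(t < M) h t t +
    \sum_(t < M) g1 t + \sum_(t < M) g2 t - M%:R * b.
  by rewrite !big_split/= sumr_const card_ord -(mulr_natl (- b)) mulrN.
(* The diagonal of [h] receives the coefficient 1/(M - 1) - 1/((M - 1) M) = 1/M. *)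
rewrite sum_offdiag.
by field; rewrite M0 M10.
Qed.

(** * Second moments of i.i.d. sums and of degenerate double sums *)

Section iid.
Context (R : realType) (d d' : measure_display) (Omega : measurableType d)
  (T' : measurableType d') (P : probability Omega R) (Q : probability T' R)
  (W : nat -> Omega -> T').
Hypothesis mW : forall t, measurable_fun [set: Omega] (W t).
Hypothesis indepW : mutually_independent P W.
Hypothesis lawW : forall t A, measurable A -> P (W t @^-1` A) = Q A.

Lemma integral_iid t (f : T' -> R) : bounded_measurable f ->
  \int[P]_w f (W t w) = \int[Q]_z f z.
Proof.
move=> bf; rewrite -(integral_law P (mW t) bf); congr fine.
by apply: eq_measure_integral => A mA _; exact: lawW.
Qed.

Lemma bounded_measurable_past_comp n t (f : T' -> R) : (t < n)%N ->
  bounded_measurable f -> bounded_measurable (fun w : past W n => f (W t w)).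
Proof.
by move=> tn bf; apply: (bounded_measurable_comp bf); exact: measurable_past.
Qed.

Lemma bounded_measurable_sum_iid n (f : T' -> R) : bounded_measurable f ->
  bounded_measurable (fun w : past W n => \sum_(t < n) f (W t w)).
Proof.
move=> bf; apply: bounded_measurable_sum => t.
by apply: bounded_measurable_past_comp.
Qed.

Lemma integral_sqr_sum_iid (f : T' -> R) (C : R) n : bounded_measurable f ->
  (forall z, `|f z| <= C) -> \int[Q]_z f z = 0 ->
  \int[P]_w (\sum_(t < n) f (W t w)) ^+ 2 <= C ^+ 2 * n%:R.
Proof.
move=> bf fC f0; elim: n => [|n IH].
  rewrite mulr0; under eq_Rintegral do rewrite big_ord0 expr0n.
  by rewrite bounded_integral_cst.
pose S w := \sum_(t < n) f (W t w).
have bS : bounded_measurable (S : past W n -> R) by exact: bounded_measurable_sum_iid.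
have bSO := bounded_measurable_past mW bS.
have bfW : bounded_measurable (fun w => f (W n w)).
  exact: bounded_measurable_comp bf (mW n).
have cross : \int[P]_w (S w * f (W n w)) = 0.
  have bF : bounded_measurable (fun z : T' * past W n => S z.2 * f z.1).
    apply: bounded_measurableM.
      by apply: (bounded_measurable_comp bS); exact: measurable_snd.
    by apply: (bounded_measurable_comp bf); exact: measurable_fst.
  have [-> _] := integral_independent_past mW indepW bF.
  rewrite -[RHS](bounded_integral_cst P 0); apply: eq_Rintegral => w _ /=.
  by rewrite bounded_integralZ// integral_iid// f0 mulr0.
have -> : \int[P]_w (\sum_(t < n.+1) f (W t w)) ^+ 2 =
    \int[P]_w (S w ^+ 2 + 2 * (S w * f (W n w)) + f (W n w) ^+ 2).
  by apply: eq_Rintegral => w _; rewrite big_ord_recr/= -/(S w); ring.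
have b1 := bounded_measurableX 2 bSO.
have b2 := bounded_measurableZ 2 (bounded_measurableM bSO bfW).
have b3 := bounded_measurableX 2 bfW.
rewrite bounded_integralD//; last exact: bounded_measurableD b1 b2.
rewrite bounded_integralD// bounded_integralZ; last exact: bounded_measurableM bSO bfW.
rewrite cross mulr0 addr0 mulrSr mulrDr mulr1 lerD//.
apply: bounded_integral_le => // w.
rewrite -real_normK ?num_real// ler_sqr ?nnegrE//.
exact: le_trans (fC (W n w)).
Qed.

(* The increment at time n is centred given the past, and is a sum of centred
   i.i.d. variables given W n. *)
Lemma integral_sqr_degenerate (q : T' * T' -> R) (C : R) n :
  bounded_measurable q -> (forall z, `|q z| <= C) ->
  (forall z, \int[Q]_z' q (z, z') = 0) -> (forall z', \int[Q]_z q (z, z') = 0) ->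
  \int[P]_w (\sum_(t < n) \sum_(s < t) q (W t w, W s w)) ^+ 2 <= C ^+ 2 * n%:R ^+ 2.
Proof.
move=> bq qC q1 q2; elim: n => [|n IH].
  rewrite expr0n mulr0; under eq_Rintegral do rewrite big_ord0 expr0n.
  by rewrite bounded_integral_cst.
have bq1 z : bounded_measurable (fun z' => q (z, z')).
  by apply: (bounded_measurable_comp bq); exact: measurable_fun_pair.
have bq2 z' : bounded_measurable (fun z => q (z, z')).
  by apply: (bounded_measurable_comp bq); exact: measurable_fun_pair.
pose S w := \sum_(t < n) \sum_(s < t) q (W t w, W s w).
pose D (z : T' * past W n) := \sum_(s < n) q (z.1, W s z.2).
have bS : bounded_measurable (S : past W n -> R).
  apply: bounded_measurable_sum => t; apply: bounded_measurable_sum => s.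
  apply: (bounded_measurable_comp bq).
  apply: measurable_fun_pair; apply: measurable_past => //.
  exact: ltn_trans (ltn_ord s) (ltn_ord t).
have bSO := bounded_measurable_past mW bS.
have bD : bounded_measurable D.
  apply: bounded_measurable_sum => s; apply: (bounded_measurable_comp bq).
  apply: measurable_fun_pair; first exact: measurable_fst.
  apply: (@measurableT_comp _ _ _ _ _ _ (W s : past W n -> T')) => //.
  by apply: measurable_past.
have mpair : measurable_fun [set: Omega] (fun w => (W n w, w : past W n)).
  by apply: measurable_fun_pair => //; exact: measurable_id_past.
have bDO : bounded_measurable (fun w => D (W n w, w)).
  exact: (bounded_measurable_comp bD mpair).
have cross : \int[P]_w (S w * D (W n w, w)) = 0.
  have bF : bounded_measurable (fun z : T' * past W n => S z.2 * D z).
    apply: bounded_measurableM => //.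
    by apply: (bounded_measurable_comp bS); exact: measurable_snd.
  have [-> _] := integral_independent_past mW indepW bF.
  rewrite -[RHS](bounded_integral_cst P 0); apply: eq_Rintegral => w _ /=.
  have bqW (s : 'I_n) : bounded_measurable (fun w' => q (W n w', W s w)).
    exact: (bounded_measurable_comp (bq2 (W s w)) (mW n)).
  rewrite bounded_integralZ/D/=; last exact: bounded_measurable_sum.
  rewrite bounded_integral_sum// big1 ?mulr0// => s _.
  by rewrite (integral_iid n (bq2 _)) q2.
(* Here [W n] is frozen and the past integrated first: [q1] makes the increment a sum of centred
   i.i.d. variables. The total bound then grows by C^2 n, and n^2 + n <= (n + 1)^2. *)
have DD : \int[P]_w D (W n w, w) ^+ 2 <= C ^+ 2 * n%:R.
  have [_ ->] := integral_independent_past mW indepW (bounded_measurableX 2 bD).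
  have bD2 := bounded_measurableX 2 bD.
  have bG : bounded_measurable (fun z => \int[P]_w (D (z, w)) ^+ 2).
    have := bounded_measurable_integral2 (law P (measurable_id_past mW (n := n))) bD2.
    congr bounded_measurable; apply/funext => z.
    by rewrite integral_law//; exact: (bounded_measurable_pair2 z bD2).
  apply: (bounded_integral_le P (bounded_measurable_comp bG (mW n))) => w'.
  exact: (integral_sqr_sum_iid n (bq1 (W n w')) (fun z => qC _) (q1 _)).
have -> : \int[P]_w (\sum_(t < n.+1) \sum_(s < t) q (W t w, W s w)) ^+ 2 =
    \int[P]_w (S w ^+ 2 + 2 * (S w * D (W n w, w)) + D (W n w, w) ^+ 2).
  by apply: eq_Rintegral => w _; rewrite big_ord_recr/= -/(S w) -/(D (W n w, w)); ring.
have b1 := bounded_measurableX 2 bSO.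
have b2 := bounded_measurableZ 2 (bounded_measurableM bSO bDO).
have b3 := bounded_measurableX 2 bDO.
rewrite bounded_integralD//; last exact: bounded_measurableD b1 b2.
rewrite bounded_integralD// bounded_integralZ; last exact: bounded_measurableM bSO bDO.
rewrite cross mulr0 addr0 (le_trans (lerD IH DD))// -mulrDr.
rewrite ler_wpM2l ?sqr_ge0// -natr1 sqrrD1 -addrA lerD2l.
by rewrite mulr2n -addrA lerDl addr_ge0.
Qed.

End iid.

Section linearization.
Context (R : realType) (d d' : measure_display) (Omega : measurableType d)
  (T' : measurableType d') (P : probability Omega R) (Q : probability T' R)
  (W : nat -> Omega -> T').
Hypothesis mW : forall t, measurable_fun [set: Omega] (W t).
Hypothesis indepW : mutually_independent P W.
Hypothesis lawW : forall t A, measurable A -> P (W t @^-1` A) = Q A.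
Context (kappa : T' * T' -> R).
Hypothesis bkappa : bounded_measurable kappa.

(** [kappa] acts on whole sample vectors, so the covariance estimator and both variance estimators
    are instances, each reading one entry of either argument. *)
Definition cov_stat (M : nat) (w : Omega) : R :=
  (M%:R - 1)^-1 * (\sum_(t < M) kappa (W t w, W t w)) -
  ((M%:R - 1) * M%:R)^-1 * (\sum_(t < M) \sum_(s < M) kappa (W t w, W s w)).

Lemma bounded_measurable_cov_stat M : bounded_measurable (cov_stat M).
Proof.
apply: bounded_measurableB; apply: bounded_measurableZ;
  apply: bounded_measurable_sum => t; last apply: bounded_measurable_sum => s;
  by apply: (bounded_measurable_comp bkappa); exact: measurable_fun_pair.
Qed.

Lemma cov_stat_linearization : exists2 zeta : T' -> R,
  bounded_measurable zeta /\ \int[Q]_z zeta z = 0 &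
  exists2 C : R, 0 < C & forall M, (1 < M)%N ->
    let theta := \int[Q]_z kappa (z, z) - \int[Q]_z \int[Q]_z' kappa (z, z') in
    let L w := M%:R^-1 * (\sum_(t < M) zeta (W t w)) in
    \int[P]_w (cov_stat M w - theta - L w) ^+ 2 <= C / M%:R ^+ 2 /\
    \int[P]_w (cov_stat M w - theta) ^+ 2 <= C / M%:R.
Proof.
pose g1 z := \int[Q]_z' kappa (z, z').
pose g2 z' := \int[Q]_z kappa (z, z').
pose b := \int[Q]_z g1 z.
pose h (z : T' * T') := kappa z - g1 z.1 - g2 z.2 + b.
pose a := \int[Q]_z kappa (z, z).
(* On the diagonal [h] has mean a - b - b + b = a - b, which is also the quantity [theta] being
   estimated. *)
pose zeta z := h (z, z) - (a - b).
have bg1 : bounded_measurable g1 by exact: bounded_measurable_integral2.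
have bg2 : bounded_measurable g2 by exact: bounded_measurable_integral1.
have b2 : \int[Q]_z g2 z = b by rewrite /b (bounded_fubini Q Q bkappa).
have mdiag : measurable_fun setT (fun z : T' => (z, z)) by exact: measurable_fun_pair.
have bdiag : bounded_measurable (fun z => kappa (z, z)).
  exact: (bounded_measurable_comp bkappa mdiag).
have bg11 : bounded_measurable (fun z : T' * T' => g1 z.1).
  exact: (bounded_measurable_comp bg1 measurable_fst).
have bg22 : bounded_measurable (fun z : T' * T' => g2 z.2).
  exact: (bounded_measurable_comp bg2 measurable_snd).
have bh : bounded_measurable h.
  apply: bounded_measurableD; last exact: bounded_measurable_cst.
  exact: bounded_measurableB (bounded_measurableB bkappa bg11) bg22.
have bcst (c : R) : bounded_measurable (fun _ : T' => c) by exact: bounded_measurable_cst.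
have h1 z : \int[Q]_z' h (z, z') = 0.
  have e0 := bounded_measurable_pair2 z bkappa.
  have e1 := bounded_measurableB e0 (bcst (g1 z)).
  have e2 := bounded_measurableB e1 bg2.
  rewrite [LHS](bounded_integralD Q e2 (bcst b)) (bounded_integralB Q e1 bg2).
  rewrite (bounded_integralB Q e0 (bcst _)) !bounded_integral_cst b2.
  rewrite -[X in X - _ - _ + _]/(g1 z).
  by ring.
have h2 z' : \int[Q]_z h (z, z') = 0.
  have e0 := bounded_measurable_pair1 z' bkappa.
  have e1 := bounded_measurableB e0 bg1.
  have e2 := bounded_measurableB e1 (bcst (g2 z')).
  rewrite [LHS](bounded_integralD Q e2 (bcst b)) (bounded_integralB Q e1 (bcst _)).
  rewrite (bounded_integralB Q e0 bg1) !bounded_integral_cst.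
  rewrite -[X in X - _ - _ + _]/(g2 z') -[X in _ - X - _ + _]/b.
  by ring.
have bhd : bounded_measurable (fun z => h (z, z)).
  exact: (bounded_measurable_comp bh mdiag).
have bzeta : bounded_measurable zeta := bounded_measurableB bhd (bcst (a - b)).
have zeta0 : \int[Q]_z zeta z = 0.
  have e1 := bounded_measurableB bdiag bg1.
  have e2 := bounded_measurableB e1 bg2.
  rewrite [LHS](bounded_integralB Q bhd (bcst _)).
  rewrite (bounded_integralD Q e2 (bcst b)) (bounded_integralB Q e1 bg2).
  by rewrite (bounded_integralB Q bdiag bg1) !bounded_integral_cst b2
    -[X in X - _ - _ + _]/a -[X in _ - X - _ + _]/b; ring.
exists zeta; first by split; [exact: bzeta|exact: zeta0].
(* Symmetrization covers both orders of the indices and keeps the degeneracy in each argument. *)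
pose q (z : T' * T') := h z + h (z.2, z.1).
have bhs : bounded_measurable (fun z : T' * T' => h (z.2, z.1)).
  by apply: (bounded_measurable_comp bh); exact: measurable_fun_pair.
have bq : bounded_measurable q by exact: bounded_measurableD.
have q1 z : \int[Q]_z' q (z, z') = 0.
  rewrite bounded_integralD; [|exact: (bounded_measurable_pair2 z bh)|
    exact: (bounded_measurable_pair2 z bhs)].
  by rewrite h1 h2 addr0.
have q2 z' : \int[Q]_z q (z, z') = 0.
  rewrite bounded_integralD; [|exact: (bounded_measurable_pair1 z' bh)|
    exact: (bounded_measurable_pair1 z' bhs)].
  by rewrite h1 h2 addr0.
have [C C0 qC] := bounded_measurable_bound bq.
have [D D0 zD] := bounded_measurable_bound bzeta.
(* As M <= 2 (M - 1), the degenerate part has second moment at most 4 C^2 / M^2. The inequality x^2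
   <= 2 (x - y)^2 + 2 y^2 then bounds the full error by 8 C^2 / M^2 + 2 D^2 / M. *)
exists (8 * (C ^+ 2 + D ^+ 2)) => [|M M1 theta L].
  by apply: mulr_gt0 => //; apply: addr_gt0; exact: exprn_gt0.
have M0 : 0 < M%:R :> R by rewrite ltr0n ltnW.
have M10 : 0 < M%:R - 1 :> R by rewrite subr_gt0 ltr1n.
pose U w := \sum_(t < M) \sum_(s < t) q (W t w, W s w).
have bW t : bounded_measurable (fun w => zeta (W t w)).
  exact: (bounded_measurable_comp bzeta (mW t)).
have bU : bounded_measurable U.
  apply: bounded_measurable_sum => t; apply: bounded_measurable_sum => s.
  by apply: (bounded_measurable_comp bq); exact: measurable_fun_pair.
have bL : bounded_measurable L.
  by apply: bounded_measurableZ; exact: bounded_measurable_sum.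
have rE w : cov_stat M w - theta - L w = - (((M%:R - 1) * M%:R)^-1 * U w).
  have := cov_est_hoeffding (fun t s => h (W t w, W s w))
    (fun t => g1 (W t w)) (fun t => g2 (W t w)) b M1.
  have kE t s : h (W t w, W s w) + g1 (W t w) + g2 (W s w) - b = kappa (W t w, W s w).
    by rewrite /h/=; ring.
  under eq_bigr do rewrite kE.
  under [X in _ - _ * X = _ -> _]eq_bigr do under eq_bigr do rewrite kE.
  rewrite -/(cov_stat M w) => ->; rewrite -/(U w) /L /zeta sumrB sumr_const card_ord.
  rewrite -(mulr_natl (a - b)) /theta -/a -[\int[Q]_z \int[Q]_z' _]/b.
  by field; rewrite !gt_eqF.
have r2 : \int[P]_w (cov_stat M w - theta - L w) ^+ 2 <= 4 * C ^+ 2 / M%:R ^+ 2.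
  have -> : \int[P]_w (cov_stat M w - theta - L w) ^+ 2 =
      \int[P]_w (((M%:R - 1) * M%:R)^-2 * U w ^+ 2).
    by apply: eq_Rintegral => w _; rewrite rE sqrrN exprMn exprVn.
  rewrite bounded_integralZ; last exact: bounded_measurableX.
  have := integral_sqr_degenerate mW indepW lawW M bq qC q1 q2.
  rewrite -/U => U2; apply: (@le_trans _ _ (((M%:R - 1) * M%:R)^-2 * (C ^+ 2 * M%:R ^+ 2))).
    by rewrite ler_wpM2l// invr_ge0 sqr_ge0.
  have -> : ((M%:R - 1) * M%:R) ^- 2 * (C ^+ 2 * M%:R ^+ 2) = C ^+ 2 / (M%:R - 1) ^+ 2.
    by field; rewrite !gt_eqF.
  rewrite ler_pdivlMr ?exprn_gt0// mulrAC ler_pdivrMr ?exprn_gt0//.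
  have M2 : 2 <= M%:R :> R by rewrite ler_nat.
  have : M%:R ^+ 2 <= 4 * (M%:R - 1) ^+ 2 :> R by move: M2; move: M%:R => m m2; nra.
  have := sqr_ge0 C; move: (C ^+ 2) (M%:R ^+ 2) ((M%:R - 1) ^+ 2) => x y z; nra.
have L2 : \int[P]_w L w ^+ 2 <= D ^+ 2 / M%:R.
  have -> : \int[P]_w L w ^+ 2 =
      \int[P]_w (M%:R^-2 * (\sum_(t < M) zeta (W t w)) ^+ 2).
    by apply: eq_Rintegral => w _; rewrite exprMn exprVn.
  rewrite bounded_integralZ; last by apply: bounded_measurableX; exact: bounded_measurable_sum.
  have := integral_sqr_sum_iid mW indepW lawW M bzeta zD zeta0 => S2.
  apply: (@le_trans _ _ (M%:R^-2 * (D ^+ 2 * M%:R))).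
    by rewrite ler_wpM2l// invr_ge0 sqr_ge0.
  by rewrite mulrC -mulrA ler_wpM2l ?sqr_ge0// expr2 invfM mulrA divff ?mul1r// gt_eqF.
have bst : bounded_measurable (fun w => cov_stat M w - theta).
  by apply: bounded_measurableB; [exact: bounded_measurable_cov_stat|exact: bounded_measurable_cst].
split.
  apply: (le_trans r2); rewrite ler_wpM2r ?invr_ge0 ?sqr_ge0//.
  by have := sqr_ge0 C; have := sqr_ge0 D; move: (C ^+ 2) (D ^+ 2) => x y; lra.
have br := bounded_measurableB bst bL.
apply: (@le_trans _ _ (\int[P]_w
    (2 * (cov_stat M w - theta - L w) ^+ 2 + 2 * L w ^+ 2))).
  apply: le_bounded_integral.
  - exact: bounded_measurableX.
  - by apply: bounded_measurableD; apply: bounded_measurableZ; exact: bounded_measurableX.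
  - move=> w; move: (cov_stat M w - theta) (L w) => x y.
    by have := sqr_ge0 (x - 2 * y); lra.
rewrite bounded_integralD; [|by apply: bounded_measurableZ; exact: bounded_measurableX..].
rewrite !bounded_integralZ; [|exact: bounded_measurableX..].
have : 4 * C ^+ 2 / M%:R ^+ 2 <= 4 * C ^+ 2 / M%:R.
  apply: ler_wpM2l; first by apply: mulr_ge0; [exact: ler0n|exact: sqr_ge0].
  rewrite lef_pV2 ?posrE ?exprn_gt0//.
  by rewrite expr2 ler_peMr ?(ltW M0)// ler1n ltnW.
have -> : 8 * (C ^+ 2 + D ^+ 2) / M%:R = 8 * (C ^+ 2 / M%:R) + 8 * (D ^+ 2 / M%:R).
  by ring.
have := divr_ge0 (sqr_ge0 D) (ltW M0); have := divr_ge0 (sqr_ge0 C) (ltW M0).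
move: r2 L2; rewrite -!(mulrA 4).
move: (\int[P]_w _) (\int[P]_w _) (C ^+ 2 / M%:R) (C ^+ 2 / _) (D ^+ 2 / _).
move=> p1 p2 x y z; lra.
Qed.

End linearization.

(** * Gaussian integrals *)

Section normal_prob_integral.
Context (R : realType).
Local Notation mu := (@lebesgue_measure R).

(** The Radon-Nikodym derivative of [normal_prob] and the density [normal_pdf] have the same
    integral over every measurable set, hence agree almost everywhere. *)
Lemma ge0_integral_normal_prob (m s : R) (f : measurableTypeR R -> \bar R) :
  measurable_fun setT f -> (forall x, 0 <= f x)%E ->
  (\int[normal_prob m s]_x f x = \int[mu]_x (f x * (normal_pdf m s x)%:E))%E.
Proof.
move=> mf f0; have dom := normal_prob_dominates m s.
rewrite -(Radon_Nikodym_SigmaFinite.change_of_variables dom f0 measurableT mf).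
have irn := Radon_Nikodym_SigmaFinite.f_integrable dom.
have mpdf : measurable_fun setT (fun x => (normal_pdf m s x)%:E).
  by apply/measurable_EFinP; exact: measurable_normal_pdf.
apply: ae_eq_integral => //.
- by apply: emeasurable_funM => //; exact: measurable_int irn.
- exact: emeasurable_funM.
- apply: ae_eqe_mul2l; apply: integral_ae_eq => // A _ mA.
  by rewrite -Radon_Nikodym_SigmaFinite.f_integral.
Qed.

(** Completing the square: the joint density of a two-step Gaussian walk x, y, z is the density of
    its end z times the conditional density of the middle point y given z. *)
Lemma normal_pdf_mul (x y z a b : R) : 0 < a -> 0 < b ->
  let c := Num.sqrt (a ^+ 2 + b ^+ 2) in
  normal_pdf y a z * normal_pdf x b y =
  normal_pdf x c z * normal_pdf ((x * a ^+ 2 + z * b ^+ 2) / c ^+ 2) (a * b / c) y.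
Proof.
move=> a0 b0 c.
have c2 : c ^+ 2 = a ^+ 2 + b ^+ 2.
  by rewrite sqr_sqrtr// addr_ge0// sqr_ge0.
have c0 : 0 < c by rewrite sqrtr_gt0 addr_gt0// exprn_gt0.
rewrite !normal_pdfE ?gt_eqF ?divr_gt0 ?mulr_gt0//.
rewrite /normal_fun /normal_peak.
rewrite mulrACA [RHS]mulrACA -!expRD -!invfM; congr (_^-1 * expR _).
  have nn (t : R) : 0 <= t ^+ 2 * pi *+ 2.
    by rewrite mulrn_wge0// mulr_ge0 ?sqr_ge0// pi_ge0.
  rewrite -(sqrtrM _ (nn a)) -(sqrtrM _ (nn c)).
  have -> : (a * b / c) ^+ 2 = a ^+ 2 * b ^+ 2 / c ^+ 2 by rewrite exprMn exprVn exprMn.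
  congr Num.sqrt; move: (a ^+ 2) (b ^+ 2) (c ^+ 2) (lt0r_neq0 (exprn_gt0 2 c0)) (@trigo.pi R).
  by move=> A B D D0 p; field; rewrite D0.
rewrite c2.
have abn : a ^+ 2 + b ^+ 2 != 0 by rewrite gt_eqF// addr_gt0// exprn_gt0.
have -> : (a * b / c) ^+ 2 = a ^+ 2 * b ^+ 2 / (a ^+ 2 + b ^+ 2).
  by rewrite -c2 !exprMn exprVn.
move: (a ^+ 2) (b ^+ 2) (lt0r_neq0 (exprn_gt0 2 a0)) (lt0r_neq0 (exprn_gt0 2 b0)) abn.
by move=> A B A0 B0 AB0; field; rewrite A0 B0 AB0.
Qed.

Lemma measurable_normal_pdf2 (s : R) : s != 0 ->
  measurable_fun setT (fun z : R * R => normal_pdf z.1 s z.2).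
Proof.
move=> s0; under eq_fun do rewrite normal_pdfE// /normal_fun.
apply: measurable_funM => //; apply: measurableT_comp => //.
apply: measurable_funM => //; apply: measurable_funN; apply: measurable_funX.
by apply: measurable_funB; [exact: measurable_snd|exact: measurable_fst].
Qed.

(** Allowing s = 0 as a Dirac mass keeps the semigroup law valid at the end of the Lindeberg
    replacement, where no Gaussian variance is left. *)
Definition gauss (m s : R) : probability (measurableTypeR R) R :=
  if s == 0 then [the probability (measurableTypeR R) R of \d_(m : measurableTypeR R)]
  else [the probability (measurableTypeR R) R of normal_prob m s].

Lemma centred_gaussianE (s : R) : centred_gaussian s = gauss 0 s.
Proof. by []. Qed.

Lemma integral_gauss0 (m : R) (f : measurableTypeR R -> R) : bounded_measurable f ->
  \int[gauss m 0]_x f x = f m.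
Proof.
move=> [mf _]; rewrite /gauss eqxx /Rintegral integral_dirac//; last first.
  exact/measurable_EFinP.
by rewrite diracT mul1e.
Qed.

Lemma ge0_integral_gauss (m s : R) (f : measurableTypeR R -> \bar R) : s != 0 ->
  measurable_fun setT f -> (forall x, 0 <= f x)%E ->
  (\int[gauss m s]_x f x = \int[mu]_x (f x * (normal_pdf m s x)%:E))%E.
Proof. by move=> s0 mf f0; rewrite /gauss (negbTE s0) ge0_integral_normal_prob. Qed.

Lemma ge0_measurable_integral_gauss (s : R) (f : measurableTypeR R -> \bar R) : s != 0 ->
  measurable_fun setT f -> (forall x, 0 <= f x)%E ->
  measurable_fun setT (fun m : measurableTypeR R => \int[gauss m s]_x f x)%E.
Proof.
move=> s0 mf f0; under eq_fun do rewrite (ge0_integral_gauss _ s0 mf f0).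
pose F (z : measurableTypeR R * measurableTypeR R) :=
  (f z.2 * (normal_pdf z.1 s z.2)%:E)%E.
apply: (@measurable_fun_fubini_tonelli_F _ _ _ _ _ mu F).
- apply: emeasurable_funM; first exact: measurableT_comp mf measurable_snd.
  by apply/measurable_EFinP; exact: measurable_normal_pdf2.
- by move=> z; rewrite mule_ge0// lee_fin normal_pdf_ge0.
Qed.

Lemma bounded_measurable_integral_gauss (s : R) (f : measurableTypeR R -> R) :
  bounded_measurable f ->
  bounded_measurable (fun m : measurableTypeR R => \int[gauss m s]_x f x).
Proof.
move=> bf; have [->|s0] := eqVneq s 0.
  rewrite (_ : (fun m => _) = f)//.
  by apply/funext => m; exact: integral_gauss0.
have [C C0 fC] := bounded_measurable_bound bf; have [mf _] := bf.
split; last by exists C => m; exact: norm_bounded_integral.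
have bfC := bounded_measurableD bf (bounded_measurable_cst C).
have fC0 x : (0 <= (f x + C)%:E)%E.
  by rewrite lee_fin -lerBlDr sub0r; have := fC x; rewrite ler_norml => /andP[].
have mfC : measurable_fun setT (fun x => (f x + C)%:E).
  by apply/measurable_EFinP; case: bfC.
have mG := ge0_measurable_integral_gauss s0 mfC fC0.
apply/measurable_EFinP; have := emeasurable_funB mG (measurable_cst C%:E).
apply: eq_measurable_fun => m _ /=.
rewrite (EFin_bounded_integral _ bfC) bounded_integralD//; last exact: bounded_measurable_cst.
by rewrite bounded_integral_cst -EFinB addrK.
Qed.

(** Tonelli and [normal_pdf_mul]: once z is fixed, the middle point contributes the integral of a
    density, which is 1. The shift by [C] makes the integrand nonnegative. *)
Lemma gauss_semigroup (x a b : R) (f : measurableTypeR R -> R) :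
  0 <= a -> 0 <= b -> bounded_measurable f ->
  \int[gauss x b]_y \int[gauss y a]_z f z =
  \int[gauss x (Num.sqrt (a ^+ 2 + b ^+ 2))]_z f z.
Proof.
move=> a0 b0 bf; have [->|an0] := eqVneq a 0.
  rewrite expr0n add0r sqrtr_sqr ger0_norm//.
  by apply: eq_Rintegral => y _; rewrite integral_gauss0.
have bI := bounded_measurable_integral_gauss a bf.
have [->|bn0] := eqVneq b 0.
  by rewrite integral_gauss0// expr0n addr0 sqrtr_sqr ger0_norm.
have {an0}a0 : 0 < a by rewrite lt_neqAle eq_sym an0.
have {bn0}b0 : 0 < b by rewrite lt_neqAle eq_sym bn0.
set c := Num.sqrt _.
have c0 : 0 < c by rewrite sqrtr_gt0 addr_gt0// exprn_gt0.
have [C C0 fC] := bounded_measurable_bound bf; have [mf _] := bf.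
have bc : bounded_measurable (fun _ : measurableTypeR R => C).
  exact: bounded_measurable_cst.
have bfC := bounded_measurableD bf bc.
have fC0 z : (0 <= (f z + C)%:E)%E.
  by rewrite lee_fin -lerBlDr sub0r; have := fC z; rewrite ler_norml => /andP[].
have mfC : measurable_fun setT (fun z => (f z + C)%:E).
  by apply/measurable_EFinP; case: bfC.
suff H : (\int[gauss x b]_y \int[gauss y a]_z (f z + C)%:E =
      \int[gauss x c]_z (f z + C)%:E)%E.
  apply: (@addIr _ C); apply: EFin_inj.
  transitivity (\int[gauss x b]_y \int[gauss y a]_z (f z + C)%:E)%E.
    rewrite -[X in (_ + X)%:E](bounded_integral_cst (gauss x b) C).
    rewrite -(bounded_integralD _ bI bc) -EFin_bounded_integral; last first.
      exact: bounded_measurableD bI bc.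
    apply: eq_integral => y _.
    by rewrite (EFin_bounded_integral _ bfC) (bounded_integralD _ bf bc) bounded_integral_cst.
  by rewrite H (EFin_bounded_integral _ bfC) (bounded_integralD _ bf bc) bounded_integral_cst.
have s0 : a * b / c != 0 by rewrite gt_eqF// divr_gt0// mulr_gt0.
have an0 : a != 0 by rewrite gt_eqF.
have mI := ge0_measurable_integral_gauss an0 mfC fC0.
have I0 y : (0 <= \int[gauss y a]_z (f z + C)%:E)%E by exact: integral_ge0.
rewrite (ge0_integral_gauss x (lt0r_neq0 b0) mI I0).
rewrite (ge0_integral_gauss x (lt0r_neq0 c0) mfC fC0).
have mpa : measurable_fun setT (fun z : measurableTypeR R * measurableTypeR R =>
   ((f z.2 + C)%:E * (normal_pdf z.1 a z.2)%:E * (normal_pdf x b z.1)%:E)%E).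
  apply: emeasurable_funM; last first.
    apply/measurable_EFinP.
    exact: (measurableT_comp (measurable_normal_pdf x b) measurable_fst).
  apply: emeasurable_funM; first exact: measurableT_comp mfC measurable_snd.
  by apply/measurable_EFinP; apply: measurable_normal_pdf2; rewrite gt_eqF.
have pdf0 (m s z : R) : (0 <= (normal_pdf m s z)%:E)%E by rewrite lee_fin normal_pdf_ge0.
transitivity (\int[mu]_y \int[mu]_z
    ((f z + C)%:E * (normal_pdf y a z)%:E * (normal_pdf x b y)%:E))%E.
  apply: eq_integral => y _; rewrite (ge0_integral_gauss y an0 mfC fC0) ge0_integralZr//.
  - apply: emeasurable_funM => //.
    by apply/measurable_EFinP; exact: measurable_normal_pdf.
  - by move=> z _; rewrite mule_ge0.
rewrite (@fubini_tonelli _ _ _ _ _ mu mu _ mpa)/=; last first.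
  by move=> z; rewrite !mule_ge0.
apply: eq_integral => z _.
pose p := normal_pdf ((x * a ^+ 2 + z * b ^+ 2) / c ^+ 2) (a * b / c).
transitivity (\int[mu]_y ((f z + C)%:E * (normal_pdf x c z)%:E * (p y)%:E))%E.
  by apply: eq_integral => y _; rewrite -!EFinM -mulrA normal_pdf_mul// mulrA.
rewrite ge0_integralZl//=.
- by rewrite integral_normal_pdf mule1.
- by apply/measurable_EFinP; exact: measurable_normal_pdf.
- by move=> y _; exact: pdf0.
- by rewrite mule_ge0.
Qed.

End normal_prob_integral.

Lemma integrableB_EFin (R : realType) (d : measure_display) (T : measurableType d)
    (mu : {measure set T -> \bar R}) (f g : T -> R) :
  mu.-integrable setT (EFin \o f) -> mu.-integrable setT (EFin \o g) ->
  mu.-integrable setT (EFin \o (fun x => f x - g x)).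
Proof. by move=> If Ig; have := integrableB measurableT If Ig; apply. Qed.

Lemma integrableZl_EFin (R : realType) (d : measure_display) (T : measurableType d)
    (mu : {measure set T -> \bar R}) (c : R) (f : T -> R) :
  mu.-integrable setT (EFin \o f) ->
  mu.-integrable setT (EFin \o (fun x => c * f x)).
Proof. by move=> If; have := integrableZl measurableT c If; apply. Qed.

Section gauss_moments.
Context (R : realType).
Local Notation mu := (@lebesgue_measure R).

(** Integrability being given, dominated convergence allows symmetric intervals around [c], where
    the fundamental theorem of calculus applies. Gaussian moments follow by exhibiting
    antiderivatives. *)
Lemma integral_derive_line (f F : R -> R) (c : R) :
  continuous f -> (forall x : R, is_derive x 1 F (f x)) ->
  mu.-integrable setT (EFin \o f) ->
  F (c + n%:R) - F (c - n%:R) @[n --> \oo] --> (0 : R) ->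
  (\int[mu]_x (f x)%:E = 0)%E.
Proof.
move=> cf dF intf F0.
have cF : continuous F.
  move=> x; apply: differentiable_continuous; apply/derivable1_diffP.
  by have [] := dF x.
pose D (n : nat) : set R := `[c - n%:R, c + n%:R]%classic.
have mf : measurable_fun setT (EFin \o f) by exact: measurable_int intf.
have h1 : (\int[mu]_x ((EFin \o f) \_ (D n)) x)%E @[n --> \oo] -->
    (\int[mu]_x (EFin \o f) x)%E.
  have mfn n : measurable_fun setT ((EFin \o f) \_ (D n)).
    apply/(measurable_restrictT _ _).1; first exact: measurable_itv.
    exact: measurable_funTS.
  have fn_f : {ae mu, forall x, setT x ->
      ((EFin \o f) \_ (D n)) x @[n --> \oo] --> (EFin \o f) x}.
    apply: aeW => x _; apply: cvg_near_cst.
    have [N _ hN] := nbhs_infty_ger `|x - c|.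
    exists N => // n /= Nn; rewrite patchE ifT//; apply/mem_set.
    have := hN _ Nn; rewrite /D/= in_itv/= ler_norml => /andP[h1 h2].
    by rewrite lerBlDr -lerBlDl -opprB lerNl h1 -lerBlDl h2.
  have fn_le : {ae mu, forall x n, setT x ->
      (`|((EFin \o f) \_ (D n)) x| <= `|(EFin \o f) x|)%E}.
    apply: aeW => x n _; rewrite patchE; case: ifP => _ //.
    by rewrite abse0.
  by have [] := @dominated_convergence _ _ _ mu setT measurableT _ _ _ mfn mf
    fn_f (integrable_abse intf) fn_le.
have DE n : (0 < n)%N -> (\int[mu]_x ((EFin \o f) \_ (D n)) x)%E =
    (F (c + n%:R) - F (c - n%:R))%:E.
  move=> n0; rewrite -integral_mkcond (@continuous_FTC2 _ f F) ?EFinB//.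
  - by rewrite ltrD2l gtrN// ltr0n.
  - exact: continuous_subspaceT.
  - split.
    + by move=> x _; have [] := dF x.
    + exact/cvg_at_right_filter/cF.
    + exact/cvg_at_left_filter/cF.
  - by move=> x _; rewrite derive1E; apply: derive_val.
have h2 : (\int[mu]_x ((EFin \o f) \_ (D n)) x)%E @[n --> \oo] --> 0%E.
  apply: cvg_EFin; first by exists 1%N => // n /= n1; rewrite DE.
  by apply: cvg_trans F0; apply: near_eq_cvg; exists 1%N => // n /= n1; rewrite DE.
by have := cvg_unique _ h1 h2; apply.
Qed.

Lemma integral_normal_prob (m s : R) (f : measurableTypeR R -> R) :
  (normal_prob m s).-integrable setT (EFin \o f) ->
  mu.-integrable setT (fun x => (f x * normal_pdf m s x)%:E) /\
  (\int[normal_prob m s]_x (f x)%:E = \int[mu]_x (f x * normal_pdf m s x)%:E)%E.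
Proof.
move=> intf; have mf : measurable_fun setT (EFin \o f) by exact: measurable_int intf.
have dom := normal_prob_dominates m s.
have mpdf : measurable_fun setT (fun x => (normal_pdf m s x)%:E).
  by apply/measurable_EFinP; exact: measurable_normal_pdf.
have mfp : measurable_fun setT (fun x => (f x * normal_pdf m s x)%:E).
  by under eq_fun do rewrite EFinM; exact: emeasurable_funM.
split.
  apply/integrableP; split => //.
  have /integrableP[_] := intf.
  rewrite ge0_integral_normal_prob//; last exact: measurableT_comp.
  apply: le_lt_trans; apply: ge0_le_integral => //.
  - exact: measurableT_comp.
  - by apply: emeasurable_funM => //; exact: measurableT_comp.
  - move=> x _ /=.
    by rewrite normrM EFinM (ger0_norm (normal_pdf_ge0 _ _ _)).
rewrite -(Radon_Nikodym_change_of_variables dom measurableT intf).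
have irn := @Radon_Nikodym_integrable _ _ _
  (charge_of_finite_measure (normal_prob m s)) mu dom.
apply: ae_eq_integral => //.
- by apply: emeasurable_funM => //; exact: measurable_int irn.
- under [X in ae_eq _ _ _ X]eq_fun do rewrite EFinM.
  apply: ae_eqe_mul2l; apply: integral_ae_eq => // A _ mA.
  by rewrite -Radon_Nikodym_integral.
Qed.

(** The exponential is the square of exp(w^2 / 8) >= 1 + w^2 / 8, so the right side is at least w^4
    / 2 + 8 w^2, and 2 w^3 <= w^4 + w^2. *)
Lemma cube_le_expR (w : R) : 0 <= w -> w ^+ 3 <= 32 * expR (w ^+ 2 / 4).
Proof.
move=> w0; have -> : w ^+ 2 / 4 = w ^+ 2 / 8 + w ^+ 2 / 8 by field.
rewrite expRD; have := expR_ge1Dx (w ^+ 2 / 8).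
move: (expR _) => e he.
have : (1 + w ^+ 2 / 8) * (1 + w ^+ 2 / 8) <= e * e.
  by apply: ler_pM => //; rewrite addr_ge0// divr_ge0// sqr_ge0.
have := mulr_ge0 (sqr_ge0 w) (sqr_ge0 (w - 1)).
by have := sqr_ge0 w; rewrite !exprS !expr0 !mulr1; nra.
Qed.

Section positive_variance.
Context (m s : R) (s0 : 0 < s).
Local Notation N := (normal_prob m s).

(** Half of the Gaussian exponent absorbs the cube; the other half is the exponent for deviation
    sqrt 2 s. The constant 64 is 32 times 2, a bound for the ratio sqrt 2 of the peaks. Both the
    third moment and the decay at infinity come from here. *)
Lemma cube_normal_pdf_le (z : R) :
  `|z - m| ^+ 3 * normal_pdf m s z <= 64 * s ^+ 3 * normal_pdf m (Num.sqrt 2 * s) z.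
Proof.
have q0 : 0 < Num.sqrt 2 :> R by rewrite sqrtr_gt0.
have q2 : Num.sqrt 2 ^+ 2 = 2 :> R by rewrite sqr_sqrtr.
rewrite !normal_pdfE ?gt_eqF ?mulr_gt0// /normal_fun !exprMn q2.
pose w := `|z - m| / s.
have w0 : 0 <= w by rewrite divr_ge0// ltW.
have zE : `|z - m| = w * s by rewrite /w divfK// gt_eqF.
have z2 : (z - m) ^+ 2 = w ^+ 2 * s ^+ 2 by rewrite -exprMn -zE real_normK ?num_real.
have sn0 : s != 0 by rewrite gt_eqF.
have peak : normal_peak s <= 2 * normal_peak (Num.sqrt 2 * s).
  have p0 : 0 < s ^+ 2 * pi *+ 2 by rewrite mulrn_wgt0// mulr_gt0 ?exprn_gt0 ?pi_gt0.
  rewrite /normal_peak.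
  have -> : (Num.sqrt 2 * s) ^+ 2 * pi *+ 2 = 2 * (s ^+ 2 * pi *+ 2).
    by rewrite exprMn q2; ring.
  rewrite sqrtrM// [X in _ <= 2 * X]invfM mulrA.
  rewrite ler_peMl ?invr_ge0 ?sqrtr_ge0// ler_pdivlMr// mul1r.
  by rewrite -(ler_pXn2r (n := 2)) ?nnegrE ?sqrtr_ge0// q2; lra.
have E : expR (- (z - m) ^+ 2 / (s ^+ 2 *+ 2)) =
    expR (- (z - m) ^+ 2 / (2 * s ^+ 2 *+ 2)) / expR (w ^+ 2 / 4).
  rewrite -expRN -expRD z2; congr expR; field; exact: sn0.
rewrite E zE exprMn; have e0 : 0 < expR (w ^+ 2 / 4) by exact: expR_gt0.
have w3 : w ^+ 3 / expR (w ^+ 2 / 4) <= 32 by rewrite ler_pdivrMr//; exact: cube_le_expR.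
set G := expR (- _ / _).
have G0 : 0 <= G by exact: expR_ge0.
have -> : w ^+ 3 * s ^+ 3 * (normal_peak s * (G / expR (w ^+ 2 / 4))) =
    (w ^+ 3 / expR (w ^+ 2 / 4)) * (s ^+ 3 * (normal_peak s * G)).
  by field; rewrite gt_eqF.
have s3 : 0 <= s ^+ 3 by rewrite exprn_ge0// ltW.
apply: (@le_trans _ _ (32 * (s ^+ 3 * (normal_peak s * G)))).
  by rewrite ler_wpM2r// mulr_ge0// mulr_ge0// normal_peak_ge0.
have -> : 64 * s ^+ 3 * (normal_peak (Num.sqrt 2 * s) * G) =
    32 * (s ^+ 3 * (2 * normal_peak (Num.sqrt 2 * s) * G)) by ring.
by rewrite ler_wpM2l// ler_wpM2l// ler_wpM2r.
Qed.

Lemma integrable_normal_cube :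
  N.-integrable setT (fun z => (`|z - m| ^+ 3)%:E) /\
  (\int[N]_z (`|z - m| ^+ 3)%:E <= (64 * s ^+ 3)%:E)%E.
Proof.
have mz : measurable_fun setT (fun z : measurableTypeR R => (`|z - m| ^+ 3)%:E).
  apply/measurable_EFinP; apply: measurable_funX; apply: measurableT_comp => //.
  exact: measurable_funB.
have z0 (z : R) : (0 <= (`|z - m| ^+ 3)%:E)%E by rewrite lee_fin exprn_ge0.
have le : (\int[N]_z (`|z - m| ^+ 3)%:E <= (64 * s ^+ 3)%:E)%E.
  rewrite ge0_integral_normal_prob//.
  apply: (@le_trans _ _ (\int[mu]_z
     ((64 * s ^+ 3)%:E * (normal_pdf m (Num.sqrt 2 * s) z)%:E))%E).
    apply: ge0_le_integral => //.
    - by move=> z _; rewrite mule_ge0// lee_fin normal_pdf_ge0.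
    - by apply: emeasurable_funM => //; apply/measurable_EFinP; exact: measurable_normal_pdf.
    - by apply: emeasurable_funM => //; apply/measurable_EFinP; exact: measurable_normal_pdf.
    - by move=> z _; rewrite -!EFinM lee_fin cube_normal_pdf_le.
  rewrite ge0_integralZl//=.
  - by rewrite integral_normal_pdf mule1.
  - by apply/measurable_EFinP; exact: measurable_normal_pdf.
  - by move=> z _; rewrite lee_fin normal_pdf_ge0.
  - by rewrite lee_fin mulr_ge0// exprn_ge0// ltW.
split => //; apply/integrableP; split => //.
apply: le_lt_trans (ltry (64 * s ^+ 3)); apply: le_trans le.
by under eq_integral do rewrite gee0_abs//.
Qed.

Lemma integrable_normal_center :
  N.-integrable setT (fun z => (z - m)%:E) /\
  N.-integrable setT (fun z => ((z - m) ^+ 2)%:E).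
Proof.
have [i3 _] := integrable_normal_cube.
have mz : measurable_fun setT (fun z : measurableTypeR R => z - m).
  exact: measurable_funB.
have ic : N.-integrable setT (fun z : measurableTypeR R => 1%:E : \bar R).
  exact: (@bounded_measurable_integrable _ _ _ N _ (bounded_measurable_cst 1)).
have i13 : N.-integrable setT (fun z : measurableTypeR R => (1 + `|z - m| ^+ 3)%:E).
  by under eq_fun do rewrite EFinD; exact: integrableD.
split; apply: (le_integrable measurableT _ _ i13).
- exact/measurable_EFinP.
- move=> z _; rewrite lee_fin /= [leRHS]ger0_norm ?addr_ge0// ?exprn_ge0//.
  have := normr_ge0 (z - m); move: `|z - m| => w w0.
  by rewrite !exprS expr0 mulr1; have := mulr_ge0 w0 (sqr_ge0 (w - 1)); nra.
- by apply/measurable_EFinP; exact: measurable_funX.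
- move=> z _; rewrite lee_fin /= [leRHS]ger0_norm ?addr_ge0// ?exprn_ge0//.
  rewrite normrX; have := normr_ge0 (z - m); move: `|z - m| => w w0.
  by rewrite !exprS expr0 mulr1; have := mulr_ge0 w0 (sqr_ge0 (w - 1)); nra.
Qed.

Lemma is_derive_normal_pdf (z : R) :
  is_derive z 1 (normal_pdf m s : R -> R) (- ((z - m) / s ^+ 2) * normal_pdf m s z).
Proof.
have sn0 : s != 0 by rewrite gt_eqF.
rewrite normal_pdfE// /normal_fun.
have d1 : is_derive z 1 (fun x : R => - (x - m) ^+ 2 / (s ^+ 2 *+ 2))
    (- ((z - m) / s ^+ 2)).
  apply: is_derive_eq; rewrite /GRing.scale/=; field; exact: sn0.
have d2 := is_derive1_comp (is_derive_expR _) d1.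
have d3 := is_deriveZ (normal_peak s) d2.
apply: (is_derive_eq d3); rewrite /GRing.scale/=; ring.
Qed.

Lemma normal_pdf_sym (t : R) : normal_pdf m s (m + t) = normal_pdf m s (m - t).
Proof.
have sn0 : s != 0 by rewrite gt_eqF.
rewrite !(normal_pdfE _ sn0) /normal_fun.
have -> : (m + t - m) ^+ 2 = (m - t - m) ^+ 2 by ring.
by [].
Qed.

Lemma integral_normal_center : \int[N]_z (z - m) = 0.
Proof.
have [i1 _] := integrable_normal_center; have sn0 : s != 0 by rewrite gt_eqF.
have [ip E] := integral_normal_prob i1.
have dF (z : R) : is_derive z 1 (fun z => - s ^+ 2 * normal_pdf m s z)
    ((z - m) * normal_pdf m s z).
  have := is_deriveZ (- s ^+ 2) (is_derive_normal_pdf z).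
  by move/is_derive_eq; apply; rewrite /GRing.scale/=; field.
rewrite /Rintegral E (integral_derive_line _ dF ip (c := m))//.
- move=> z; apply: cvgM; last exact: continuous_normal_pdf.
  by apply: (@cvgB _ R^o); [exact: cvg_id|exact: cvg_cst].
- under eq_fun do rewrite normal_pdf_sym subrr.
  exact: cvg_cst.
Qed.

(** The function ((z - m)^2 - s^2) p(z) has the antiderivative -s^2 (z - m) p(z), whose increments
    over symmetric intervals tend to 0. *)
Lemma integral_normal_sqr_center : \int[N]_z ((z - m) ^+ 2) = s ^+ 2.
Proof.
have [_ i2] := integrable_normal_center; have sn0 : s != 0 by rewrite gt_eqF.
have ic : N.-integrable setT (EFin \o (fun _ : measurableTypeR R => s ^+ 2)).
  exact: (@bounded_measurable_integrable _ _ _ N _ (bounded_measurable_cst _)).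
apply/eqP; rewrite -subr_eq0; apply/eqP.
rewrite -[X in _ - X](bounded_integral_cst N (s ^+ 2)) -RintegralB//.
have iB : N.-integrable setT (EFin \o (fun z => (z - m) ^+ 2 - s ^+ 2)).
  exact: integrableB_EFin.
have [ip E] := integral_normal_prob iB.
have dF (z : R) : is_derive z 1 (fun z => - s ^+ 2 * ((z - m) * normal_pdf m s z))
    (((z - m) ^+ 2 - s ^+ 2) * normal_pdf m s z).
  have d1 : is_derive z 1 (fun x : R => x - m) 1.
    by apply: is_derive_eq; rewrite subr0.
  have := is_deriveZ (- s ^+ 2) (is_deriveM d1 (is_derive_normal_pdf z)).
  by move/is_derive_eq; apply; rewrite /GRing.scale/=; field.
rewrite /Rintegral E (integral_derive_line _ dF ip (c := m))//.
- move=> z; apply: cvgM; last exact: continuous_normal_pdf.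
  apply: (@cvgB _ R^o); last exact: cvg_cst.
  apply: (cvg_comp (fun x => x - m) (fun x => x ^+ 2)).
    by apply: (@cvgB _ R^o); [exact: cvg_id|exact: cvg_cst].
  exact: sqr_continuous.
(* The boundary term is 2 s^2 n p(m + n) in absolute value, and n^2 p <= n^3 p <= 64 s^3 times the
   peak for n >= 1. *)
- pose K := 128 * s ^+ 5 * normal_peak (Num.sqrt 2 * s).
  have K0 : 0 <= K by rewrite !mulr_ge0// ?exprn_ge0 ?normal_peak_ge0// ltW.
  have le n : `|- s ^+ 2 * ((m + n%:R - m) * normal_pdf m s (m + n%:R)) -
       - s ^+ 2 * ((m - n%:R - m) * normal_pdf m s (m - n%:R))| <= K * n%:R^-1.
    rewrite -normal_pdf_sym.
    have -> : - s ^+ 2 * ((m + n%:R - m) * normal_pdf m s (m + n%:R)) -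
       - s ^+ 2 * ((m - n%:R - m) * normal_pdf m s (m + n%:R)) =
       - (2 * s ^+ 2 * (n%:R * normal_pdf m s (m + n%:R))) by ring.
    have p0 := normal_pdf_ge0 m s (m + n%:R).
    rewrite normrN ger0_norm; last by apply: mulr_ge0; apply: mulr_ge0 => //; exact: sqr_ge0.
    case: n p0 => [|n] p0; first by rewrite mul0r mulr0 invr0 mulr0.
    have := cube_normal_pdf_le (m + n.+1%:R).
    have -> : m + n.+1%:R - m = n.+1%:R by ring.
    rewrite ger0_norm//.
    have q0 : Num.sqrt 2 * s != 0 by rewrite gt_eqF// mulr_gt0// sqrtr_gt0.
    have := normal_pdf_ub m (m + n.+1%:R) q0.
    have n1 : 1 <= n.+1%:R :> R by rewrite ler1n.
    set p := normal_pdf m s _ in p0 *; set q := normal_pdf m (_ * _) _.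
    move: p0 n1; move: p q n.+1%:R => p q x p0 x1 qub xp.
    have x0 : 0 < x by rewrite (lt_le_trans _ x1).
    rewrite ler_pdivlMr//.
    have s3 : 0 <= 64 * s ^+ 3 by rewrite mulr_ge0// exprn_ge0// ltW.
    have h1 : x * p * x <= x ^+ 3 * p.
      have -> : x ^+ 3 * p = (x * p * x) * x by ring.
      by apply: ler_peMr => //; apply: mulr_ge0; [apply: mulr_ge0 => //|]; exact: ltW.
    have h2 : x * p * x <= 64 * s ^+ 3 * normal_peak (Num.sqrt 2 * s).
      by rewrite (le_trans h1)// (le_trans xp)// ler_wpM2l.
    have -> : 2 * s ^+ 2 * (x * p) * x = 2 * s ^+ 2 * (x * p * x) by ring.
    have -> : K = 2 * s ^+ 2 * (64 * s ^+ 3 * normal_peak (Num.sqrt 2 * s)).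
      by rewrite /K; ring.
    by rewrite ler_wpM2l// mulr_ge0// sqr_ge0.
  apply/norm_cvg0P; apply: (@squeeze_cvgr _ _ _ _ (cst 0) (fun n => K * n%:R^-1)).
  + by near=> n; rewrite normr_ge0 le.
  + exact: cvg_cst.
  + rewrite -[X in _ --> X](mulr0 K); apply: cvgMr.
    by rewrite -(cvg_shiftS (fun n : nat => n%:R^-1 : R)); exact: cvg_harmonic.
Unshelve. all: by end_near. Qed.

End positive_variance.

Lemma gauss_taylor (m s K v1 v2 : R) (v : measurableTypeR R -> R) :
  0 <= s -> 0 <= K -> bounded_measurable v ->
  (forall z, `|v z - v m - (z - m) * v1 - (z - m) ^+ 2 / 2 * v2| <= K * `|z - m| ^+ 3) ->
  `|\int[gauss m s]_z v z - v m - s ^+ 2 / 2 * v2| <= 64 * K * s ^+ 3.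
Proof.
rewrite le_eqVlt => /predU1P[<-|s0] K0 bv hv.
  rewrite integral_gauss0// subrr sub0r !expr0n !mul0r normrN normr0 mulr0//.
rewrite /gauss gt_eqF//.
pose N := [the probability (measurableTypeR R) R of normal_prob m s]; rewrite -/N.
have iv : N.-integrable setT (EFin \o v) by exact: bounded_measurable_integrable.
have ic (c : R) : N.-integrable setT (EFin \o (fun _ : measurableTypeR R => c)).
  exact: (bounded_measurable_integrable N (bounded_measurable_cst c)).
have [i1 i2] := integrable_normal_center m s0.
have [i3 le3] := integrable_normal_cube m s0.
have iB1 : N.-integrable setT (EFin \o (fun z => v z - v m)).
  exact: integrableB_EFin.
have i1v : N.-integrable setT (EFin \o (fun z => v1 * (z - m))).
  exact: integrableZl_EFin.
have i2v : N.-integrable setT (EFin \o (fun z => v2 / 2 * (z - m) ^+ 2)).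
  exact: integrableZl_EFin.
have iB2 : N.-integrable setT (EFin \o (fun z => v z - v m - v1 * (z - m))).
  exact: integrableB_EFin.
have iB3 : N.-integrable setT
    (EFin \o (fun z => v z - v m - v1 * (z - m) - v2 / 2 * (z - m) ^+ 2)).
  exact: integrableB_EFin.
have IE : \int[N]_z v z - v m - s ^+ 2 / 2 * v2 =
    \int[N]_z (v z - v m - v1 * (z - m) - v2 / 2 * (z - m) ^+ 2).
  rewrite RintegralB// RintegralB// RintegralB// bounded_integral_cst.
  rewrite RintegralZl// RintegralZl// integral_normal_center// mulr0 subr0.
  by rewrite integral_normal_sqr_center//; congr (_ - _); ring.
rewrite IE; apply: (le_trans (le_normr_Rintegral measurableT iB3)).
have i3K : N.-integrable setT (EFin \o (fun z => K * `|z - m| ^+ 3)).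
  exact: integrableZl_EFin.
apply: (@le_trans _ _ (\int[N]_z (K * `|z - m| ^+ 3))).
  apply: le_Rintegral => //; first exact: integrable_abse iB3.
  by move=> z _; rewrite [v1 * _]mulrC [v2 / 2]mulrC -mulrA [v2 * _]mulrC mulrA [2^-1 * _]mulrC; exact: hv.
rewrite RintegralZl// -mulrA mulrCA ler_wpM2l// -lee_fin /Rintegral fineK//.
exact: integrable_fin_num.
Qed.

End gauss_moments.

(** * Lindeberg's method *)

(** [g1] and [g2] stand for the first two derivatives but are mere data of an inequality, linear in
    (g, g1, g2) before the absolute value and uniform in x; hence it survives integration. *)
Definition taylor3 (R : realType) (g g1 g2 : measurableTypeR R -> R) (K : R) :=
  [/\ bounded_measurable g, bounded_measurable g1, bounded_measurable g2 &
      forall x h : R,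
        `|g (x + h) - g x - h * g1 x - h ^+ 2 / 2 * g2 x| <= K * `|h| ^+ 3].

Section lindeberg.
Context (R : realType) (d d' : measure_display) (Omega : measurableType d)
  (T' : measurableType d') (P : probability Omega R) (Q : probability T' R)
  (W : nat -> Omega -> T').
Hypothesis mW : forall t, measurable_fun [set: Omega] (W t).
Hypothesis indepW : mutually_independent P W.
Hypothesis lawW : forall t A, measurable A -> P (W t @^-1` A) = Q A.
Context (xi : T' -> R).
Hypothesis bxi : bounded_measurable xi.
Hypothesis xi0 : \int[Q]_z xi z = 0.

Let sigma := Num.sqrt (\int[Q]_z xi z ^+ 2).

Let mean_translate (e : R) j (g : measurableTypeR R -> R) (x : measurableTypeR R) : R :=
  \int[P]_w g (x + e * \sum_(t < j) xi (W t w)).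

Let bsum j : bounded_measurable (fun w => \sum_(t < j) xi (W t w)).
Proof.
by apply: bounded_measurable_sum => t; exact: (bounded_measurable_comp bxi (mW t)).
Qed.

Let bpair (e : R) j (g : measurableTypeR R -> R) : bounded_measurable g ->
  bounded_measurable (fun z : measurableTypeR R * Omega =>
    g (z.1 + e * \sum_(t < j) xi (W t z.2))).
Proof.
move=> bg; apply: (bounded_measurable_comp bg).
apply: measurable_funD; first exact: measurable_fst.
apply: measurable_funM => //.
by have [ms _] := bsum j; exact: (measurableT_comp ms measurable_snd).
Qed.

Let btranslate (e : R) j (g : measurableTypeR R -> R) (x : measurableTypeR R) : bounded_measurable g ->
  bounded_measurable (fun w => g (x + e * \sum_(t < j) xi (W t w))).
Proof. by move=> bg; have := bounded_measurable_pair2 x (bpair e j bg). Qed.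

Let taylor3_mean_translate (e : R) j (g g1 g2 : measurableTypeR R -> R) K : taylor3 g g1 g2 K ->
  taylor3 (mean_translate e j g) (mean_translate e j g1) (mean_translate e j g2) K.
Proof.
move=> [bg bg1 bg2 gK]; split.
- exact: (bounded_measurable_integral2 P (bpair e j bg)).
- exact: (bounded_measurable_integral2 P (bpair e j bg1)).
- exact: (bounded_measurable_integral2 P (bpair e j bg2)).
move=> x h; rewrite /mean_translate.
have bh := btranslate e j (x + h) bg; have b0 := btranslate e j x bg.
have b1 := bounded_measurableZ h (btranslate e j x bg1).
have b2 := bounded_measurableZ (h ^+ 2 / 2) (btranslate e j x bg2).
rewrite -(bounded_integralZ _ _ (btranslate e j x bg1)).
rewrite -(bounded_integralZ _ _ (btranslate e j x bg2)).
rewrite -(bounded_integralB _ bh b0) -(bounded_integralB _ (bounded_measurableB bh b0) b1).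
have b3 := bounded_measurableB (bounded_measurableB bh b0) b1.
rewrite -(bounded_integralB _ b3 b2).
apply: norm_bounded_integral; first exact: bounded_measurableB.
by move=> w; rewrite [x + h + _]addrAC; exact: gK.
Qed.

Let mean_translateS (e : R) j (g : measurableTypeR R -> R) x : bounded_measurable g ->
  mean_translate e j.+1 g x = \int[Q]_z mean_translate e j g (x + e * xi z).
Proof.
move=> bg; rewrite /mean_translate.
have bS : bounded_measurable (fun w : past W j => \sum_(t < j) xi (W t w)).
  exact: bounded_measurable_sum_iid.
pose F (z : T' * past W j) := g (x + e * xi z.1 + e * \sum_(t < j) xi (W t z.2)).
have bF : bounded_measurable F.
  apply: (bounded_measurable_comp bg); apply: measurable_funD.
    apply: measurable_funD => //; apply: measurable_funM => //.
    by case: bxi => mxi _; exact: (measurableT_comp mxi measurable_fst).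
  apply: measurable_funM => //.
  by case: bS => mS _; exact: (measurableT_comp mS measurable_snd).
have [_ E] := integral_independent_past mW indepW bF.
transitivity (\int[P]_w F (W j w, w)).
  by apply: eq_Rintegral => w _; rewrite /F big_ord_recr/= mulrDr addrA addrAC.
have bI : bounded_measurable (fun z => mean_translate e j g (x + e * xi z)).
  apply: (bounded_measurable_comp (bounded_measurable_integral2 P (bpair e j bg))).
  apply: measurable_funD => //; apply: measurable_funM => //.
  by case: bxi.
by rewrite E -(integral_iid mW lawW j bI).
Qed.

(** The Gaussian increment and [e * xi] have the same mean and variance, so both averages are
    compared with v(x) + (sigma e)^2 / 2 v2(x); the third-order errors are 64 K (sigma e)^3 and K (e
    C)^3. *)
Lemma lindeberg_step (e : R) j (g g1 g2 : measurableTypeR R -> R) K C x : 0 <= e -> 0 <= K ->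
  (forall z, `|xi z| <= C) -> taylor3 g g1 g2 K ->
  `|\int[gauss x (sigma * e)]_y mean_translate e j g y - mean_translate e j.+1 g x| <=
  e ^+ 3 * (K * (C ^+ 3 + 64 * sigma ^+ 3)).
Proof.
move=> e0 K0 xiC tg; have [bg _ _ _] := tg.
have [bv bv1 bv2 vK] := taylor3_mean_translate e j tg.
set v := mean_translate e j g in bv vK *.
set v1 := mean_translate e j g1 in bv1 vK.
set v2 := mean_translate e j g2 in bv2 vK.
have s0 : 0 <= sigma by exact: sqrtr_ge0.
have s2 : sigma ^+ 2 = \int[Q]_z xi z ^+ 2.
  by rewrite sqr_sqrtr// Rintegral_ge0// => z _; exact: sqr_ge0.
have hG : `|\int[gauss x (sigma * e)]_y v y - v x - (sigma * e) ^+ 2 / 2 * v2 x| <=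
    64 * K * (sigma * e) ^+ 3.
  apply: (gauss_taylor (mulr_ge0 s0 e0) K0 bv (v1 := v1 x)) => z.
  by have := vK x (z - x); rewrite subrKC.
have C0 : 0 <= C by exact: le_trans (xiC point).
have hQ : `|\int[Q]_z v (x + e * xi z) - v x - (sigma * e) ^+ 2 / 2 * v2 x| <=
    K * (e * C) ^+ 3.
  have mv : measurable_fun setT (fun z => x + e * xi z : measurableTypeR R).
    by apply: measurable_funD => //; apply: measurable_funM => //; case: bxi.
  have bvx := bounded_measurable_comp bv mv.
  have bc : bounded_measurable (fun _ : T' => v x) by exact: bounded_measurable_cst.
  have b1 := bounded_measurableZ (e * v1 x) bxi.
  have b2 := bounded_measurableZ (e ^+ 2 / 2 * v2 x) (bounded_measurableX 2 bxi).
  have b3 := bounded_measurableB (bounded_measurableB bvx bc) b1.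
  have -> : \int[Q]_z v (x + e * xi z) - v x - (sigma * e) ^+ 2 / 2 * v2 x =
      \int[Q]_z (v (x + e * xi z) - v x - e * v1 x * xi z
        - e ^+ 2 / 2 * v2 x * xi z ^+ 2).
    rewrite (bounded_integralB _ b3 b2) (bounded_integralB _ (bounded_measurableB bvx bc) b1).
    rewrite (bounded_integralB _ bvx bc) bounded_integral_cst.
    rewrite (bounded_integralZ _ _ bxi) (bounded_integralZ _ _ (bounded_measurableX 2 bxi)).
    by rewrite xi0 mulr0 subr0 -s2; congr (_ - _); ring.
  apply: norm_bounded_integral; first exact: bounded_measurableB.
  move=> z; have := vK x (e * xi z).
  have -> : e * xi z * v1 x = e * v1 x * xi z by ring.
  have -> : (e * xi z) ^+ 2 / 2 * v2 x = e ^+ 2 / 2 * v2 x * xi z ^+ 2 by ring.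
  move=> /le_trans; apply; rewrite ler_wpM2l// normrM (ger0_norm e0).
  by rewrite lerXn2r ?nnegrE ?mulr_ge0// ler_wpM2l.
rewrite mean_translateS// -/v.
have -> : e ^+ 3 * (K * (C ^+ 3 + 64 * sigma ^+ 3)) =
    64 * K * (sigma * e) ^+ 3 + K * (e * C) ^+ 3 by ring.
apply: le_trans (lerD hG hQ); apply: le_trans (ler_normB _ _).
by rewrite le_eqVlt; apply/orP; left; apply/eqP; congr `|_|; ring.
Qed.

Theorem clt_taylor3 (g g1 g2 : measurableTypeR R -> R) K : 0 <= K -> taylor3 g g1 g2 K ->
  exists2 C : R, 0 < C & forall n, (0 < n)%N ->
    `|\int[P]_w g ((Num.sqrt n%:R)^-1 * \sum_(t < n) xi (W t w)) -
      \int[gauss 0 sigma]_x g x| <= C / Num.sqrt n%:R.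
Proof.
move=> K0 tg; have [bg _ _ _] := tg.
have [C C0 xiC] := bounded_measurable_bound bxi.
have s0 : 0 <= sigma by exact: sqrtr_ge0.
pose D := K * (C ^+ 3 + 64 * sigma ^+ 3).
have D0 : 0 <= D by rewrite mulr_ge0// addr_ge0 ?mulr_ge0 ?exprn_ge0// ltW.
exists (D + 1) => [|n n0]; first by rewrite ltr_wpDl.
set e := (Num.sqrt n%:R)^-1.
have q0 : 0 < Num.sqrt n%:R :> R by rewrite sqrtr_gt0 ltr0n.
have e0 : 0 < e by rewrite invr_gt0.
have e2 : e ^+ 2 * n%:R = 1.
  by rewrite exprVn sqr_sqrtr ?ler0n// mulVf// pnatr_eq0 -lt0n.
(* The interpolation: j original summands, and a single Gaussian variable replacing the other n - j.
   Each of the n steps costs e^3 D, and n e^3 = e. *)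
pose b j := \int[gauss 0 (sigma * e * Num.sqrt (n - j)%:R)]_x mean_translate e j g x.
have bv j : bounded_measurable (mean_translate e j g).
  exact: (bounded_measurable_integral2 P (bpair e j bg)).
have step j : (j < n)%N -> `|b j - b j.+1| <= e ^+ 3 * D.
  move=> jn; rewrite /b; set t := sigma * e * Num.sqrt (n - j.+1)%:R.
  have t0 : 0 <= t by rewrite !mulr_ge0 ?sqrtr_ge0// ltW.
  (* The semigroup law detaches one Gaussian increment of deviation sigma e, to be exchanged with
     the summand of index j. *)
  have -> : sigma * e * Num.sqrt (n - j)%:R = Num.sqrt ((sigma * e) ^+ 2 + t ^+ 2).
    have t2 : t ^+ 2 = (sigma * e) ^+ 2 * (n - j.+1)%:R.
      by rewrite /t exprMn sqr_sqrtr ?ler0n.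
    have -> : (sigma * e) ^+ 2 + t ^+ 2 = (sigma * e) ^+ 2 * (n - j)%:R.
      by rewrite t2 -[(n - j)%N]prednK ?subn_gt0// -subnS -natr1; ring.
    by rewrite sqrtrM ?sqr_ge0// sqrtr_sqr ger0_norm// mulr_ge0// ltW.
  have se0 : 0 <= sigma * e by rewrite mulr_ge0// ltW.
  rewrite -(gauss_semigroup _ se0 t0 (bv j)).
  rewrite -(bounded_integralB _ (bounded_measurable_integral_gauss _ (bv j)) (bv j.+1)).
  apply: norm_bounded_integral => [|x].
    exact: bounded_measurableB (bounded_measurable_integral_gauss _ (bv j)) (bv j.+1).
  exact: lindeberg_step (ltW e0) K0 xiC tg.
have sum_step j : (j <= n)%N -> `|b 0%N - b j| <= j%:R * (e ^+ 3 * D).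
  elim: j => [|j IH] jn; first by rewrite subrr normr0 mul0r.
  rewrite -natr1 mulrDl mul1r.
  apply: le_trans (lerD (IH (ltnW jn)) (step j jn)).
  by apply: le_trans (ler_normD _ _); rewrite addrA subrK.
have b0E : b 0%N = \int[gauss 0 sigma]_x g x.
  rewrite /b subn0 -mulrA mulVf ?gt_eqF// mulr1.
  apply: eq_Rintegral => x _; rewrite /mean_translate -[RHS](bounded_integral_cst P).
  by apply: eq_Rintegral => w _; rewrite big_ord0 mulr0 addr0.
have bnE : b n = \int[P]_w g (e * \sum_(t < n) xi (W t w)).
  rewrite /b subnn sqrtr0 mulr0 integral_gauss0//.
  by apply: eq_Rintegral => w _; rewrite add0r.
rewrite -b0E -bnE distrC; apply: (le_trans (sum_step n (leqnn n))).
have -> : n%:R * (e ^+ 3 * D) = e ^+ 2 * n%:R * (D * e) by ring.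
by rewrite e2 mul1r ler_wpM2r// ?ltW// ltrDl.
Qed.

End lindeberg.

(** * From smooth steps to convergence in distribution *)

Section smooth_step.
Context (R : realType).
Implicit Types x u : R.

Definition cube_pos x : R := Num.max x 0 ^+ 3.
Definition cube_pos1 x : R := 3 * Num.max x 0 ^+ 2.
Definition cube_pos2 x : R := 6 * Num.max x 0.

(** The second derivative 6 x_+ is Lipschitz with constant 6, whence the remainder 6/3! = 1 times
    |h|^3. The cases are the signs of x and x + h. *)
Lemma cube_pos_taylor x h :
  `|cube_pos (x + h) - cube_pos x - h * cube_pos1 x - h ^+ 2 / 2 * cube_pos2 x|
  <= `|h| ^+ 3.
Proof.
rewrite /cube_pos /cube_pos1 /cube_pos2.
have [x0|x0] := leP x 0; have [y0|y0] := leP (x + h) 0.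
- rewrite [X in `|X|](_ : _ = 0) ?normr0 ?exprn_ge0//; ring.
- have h0 : 0 < h by lra.
  rewrite [X in `|X|](_ : _ = (x + h) ^+ 3); last by field.
  rewrite normrX (gtr0_norm y0) (gtr0_norm h0).
  by apply: lerXn2r; rewrite ?nnegrE; lra.
- have h0 : h < 0 by lra.
  rewrite [X in `|X|](_ : _ = - (x + h) ^+ 3 + h ^+ 3); last by field.
  rewrite (ltr0_norm h0) ler_norml; apply/andP; split.
    have : 0 <= (- (x + h)) ^+ 3 by rewrite exprn_ge0// oppr_ge0.
    rewrite !exprS !expr0; lra.
  have : (- (x + h)) ^+ 3 <= (- h) ^+ 3.
    by apply: lerXn2r; rewrite ?nnegrE; lra.
  have : 0 <= (- h) ^+ 3 by rewrite exprn_ge0// oppr_ge0 ltW.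
  rewrite !exprS !expr0; lra.
- rewrite [X in `|X|](_ : _ = h ^+ 3); last by field.
  by rewrite normrX.
Qed.

(* The third difference of the truncated cube is 6 times a twice differentiable
   function increasing from 0 to 1 on [0, 3]. *)
Definition third_difference (c : R -> R) u : R :=
  (c u - 3 * c (u - 1) + 3 * c (u - 2) - c (u - 3)) / 6.

Lemma third_difference_le0 c x : (forall y, y <= 0 -> c y = 0) -> x <= 0 ->
  third_difference c x = 0.
Proof. by move=> c0 x0; rewrite /third_difference !c0; [ring|lra..]. Qed.

(** The coefficients have absolute sum 8, and 8/6 <= 2. *)
Lemma third_difference_bound c x (B : R) :
  (forall y, y <= 3 -> `|c y| <= B) -> x <= 3 -> `|third_difference c x| <= 2 * B.
Proof.
move=> cB x3; rewrite /third_difference.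
have b0 : `|c x| <= B by apply: cB.
have b1 : `|c (x - 1)| <= B by apply: cB; lra.
have b2 : `|c (x - 2)| <= B by apply: cB; lra.
have b3 : `|c (x - 3)| <= B by apply: cB; lra.
move: b0 b1 b2 b3; rewrite !ler_norml => /andP[? ?] /andP[? ?] /andP[? ?] /andP[? ?].
by apply/andP; split; lra.
Qed.

Lemma pos_part_le3 x : x <= 3 -> 0 <= Num.max x 0 <= 3.
Proof. by move=> x3; rewrite le_max lexx orbT ge_max x3 ler0n. Qed.

(** This is the primitive of the quadratic cardinal B-spline supported on [0, 3]. *)
Definition step3 := third_difference cube_pos.
Definition step3' := third_difference cube_pos1.
Definition step3'' := third_difference cube_pos2.

Lemma step3_le0 x : x <= 0 -> step3 x = 0.
Proof.
by apply: third_difference_le0 => y y0; rewrite /cube_pos (max_idPr y0) expr0n.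
Qed.

Lemma step3_ge3 x : 3 <= x -> step3 x = 1.
Proof.
move=> x3; rewrite /step3 /third_difference /cube_pos !(max_idPl _); [|lra..].
by field.
Qed.

Lemma step3_01 x : 0 <= step3 x <= 1.
Proof.
have [x0|x0] := leP x 0; first by rewrite step3_le0// lexx ler01.
have [x3|x3] := leP 3 x; first by rewrite step3_ge3// lexx ler01.
rewrite /step3 /third_difference /cube_pos (max_idPl (ltW x0)) (max_idPr (_ : x - 3 <= 0)); last by lra.
have [x1|x1] := leP (x - 1) 0; have [x2|x2] := leP (x - 2) 0; rewrite !exprS !expr0.
- have h1 : 0 <= x * (x * x) by rewrite !mulr_ge0// ltW.
  have h2 : x * (x * x) <= 1 by rewrite mulr_ile1 ?mulr_ge0 ?mulr_ile1//; lra.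
  by apply/andP; split; lra.
- lra.
- have : 0 <= (x - 1) * (2 - x) by rewrite mulr_ge0; lra.
  have : 0 <= (x - 1) * ((x - 1) * (2 - x)) by rewrite !mulr_ge0; lra.
  by move=> ? ?; apply/andP; split; nra.
- have h0 : 0 <= 3 - x by lra.
  have h1 : 0 <= (3 - x) * ((3 - x) * (3 - x)) by rewrite !mulr_ge0.
  have h2 : (3 - x) * ((3 - x) * (3 - x)) <= 1.
    by rewrite mulr_ile1 ?mulr_ge0 ?mulr_ile1//; lra.
  by apply/andP; split; lra.
Qed.

(** Beyond 3 the third difference acts on a polynomial of degree 2 and vanishes; up to 3 the
    truncated powers are at most 27. *)
Lemma step3'_bound x : `|step3' x| <= 54.
Proof.
have [x3|x3] := leP x 3; last first.
  rewrite /step3' /third_difference /cube_pos1 !(max_idPl _); [|lra..].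
  rewrite [X in `|X|](_ : _ = 0) ?normr0//; by field.
rewrite (_ : 54 = 2 * 27); last by lra.
apply: third_difference_bound x3 => y /pos_part_le3 /andP[y0 y3].
rewrite /cube_pos1 ger0_norm ?mulr_ge0 ?sqr_ge0//.
by move: y0 y3; move: (Num.max y 0) => t t0 t3; nra.
Qed.

Lemma step3''_bound x : `|step3'' x| <= 54.
Proof.
have [x3|x3] := leP x 3; last first.
  rewrite /step3'' /third_difference /cube_pos2 !(max_idPl _); [|lra..].
  rewrite [X in `|X|](_ : _ = 0) ?normr0//; by field.
rewrite (_ : 54 = 2 * 27); last by lra.
apply: third_difference_bound x3 => y /pos_part_le3 /andP[y0 y3].
by rewrite /cube_pos2 ger0_norm ?mulr_ge0//; lra.
Qed.

Lemma step3_taylor x h :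
  `|step3 (x + h) - step3 x - h * step3' x - h ^+ 2 / 2 * step3'' x|
  <= 2 * `|h| ^+ 3.
Proof.
pose r y := cube_pos (y + h) - cube_pos y - h * cube_pos1 y - h ^+ 2 / 2 * cube_pos2 y.
have rE : step3 (x + h) - step3 x - h * step3' x - h ^+ 2 / 2 * step3'' x =
    (r x - 3 * r (x - 1) + 3 * r (x - 2) - r (x - 3)) / 6.
  rewrite /r /step3 /step3' /step3'' /third_difference.
  rewrite [x + h - 1]addrAC [x + h - 2]addrAC [x + h - 3]addrAC.
  by field.
have := cube_pos_taylor (x - 3) h; have := cube_pos_taylor (x - 2) h.
have := cube_pos_taylor (x - 1) h; have := cube_pos_taylor x h.
rewrite -!/(r _) rE.
move: (r x) (r (x - 1)) (r (x - 2)) (r (x - 3)) (`|h| ^+ 3) => a b c d e.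
rewrite !ler_norml => /andP[? ?] /andP[? ?] /andP[? ?] /andP[? ?].
by apply/andP; split; lra.
Qed.

Lemma measurable_third_difference (c : measurableTypeR R -> R) :
  measurable_fun setT c ->
  measurable_fun setT (third_difference c : measurableTypeR R -> R).
Proof.
move=> mc; have mB (t : R) : measurable_fun setT (fun u : measurableTypeR R => c (u - t)).
  by apply: measurableT_comp => //; exact: measurable_funB.
apply: measurable_funM => //; apply: measurable_funB => //.
apply: measurable_funD; last by apply: measurable_funM.
by apply: measurable_funB => //; apply: measurable_funM.
Qed.

Lemma measurable_pos_part (n : nat) (c : R) :
  measurable_fun setT (fun u : measurableTypeR R => c * Num.max u 0 ^+ n).
Proof.
by apply: measurable_funM => //; apply: measurable_funX; exact: measurable_maxr.
Qed.

Lemma bounded_measurable_step3 :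
  bounded_measurable (step3 : measurableTypeR R -> R).
Proof.
split.
  apply: measurable_third_difference.
  by have := measurable_pos_part 3 1; under eq_fun do rewrite mul1r.
exists 1 => x; have /andP[h0 h1] := step3_01 x.
by rewrite ger0_norm.
Qed.

Lemma taylor3_step3 : taylor3 (step3 : measurableTypeR R -> R) step3' step3'' 2.
Proof.
split; [exact: bounded_measurable_step3| | |exact: step3_taylor].
- split; last by exists 54; exact: step3'_bound.
  by apply: measurable_third_difference; exact: measurable_pos_part.
- split; last by exists 54; exact: step3''_bound.
  by apply: measurable_third_difference; exact: (measurable_pos_part 1).
Qed.

End smooth_step.

Lemma taylor3_affine (R : realType) (g g1 g2 : measurableTypeR R -> R) (K a b : R) :
  taylor3 g g1 g2 K ->
  taylor3 (fun x => g (b * (x - a))) (fun x => b * g1 (b * (x - a)))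
    (fun x => b ^+ 2 * g2 (b * (x - a))) (K * `|b| ^+ 3).
Proof.
move=> [bg bg1 bg2 gK].
have mb : measurable_fun setT (fun x : measurableTypeR R => b * (x - a) : measurableTypeR R).
  by apply: measurable_funM => //; exact: measurable_funB.
split.
- exact: (bounded_measurable_comp bg mb).
- exact: (bounded_measurableZ b (bounded_measurable_comp bg1 mb)).
- exact: (bounded_measurableZ (b ^+ 2) (bounded_measurable_comp bg2 mb)).
move=> x h /=; have := gK (b * (x - a)) (b * h).
have -> : b * (x - a) + b * h = b * (x + h - a) by ring.
have -> : b * h * g1 (b * (x - a)) = h * (b * g1 (b * (x - a))) by ring.
have -> : (b * h) ^+ 2 / 2 * g2 (b * (x - a)) = h ^+ 2 / 2 * (b ^+ 2 * g2 (b * (x - a))).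
  by ring.
by rewrite normrM exprMn (mulrA K).
Qed.

(** For |h| >= 1 boundedness of [g] suffices; for |h| < 1 each term of the Taylor inequality is at
    most linear in |h|. *)
Lemma taylor3_lipschitz (R : realType) (g g1 g2 : measurableTypeR R -> R) (K : R) :
  0 <= K -> taylor3 g g1 g2 K ->
  exists2 C : R, 0 < C & forall x y : R, `|g x - g y| <= C * `|x - y|.
Proof.
move=> K0 [bg bg1 bg2 gK].
have [B B0 gB] := bounded_measurable_bound bg.
have [B1 B10 gB1] := bounded_measurable_bound bg1.
have [B2 B20 gB2] := bounded_measurable_bound bg2.
exists (2 * B + B1 + B2 + K) => [|x y]; first by lra.
have [h ->] : exists h, x = y + h by exists (x - y); ring.
have -> : y + h - y = h by ring.
have [h1|h1] := leP 1 `|h|.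
  have : `|g (y + h) - g y| <= 2 * B.
    by rewrite (le_trans (ler_normB _ _))// mulr2n mulrDl mul1r lerD.
  by move=> /le_trans; apply; nra.
have h0 : 0 <= `|h| by [].
have E : g (y + h) - g y = (g (y + h) - g y - h * g1 y - h ^+ 2 / 2 * g2 y) +
  h * g1 y + h ^+ 2 / 2 * g2 y by ring.
rewrite E; apply: le_trans (ler_normD _ _) _.
have t2 : `|h ^+ 2 / 2 * g2 y| <= `|h| * B2.
  rewrite normrM ler_pM// normrM normrX (ger0_norm (_ : 0 <= 2^-1))//.
  by move: h0 h1; move: `|h| => t t0 t1; nra.
apply: le_trans (lerD (ler_normD _ _) t2) _.
have t1 : `|h * g1 y| <= `|h| * B1 by rewrite normrM ler_wpM2l.
have t3 : K * `|h| ^+ 3 <= K * `|h|.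
  by rewrite ler_wpM2l// -[leRHS]mulr1 exprS ler_wpM2l// exprn_ile1// ltW.
have := gK y h; have : 0 <= B * `|h| by rewrite mulr_ge0// ltW.
by move: t1 t2 t3; lra.
Qed.

(** Only x is confined to the segment. Compactness is used as a near-covering property with the
    radius running through the filter of right neighbourhoods of 0. *)
Lemma heine_segment (R : realType) (f : R -> R) (a b e : R) : continuous f -> 0 < e ->
  exists2 r, 0 < r & forall x y, a <= x <= b -> `|x - y| < r -> `|f x - f y| < e.
Proof.
move=> cf e0; have /compact_near_coveringP cov := @segment_compact R a b.
have := cov R (0 : R)^'+ (fun r x => forall y, `|x - y| < r -> `|f x - f y| < e) _.
case=> [x _|r /= r0 hr].
  have /cvgrPdist_lt/(_ (e / 2)) := cf x.
  rewrite divr_gt0// => /(_ isT) [r /= r0 hr].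
  exists (ball x (r / 2), [set t | 0 < t < r / 2]).
    split; first exact: nbhsx_ballx (divr_gt0 _ _).
    exists (r / 2) => /=; first by rewrite divr_gt0.
    by move=> t /=; rewrite sub0r normrN => tr t0; rewrite t0 -(gtr0_norm t0).
  move=> [x' t] /= [xx' /andP[t0 tr]] y x'y.
  have h1 := hr x'; have h2 := hr y.
  have {}h1 : `|f x - f x'| < e / 2.
    by apply: h1; rewrite /ball/= in xx' *; lra.
  have {}h2 : `|f x - f y| < e / 2.
    apply: h2; rewrite /ball/= in xx' *.
    by rewrite -(subrKA x') (le_lt_trans (ler_normD _ _))//; lra.
  rewrite -(subrKA (f x)) (le_lt_trans (ler_normD _ _))// (distrC (f x')); lra.
exists (r / 2); first by rewrite divr_gt0.
move=> x y xab; apply: (hr (r / 2)) => /=.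
- by rewrite sub0r normrN gtr0_norm ?divr_gt0//; lra.
- by rewrite divr_gt0.
- by rewrite in_itv.
Qed.

(** * Uniform approximation by sums of smooth steps *)

Section spline_approximation.
Context (R : realType) (f : R -> R) (a h B e : R).
Hypothesis h0 : 0 < h.
Hypothesis fB : forall x, `|f x| <= B.

Let node (i : nat) : R := a + i%:R * h.

(** The factor 3/h fits the transition of [step3] to one cell. Completed steps telescope, so inside
    a cell the value is a convex combination of [f] at its two ends. *)
Definition spline (n : nat) (x : R) : R :=
  f (node 0) + \sum_(i < n) (f (node i.+1) - f (node i)) * step3 (3 / h * (x - node i)).

Let nodeS i : node i.+1 = node i + h.
Proof. by rewrite /node -natr1 mulrDl mul1r addrA. Qed.

Let step_le i x : x <= node i -> step3 (3 / h * (x - node i)) = 0.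
Proof.
move=> xi; apply: step3_le0; rewrite pmulr_rle0 ?divr_gt0//.
by rewrite subr_le0.
Qed.

Let step_ge i x : node i.+1 <= x -> step3 (3 / h * (x - node i)) = 1.
Proof.
move=> xi; apply: step3_ge3; rewrite mulrAC ler_pdivlMr// ler_wpM2l//.
by rewrite lerBrDl -nodeS.
Qed.

Lemma spline_ge n x : node n <= x -> spline n x = f (node n).
Proof.
elim: n => [|n IH] nx; first by rewrite /spline big_ord0 addr0.
have nnx : node n <= x by rewrite (le_trans _ nx)// nodeS lerDl ltW.
rewrite /spline big_ord_recr/= addrA -/(spline n x) IH// step_ge// mulr1.
by rewrite subrKC.
Qed.

Let convex_combination (u v t c d : R) : 0 <= t <= 1 ->
  `|u - c| <= d -> `|v - c| <= d -> `|u + (v - u) * t - c| <= d.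
Proof.
move=> /andP[t0 t1]; rewrite !ler_norml => /andP[? ?] /andP[? ?].
by apply/andP; split; nra.
Qed.

Lemma spline_bound n x : `|spline n x| <= B.
Proof.
elim: n => [|n IH]; first by rewrite /spline big_ord0 addr0.
rewrite /spline big_ord_recr/= addrA -/(spline n x).
have [xn|/ltW nx] := leP x (node n); first by rewrite step_le// mulr0 addr0.
rewrite spline_ge// -[X in `|X|]subr0; apply: convex_combination.
- exact: step3_01.
- by rewrite subr0.
- by rewrite subr0.
Qed.

Lemma spline_approx n x :
  (forall i y, (i < n)%N -> node i <= y <= node i.+1 ->
     `|f (node i) - f y| <= e /\ `|f (node i.+1) - f y| <= e) ->
  (0 < n)%N -> node 0 <= x <= node n -> `|spline n x - f x| <= e.
Proof.
elim: n => // n IH osc _ /andP[x0 xn].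
rewrite /spline big_ord_recr/= addrA -/(spline n x).
have [xn'|/ltW nx] := leP x (node n); last first.
  rewrite spline_ge//.
  have [h1 h2] := osc n x (ltnSn n) (introT andP (conj nx xn)).
  by apply: convex_combination => //; exact: step3_01.
rewrite step_le// mulr0 addr0.
(* The induction hypothesis requires a cell; when none precedes the last one, x is the first node
   itself. *)
case: n => [|n] in IH osc xn xn' *.
  have -> : x = node 0 by apply/eqP; rewrite eq_le xn' x0.
  rewrite /spline big_ord0 addr0 subrr normr0.
  have n01 : node 0 <= node 0 <= node 1 by rewrite lexx nodeS lerDl ltW.
  by have [h1 _] := osc 0%N _ (ltnSn 0) n01; exact: le_trans h1.
apply: IH => //; last by rewrite x0.
by move=> i y /ltnW iy; apply: osc.
Qed.

End spline_approximation.

(** * Convergence in distribution from smooth steps *)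

Section weak_convergence.
Context (R : realType) (d : measure_display) (Omega : measurableType d)
  (P : probability Omega R) (nu : probability (measurableTypeR R) R)
  (Y : nat -> Omega -> measurableTypeR R).
Hypothesis mY : forall n, measurable_fun [set: Omega] (Y n).

Let weak (g : measurableTypeR R -> R) := bounded_measurable g /\
  \int[P]_w g (Y n w) @[n --> \oo] --> \int[nu]_x g x.

Let bY n (g : measurableTypeR R -> R) : bounded_measurable g -> bounded_measurable (fun w => g (Y n w)).
Proof. by move=> bg; exact: (bounded_measurable_comp bg (mY n)). Qed.

Let weak_cst (c : R) : weak (fun=> c).
Proof.
split; first exact: bounded_measurable_cst.
under eq_fun do rewrite bounded_integral_cst.
by rewrite bounded_integral_cst; exact: cvg_cst.
Qed.

Let weakD g1 g2 : weak g1 -> weak g2 -> weak (fun x => g1 x + g2 x).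
Proof.
move=> [b1 c1] [b2 c2]; split; first exact: bounded_measurableD.
rewrite bounded_integralD//.
under eq_fun do rewrite (bounded_integralD _ (bY _ b1) (bY _ b2)).
exact: cvgD.
Qed.

Let weakZ (c : R) g : weak g -> weak (fun x => c * g x).
Proof.
move=> [bg cg]; split; first exact: bounded_measurableZ.
rewrite bounded_integralZ//.
under eq_fun do rewrite (bounded_integralZ _ _ (bY _ bg)).
by apply: cvgM => //; exact: cvg_cst.
Qed.

Hypothesis weak_step : forall a b : R, 0 < b ->
  \int[P]_w step3 (b * (Y n w - a)) @[n --> \oo] --> \int[nu]_x step3 (b * (x - a)).

Let weak_step3 (a b : R) : 0 < b -> weak (fun x => step3 (b * (x - a))).
Proof.
move=> b0; split; last exact: weak_step.
by have [] := taylor3_affine a b (taylor3_step3 R).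
Qed.

Let weak_spline f a h n : 0 < h -> weak (spline f a h n).
Proof.
move=> h0; elim: n => [|n [b c]].
  rewrite (_ : spline f a h 0 = fun=> f (a + 0%:R * h)); first exact: weak_cst.
  by apply/funext => x; rewrite /spline big_ord0 addr0.
rewrite (_ : spline f a h n.+1 = fun x => spline f a h n x +
  (f (a + n.+1%:R * h) - f (a + n%:R * h)) * step3 (3 / h * (x - (a + n%:R * h)))).
  by apply: weakD => //; apply: weakZ; apply: weak_step3; rewrite divr_gt0.
by apply/funext => x; rewrite /spline big_ord_recr/= addrA.
Qed.

(* 0 on [-N, N] and 1 outside of [-N-1, N+1] *)
Let tail (N : nat) (x : measurableTypeR R) : R :=
  1 + (-1) * (step3 (3 * (x - (- (N%:R + 1)))) + (-1) * step3 (3 * (x - N%:R))).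

Let weak_tail N : weak (tail N).
Proof.
apply: weakD; first exact: weak_cst.
apply: weakZ; apply: weakD; first exact: weak_step3.
by apply: weakZ; exact: weak_step3.
Qed.

Let tail_ge0 N x : 0 <= tail N x <= 1.
Proof.
rewrite /tail; have [xN|xN] := leP x N%:R.
  rewrite (_ : step3 (3 * (x - N%:R)) = 0); last by apply: step3_le0; lra.
  by have /andP[? ?] := step3_01 (3 * (x - (- (N%:R + 1)))); apply/andP; split; lra.
have N0 : 0 <= N%:R :> R by [].
rewrite (_ : step3 (3 * (x - (- (N%:R + 1)))) = 1); last by apply: step3_ge3; lra.
by have /andP[? ?] := step3_01 (3 * (x - N%:R)); apply/andP; split; lra.
Qed.

Let tail_eq1 N x : N%:R + 1 <= `|x| -> tail N x = 1.
Proof.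
have N0 : 0 <= N%:R :> R by [].
rewrite /tail; have [x0|x0] := leP 0 x => xN.
  by rewrite (ger0_norm x0) in xN; rewrite !step3_ge3; [ring|lra|lra].
by rewrite (ltr0_norm x0) in xN; rewrite !step3_le0; [ring|lra|lra].
Qed.

Let tail_eq0 N x : `|x| <= N%:R -> tail N x = 0.
Proof.
rewrite ler_norml => /andP[x1 x2].
rewrite /tail step3_ge3; last by lra.
by rewrite step3_le0; [ring|lra].
Qed.

Let tail_cvg0 : \int[nu]_x tail N x @[N --> \oo] --> (0 : R).
Proof.
have bt N : bounded_measurable (tail N) by case: (weak_tail N).
have m N : measurable_fun setT (EFin \o tail N).
  by apply/measurable_EFinP; case: (bt N).
have c1 : nu.-integrable setT (EFin \o cst (1 : R)).
  exact: (bounded_measurable_integrable nu (bounded_measurable_cst 1)).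
have cv : {ae nu, forall x, setT x ->
    (EFin \o tail N) x @[N --> \oo] --> cst (0%:E : \bar R) x}.
  apply: aeW => x _; apply: cvg_near_cst.
  have [N _ hN] := nbhs_infty_ger `|x|.
  by exists N => // n Nn; rewrite /= tail_eq0//; exact: hN.
have le1 : {ae nu, forall x n, setT x -> (`|(EFin \o tail n) x| <= (EFin \o cst 1%R) x)%E}.
  apply: aeW => x n _; rewrite /= lee_fin.
  by have /andP[h1 h2] := tail_ge0 n x; rewrite ger0_norm.
have [_ _] := @dominated_convergence _ _ _ nu setT measurableT _ _ _ m
  (measurable_cst _) cv c1 le1.
rewrite integral0 => /fine_cvg; apply.
Qed.

(** The error f - phi of the spline is dominated by [psi], a constant plus a multiple of [tail N].
    As [psi] is again a combination of steps, its integral also converges, so tightness of the laws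
    of [Y] comes from that of [nu]. *)
Lemma cvg_in_distribution_step3 : cvg_in_distribution P Y nu.
Proof.
split=> // f cf [B0 fB0].
have bf : bounded_measurable (f : measurableTypeR R -> R).
  by split; [exact: continuous_measurable_fun|exists B0].
have [B B_gt0 fB] := bounded_measurable_bound bf.
apply/cvgrPdist_le => e e0.
(* The budget: 2 e' for int psi dnu, e' for the spline, and 3 e' for E psi(Y m), in all 6 e'. *)
pose e' := e / 8; have e'0 : 0 < e' by rewrite divr_gt0.
have [N _ /(_ N (leqnn N)) hN] : \forall N \near \oo, \int[nu]_x tail N x < e' / (2 * B).
  by apply: (cvgr_lt (0 : R)) => //; rewrite divr_gt0// mulr_gt0.
(* Outside [-A, A] the tail function is 1, so 2 B times it covers |f - phi|; inside, the mesh below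
   r gives the error e'. *)
pose A : R := N%:R + 1.
have A0 : 0 < A by rewrite ltr_wpDl.
have [r r0 hr] := heine_segment (- A) A cf e'0.
have [n _ /(_ n (leqnn n)) /= nr] := nbhs_infty_gtr (2 * A / r).
have n0 : (0 < n)%N.
  rewrite -(ltr0n R) (lt_trans _ nr)// divr_gt0// mulr_gt0//.
pose h := 2 * A / n%:R.
have n0' : 0 < n%:R :> R by rewrite ltr0n.
have h0 : 0 < h by rewrite divr_gt0// mulr_gt0.
have hlt : h < r by rewrite ltr_pdivrMr// [ltRHS]mulrC -ltr_pdivrMr.
pose phi := spline f (- A) h n.
have hn : - A + n%:R * h = A by rewrite /h mulrC divfK ?gt_eqF//; ring.
have approx x : `|f x - phi x| <= e' + 2 * B * tail N x.
  have /andP[t0 t1] := tail_ge0 N x.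
  have [xA|/ltW xA] := leP `|x| A; last first.
    rewrite tail_eq1// mulr1 (le_trans (ler_normB _ _))//.
    have := fB x; have := @spline_bound _ f (- A) h B h0 fB n x.
    by rewrite -/phi; move: (`|phi x|) (`|f x|) => u v; lra.
  have : `|phi x - f x| <= e'.
    apply: spline_approx => //; last first.
      by rewrite hn mul0r addr0 -ler_norml.
    move=> i y iltn /andP[iy yi].
    have i0 : 0 <= i%:R * h by rewrite mulr_ge0// ltW.
    have iA : - A + i.+1%:R * h <= A.
      by rewrite -[leRHS]hn lerD2l ler_wpM2r ?ler_nat// ltW.
    rewrite -natr1 mulrDl mul1r in yi iA *.
    split; apply/ltW/hr; [lra| |lra|].
    - by rewrite distrC ger0_norm; lra.
    - by rewrite ger0_norm; lra.
  rewrite distrC => /le_trans; apply; rewrite lerDl !mulr_ge0// ltW//.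
have [bphi cphi] := weak_spline f (- A) n h0.
pose psi x := e' + 2 * B * tail N x.
have [bpsi cpsi] : weak psi.
  by apply: weakD; [exact: weak_cst|exact/weakZ/weak_tail].
have npsi : \int[nu]_x psi x < 2 * e'.
  have [bt _] := weak_tail N.
  rewrite bounded_integralD; [|exact: bounded_measurable_cst|exact: bounded_measurableZ].
  rewrite bounded_integral_cst bounded_integralZ//.
  move: hN; rewrite ltr_pdivlMr ?mulr_gt0//.
  by move: (\int[nu]_x _) => t; lra.
near=> m.
have h1 : `|\int[nu]_x phi x - \int[P]_w phi (Y m w)| <= e'.
  by near: m; move/cvgrPdist_le : cphi => /(_ _ e'0).
have h2 : `|\int[nu]_x psi x - \int[P]_w psi (Y m w)| <= e'.
  by near: m; move/cvgrPdist_le : cpsi => /(_ _ e'0).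
have h3 : `|\int[nu]_x f x - \int[nu]_x phi x| <= \int[nu]_x psi x.
  rewrite -bounded_integralB//.
  by apply: norm_bounded_integral_le => //; exact: bounded_measurableB.
have h4 : `|\int[P]_w f (Y m w) - \int[P]_w phi (Y m w)| <= \int[P]_w psi (Y m w).
  rewrite -(bounded_integralB _ (bY m bf) (bY m bphi)).
  apply: norm_bounded_integral_le; [|exact: bY|by move=> w; exact: approx].
  exact: bounded_measurableB (bY m bf) (bY m bphi).
move: h1 h2 h3 h4 npsi.
move: (\int[nu]_x phi x) (\int[P]_w phi (Y m w)) (\int[nu]_x psi x)
  (\int[P]_w psi (Y m w)) (\int[nu]_x f x) (\int[P]_w f (Y m w)) => p1 p2 q1 q2 u v.
rewrite !ler_norml => /andP[? ?] /andP[? ?] /andP[? ?] /andP[? ?] ?.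
have eE : e = 8 * e' by rewrite /e' mulrC divfK.
by apply/andP; split; lra.
Unshelve. all: by end_near. Qed.

End weak_convergence.

(** * The delta method *)

Section delta_method.
Context (R : realType).
Implicit Types x v c p l n : R.

(** With a = sqrt v and b = sqrt x the remainder is exactly (x - v)^2 (b + 2a) / (2 a^3 b (a +
    b)^2), and x >= v/2 gives a <= 2b. *)
Lemma invsqrt_expansion v x : 0 < v -> `|x - v| <= v / 2 ->
  0 < x /\
  `|(Num.sqrt x)^-1 - (Num.sqrt v)^-1 - (- (2 * Num.sqrt v ^+ 3)^-1) * (x - v)| <=
  2 / Num.sqrt v ^+ 5 * (x - v) ^+ 2.
Proof.
move=> v0; rewrite ler_norml => /andP[xv1 xv2].
have x0 : 0 < x by lra.
split=> //.
set a := Num.sqrt v; set b := Num.sqrt x.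
have a0 : 0 < a by rewrite sqrtr_gt0.
have b0 : 0 < b by rewrite sqrtr_gt0.
have a2 : v = a ^+ 2 by rewrite sqr_sqrtr// ltW.
have b2 : x = b ^+ 2 by rewrite sqr_sqrtr// ltW.
have ab : a <= 2 * b.
  rewrite -(ler_pXn2r (n := 2)) ?nnegrE ?mulr_ge0 ?(ltW a0) ?(ltW b0)//.
  by rewrite exprMn -a2 -b2; lra.
have -> : b^-1 - a^-1 - - (2 * a ^+ 3)^-1 * (x - v) =
    (x - v) ^+ 2 * ((b + 2 * a) / (2 * a ^+ 3 * b * (a + b) ^+ 2)).
  by rewrite a2 b2; field; rewrite !gt_eqF// addr_gt0.
have D0 : 0 < 2 * a ^+ 3 * b * (a + b) ^+ 2.
  by rewrite !mulr_gt0// ?exprn_gt0// addr_gt0.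
rewrite ger0_norm; last first.
  by rewrite mulr_ge0 ?sqr_ge0// divr_ge0 ?(ltW D0)// addr_ge0 ?mulr_ge0// ltW.
rewrite mulrC ler_wpM2r ?sqr_ge0// ler_pdivrMr//.
have a5 : 0 < a ^+ 5 by rewrite exprn_gt0.
rewrite mulrAC ler_pdivlMr//.
have -> : 2 * (2 * a ^+ 3 * b * (a + b) ^+ 2) =
  a ^+ 3 * (4 * b * (a + b) ^+ 2) by ring.
have -> : (b + 2 * a) * a ^+ 5 = a ^+ 3 * (a ^+ 2 * (b + 2 * a)) by ring.
rewrite ler_wpM2l ?exprn_ge0 ?(ltW a0)//.
have ab' : 0 <= 2 * b - a by lra.
have h1 : 0 <= (2 * b - a) * (a * (a + b)).
  by rewrite mulr_ge0// mulr_ge0 ?addr_ge0// ltW.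
have h2 : 0 <= b * (a * b) by rewrite !mulr_ge0// ltW.
have h3 : 0 <= b * (b * b) by rewrite !mulr_ge0// ltW.
have h4 : 0 <= a * (a * b) by rewrite !mulr_ge0// ltW.
rewrite !exprS !expr0 !mulr1; nra.
Qed.

(** A first-order expansion with explicit constant: [n] is the size of the perturbation and [l] the
    linear part of p' - p. *)
Definition expansion n (K p p' l : R) := `|l| <= K * n /\ `|p' - p - l| <= K * n ^+ 2.

(** Leibniz rule. The remainder is p1 r2 + p2 r1 + (l1 + r1)(l2 + r2); as n <= 1, each factor of the
    last product is at most 2 Ki n, whence 4 K1 K2. *)
Lemma expansionM n K1 K2 p1 p1' l1 p2 p2' l2 :
  0 <= n <= 1 -> 0 <= K1 -> 0 <= K2 ->
  expansion n K1 p1 p1' l1 -> expansion n K2 p2 p2' l2 ->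
  expansion n (`|p1| * K2 + `|p2| * K1 + 4 * (K1 * K2))
    (p1 * p2) (p1' * p2') (p1 * l2 + p2 * l1).
Proof.
move=> /andP[n0 n1] K10 K20 [l1n r1n] [l2n r2n].
have nn : n ^+ 2 <= n by rewrite expr2 ler_piMr.
have KK : 0 <= 4 * (K1 * K2) by rewrite !mulr_ge0.
have pl i (p l K : R) : `|l| <= K * i -> `|p * l| <= `|p| * K * i.
  by move=> h; rewrite normrM -mulrA ler_wpM2l.
split.
  apply: le_trans (ler_normD _ _) _.
  apply: (le_trans (lerD (pl _ p1 _ _ l2n) (pl _ p2 _ _ l1n))).
  by have := mulr_ge0 KK n0; move: `|p1| `|p2| => u v; lra.
set r1 := p1' - p1 - l1 in r1n; set r2 := p2' - p2 - l2 in r2n.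
have -> : p1' * p2' - p1 * p2 - (p1 * l2 + p2 * l1) =
    p1 * r2 + p2 * r1 + (l1 + r1) * (l2 + r2) by rewrite /r1 /r2; ring.
have s1 : `|l1 + r1| <= 2 * K1 * n.
  rewrite (le_trans (ler_normD _ _))//; have : K1 * n ^+ 2 <= K1 * n by rewrite ler_wpM2l.
  by lra.
have s2 : `|l2 + r2| <= 2 * K2 * n.
  rewrite (le_trans (ler_normD _ _))//; have : K2 * n ^+ 2 <= K2 * n by rewrite ler_wpM2l.
  by lra.
apply: le_trans (ler_normD _ _) _; rewrite [leRHS]mulrDl; apply: lerD.
  apply: le_trans (ler_normD _ _) _; rewrite [leRHS]mulrDl.
  exact: lerD (pl _ p1 _ _ r2n) (pl _ p2 _ _ r1n).
rewrite normrM; apply: (le_trans (ler_pM _ _ s1 s2)) => //.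
by rewrite le_eqVlt; apply/orP; left; apply/eqP; ring.
Qed.

(** [alpha] is the gradient of c / (sqrt v1 sqrt v2). Stating both the neighbourhood and the error
    through the squared distance [N] lets the bound be integrated directly against mean squared
    errors. *)
Lemma correlation_expansion c v1 v2 : 0 < v1 -> 0 < v2 ->
  exists alpha : R * R * R, exists2 K : R, 0 < K & exists2 e : R, 0 < e &
  forall c' x1 x2,
    let N := (c' - c) ^+ 2 + (x1 - v1) ^+ 2 + (x2 - v2) ^+ 2 in
    N <= e -> [/\ 0 < x1, 0 < x2 &
      `|c' / (Num.sqrt x1 * Num.sqrt x2) - c / (Num.sqrt v1 * Num.sqrt v2) -
        (alpha.1.1 * (c' - c) + alpha.1.2 * (x1 - v1) + alpha.2 * (x2 - v2))|
      <= K * N].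
Proof.
move=> v10 v20.
pose q v := (Num.sqrt v)^-1; pose m v := - (2 * Num.sqrt v ^+ 3)^-1 : R.
pose Kq v := `|m v| + 2 / Num.sqrt v ^+ 5 : R.
pose K12 := `|q v1| * Kq v2 + `|q v2| * Kq v1 + 4 * (Kq v1 * Kq v2).
pose K := `|c| * K12 + `|q v1 * q v2| * 1 + 4 * (1 * K12).
have Kq0 v : 0 <= Kq v.
  by rewrite addr_ge0// divr_ge0// exprn_ge0// sqrtr_ge0.
have K120 : 0 <= K12 by rewrite !addr_ge0 ?mulr_ge0 ?Kq0.
have K0 : 0 <= K by rewrite !addr_ge0 ?mulr_ge0.
exists (q v1 * q v2, c * (q v2 * m v1), c * (q v1 * m v2)).
exists (K + 1); first by rewrite ltr_wpDl.
(* The bound 1 is for the product rule, the other two for the expansions of the inverse square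
   roots. *)
exists (Num.min 1 (Num.min ((v1 / 2) ^+ 2) ((v2 / 2) ^+ 2))).
  by rewrite !lt_min ltr01 !exprn_gt0// divr_gt0.
move=> c' x1 x2 N; rewrite !le_min => /and3P[N1 Nv1 Nv2].
have sq0 (t : R) := sqr_ge0 t.
have N0 : 0 <= N by rewrite !addr_ge0.
pose n := Num.sqrt N.
have n2 : n ^+ 2 = N by rewrite sqr_sqrtr.
have n0 : 0 <= n by exact: sqrtr_ge0.
have n1 : n <= 1 by rewrite -(@expr_le1 _ 2)// n2.
have le_n (t : R) : t ^+ 2 <= N -> `|t| <= n by rewrite -sqrtr_sqr; exact: ler_wsqrtr.
have cn : `|c' - c| <= n by apply: le_n; rewrite /N; move: (sq0 (x1 - v1)) (sq0 (x2 - v2)); lra.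
have xn1 : `|x1 - v1| <= n by apply: le_n; rewrite /N; move: (sq0 (c' - c)) (sq0 (x2 - v2)); lra.
have xn2 : `|x2 - v2| <= n by apply: le_n; rewrite /N; move: (sq0 (c' - c)) (sq0 (x1 - v1)); lra.
have nv (v : R) : 0 < v -> N <= (v / 2) ^+ 2 -> n <= v / 2.
  by move=> v0 Nv; rewrite -(ler_pXn2r (n := 2)) ?nnegrE ?n2// divr_ge0// ltW.
have [x10 e1] := invsqrt_expansion v10 (le_trans xn1 (nv _ v10 Nv1)).
have [x20 e2] := invsqrt_expansion v20 (le_trans xn2 (nv _ v20 Nv2)).
have ex (v x : R) : `|x - v| <= n -> `|q x - q v - m v * (x - v)| <= 2 / Num.sqrt v ^+ 5 * (x - v) ^+ 2 ->
    expansion n (Kq v) (q v) (q x) (m v * (x - v)).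
  move=> xn h; have d0 : 0 <= 2 / Num.sqrt v ^+ 5 by rewrite divr_ge0// exprn_ge0// sqrtr_ge0.
  have xv2 : (x - v) ^+ 2 <= n ^+ 2 by rewrite -real_normK ?num_real// lerXn2r// nnegrE.
  split.
    by rewrite normrM /Kq mulrDl (le_trans (ler_wpM2l _ xn))// lerDl mulr_ge0.
  apply: (le_trans h); rewrite /Kq [leRHS]mulrDl.
  by apply: (le_trans (ler_wpM2l d0 xv2)); rewrite lerDr mulr_ge0// exprn_ge0.
have nn : 0 <= n <= 1 by rewrite n0.
have E12 := expansionM nn (Kq0 _) (Kq0 _) (ex _ _ xn1 e1) (ex _ _ xn2 e2).
have Ec : expansion n 1 c c' (c' - c).
  by split; rewrite ?mul1r// subrr normr0 sq0.
have [_] := expansionM nn ler01 K120 Ec E12.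
rewrite n2 -/K; split => //.
rewrite mulrDl mul1r; apply: (@le_trans _ _ (K * N)); last by rewrite lerDl.
rewrite /= !invfM.
rewrite (_ : q v1 * q v2 * (c' - c) + c * (q v2 * m v1) * (x1 - v1) +
    c * (q v1 * m v2) * (x2 - v2) =
  c * (q v1 * (m v2 * (x2 - v2)) + q v2 * (m v1 * (x1 - v1))) +
    q v1 * q v2 * (c' - c))//; ring.
Qed.

End delta_method.

Lemma cvg_le_invsqrt (R : realType) (u : nat -> R) (l C : R) :
  (forall n, (1 < n)%N -> `|u n - l| <= C / Num.sqrt n%:R) ->
  u n @[n --> \oo] --> l.
Proof.
move=> uC; apply/cvgrPdist_le => e e0.
have [N _ hN] := nbhs_infty_gtr ((C / e) ^+ 2).
exists (maxn 2 N) => // n; rewrite /= geq_max => /andP[n1 Nn].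
rewrite distrC (le_trans (uC _ n1))//.
have n0 : 0 < n%:R :> R by rewrite ltr0n ltnW.
have q0 : 0 < Num.sqrt n%:R :> R by rewrite sqrtr_gt0.
rewrite ler_pdivrMr// mulrC -ler_pdivrMr// (le_trans (ler_norm _))//.
by rewrite -sqrtr_sqr ler_wsqrtr// ltW//; exact: hN.
Qed.

Lemma measurable_sqrt_comp (R : realType) (d : measure_display) (T : measurableType d)
    (f : T -> R) : measurable_fun setT f -> measurable_fun setT (fun x => Num.sqrt (f x)).
Proof.
move=> mf; apply: (measurableT_comp (f := @Num.sqrt R)) => //.
by apply: continuous_measurable_fun; exact: sqrt_continuous.
Qed.

(** On nonnegative numbers the inverse is the power of exponent -1, whose measurability is known. *)
Lemma measurable_div_ge0 (R : realType) (d : measure_display) (T : measurableType d)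
    (f g : T -> R) : measurable_fun setT f -> measurable_fun setT g ->
  (forall x, 0 <= g x) -> measurable_fun setT (fun x => f x / g x).
Proof.
move=> mf mg g0; apply: measurable_funM => //.
apply: (eq_measurable_fun (fun x => g x `^ (-1))).
  by move=> x _; rewrite powR_inv1.
exact: (measurableT_comp (measurable_powR (-1)) mg).
Qed.

(** Replaces Cauchy-Schwarz for integrals. With m the sample size and r^2 of mean O(m^-2), both
    terms are of order 1/m. *)
Lemma norm_le_mean_sqr (R : realFieldType) (m r : R) : 0 < m ->
  `|r| <= (m^-1 + m * `|r| ^+ 2) / 2.
Proof.
move=> m0; rewrite ler_pdivlMr//.
have mi : 0 <= m^-1 by rewrite invr_ge0 ltW.
have := mulr_ge0 mi (sqr_ge0 (m * `|r| - 1)).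
have -> : m^-1 * (m * `|r| - 1) ^+ 2 = m * `|r| ^+ 2 - 2 * `|r| + m^-1.
  by field; rewrite gt_eqF.
by lra.
Qed.

(** With y = sqrt M and [u0], [u1], [u2] the i.i.d. sums: the Taylor remainder of the ratio plus the
    linearization remainders of the three estimators. *)
Lemma linearized_error (F : fieldType) (y X p C0 C1 C2 t0 t1 t2 a0 a1 a2 u0 u1 u2 : F) :
  y != 0 ->
  y * (X - p) - y^-1 * (a0 * u0 + a1 * u1 + a2 * u2) =
  y * (X - p - (a0 * (C0 - t0) + a1 * (C1 - t1) + a2 * (C2 - t2))) +
  y * (a0 * (C0 - t0 - y ^- 2 * u0) + a1 * (C1 - t1 - y ^- 2 * u1) +
       a2 * (C2 - t2 - y ^- 2 * u2)).
Proof. by move=> y0; field. Qed.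

(** * Asymptotic normality of the correlation statistic *)

Section correlation_estimator.
Context (R : realType) (d d' : measure_display) (Omega : measurableType d)
  (T' : measurableType d') (P : probability Omega R) (Q : probability T' R)
  (W : nat -> Omega -> T').
Hypothesis mW : forall t, measurable_fun [set: Omega] (W t).
Hypothesis indepW : mutually_independent P W.
Hypothesis lawW : forall t A, measurable A -> P (W t @^-1` A) = Q A.
Context (kappa kappa1 kappa2 : T' * T' -> R).
Hypothesis bkappa : bounded_measurable kappa.
Hypothesis bkappa1 : bounded_measurable kappa1.
Hypothesis bkappa2 : bounded_measurable kappa2.

Let theta (k : T' * T' -> R) := \int[Q]_z k (z, z) - \int[Q]_z \int[Q]_z' k (z, z').

Hypothesis theta1 : 0 < theta kappa1.
Hypothesis theta2 : 0 < theta kappa2.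
Context (c : nat -> Omega -> R).
Hypothesis mc : forall M, measurable_fun [set: Omega] (c M).

Let C M w := cov_stat W kappa M w.
Let V1 M w := cov_stat W kappa1 M w.
Let V2 M w := cov_stat W kappa2 M w.

Definition corr_stat M w := if (0 < V1 M w) && (0 < V2 M w)
  then C M w / (Num.sqrt (V1 M w) * Num.sqrt (V2 M w)) else c M w.

Lemma measurable_corr_stat M : measurable_fun setT (corr_stat M).
Proof.
have [m0 _] := bounded_measurable_cov_stat mW bkappa M.
have [m1 _] := bounded_measurable_cov_stat mW bkappa1 M.
have [m2 _] := bounded_measurable_cov_stat mW bkappa2 M.
apply: measurable_fun_ifT => //.
  by apply: measurable_and; exact: measurable_fun_ltr.
apply: measurable_div_ge0 => //.
by apply: measurable_funM; exact: measurable_sqrt_comp.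
Qed.

Lemma corr_stat_clt : exists s : R, 0 <= s /\
  cvg_in_distribution P
    (fun M w => Num.sqrt M%:R * (corr_stat M w -
       theta kappa / (Num.sqrt (theta kappa1) * Num.sqrt (theta kappa2))))
    (centred_gaussian s).
Proof.
have [z0 [bz0 Ez0] [D0 D00 L0]] := cov_stat_linearization mW indepW lawW bkappa.
have [z1 [bz1 Ez1] [D1 D10 L1]] := cov_stat_linearization mW indepW lawW bkappa1.
have [z2 [bz2 Ez2] [D2 D20 L2]] := cov_stat_linearization mW indepW lawW bkappa2.
have [[[a0 a1] a2] [K K0 [e e0 taylor]]] := correlation_expansion (theta kappa) theta1 theta2.
pose xi z := a0 * z0 z + a1 * z1 z + a2 * z2 z.
have ba0 := bounded_measurableZ a0 bz0.
have ba1 := bounded_measurableZ a1 bz1.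
have ba2 := bounded_measurableZ a2 bz2.
have bxi : bounded_measurable xi.
  exact: bounded_measurableD (bounded_measurableD ba0 ba1) ba2.
have Exi : \int[Q]_z xi z = 0.
  rewrite (bounded_integralD Q (bounded_measurableD ba0 ba1) ba2).
  rewrite (bounded_integralD Q ba0 ba1) !bounded_integralZ//.
  by rewrite Ez0 Ez1 Ez2 !mulr0 !addr0.
(* This may vanish; the limit is then the Dirac mass at 0. *)
pose s := Num.sqrt (\int[Q]_z xi z ^+ 2).
exists s; split; first exact: sqrtr_ge0.
rewrite centred_gaussianE; set rho := theta kappa / _.
pose G M w := Num.sqrt M%:R * (corr_stat M w - rho).
have mG M : measurable_fun setT (G M : Omega -> measurableTypeR R).
  by apply: measurable_funM => //; apply: measurable_funB => //; exact: measurable_corr_stat.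
apply: (@cvg_in_distribution_step3 _ _ _ P (gauss 0 s) G mG) => a b b0.
have tg := taylor3_affine a b (taylor3_step3 R).
set g := (fun x : measurableTypeR R => step3 (b * (x - a))) in tg *.
have Kg0 : 0 <= 2 * `|b| ^+ 3 by rewrite mulr_ge0// exprn_ge0.
have [bg _ _ _] := tg.
have g1 x : `|g x| <= 1.
  by have /andP[h0 h1] := step3_01 (b * (x - a)); rewrite ger0_norm.
have [C1 C10 clt] := clt_taylor3 mW indepW lawW bxi Exi Kg0 tg.
have [Lip Lip0 lip] := taylor3_lipschitz Kg0 tg.
pose r0 M w := C M w - theta kappa - M%:R^-1 * (\sum_(t < M) z0 (W t w)).
pose r1 M w := V1 M w - theta kappa1 - M%:R^-1 * (\sum_(t < M) z1 (W t w)).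
pose r2 M w := V2 M w - theta kappa2 - M%:R^-1 * (\sum_(t < M) z2 (W t w)).
pose N M w := (C M w - theta kappa) ^+ 2 + (V1 M w - theta kappa1) ^+ 2
  + (V2 M w - theta kappa2) ^+ 2.
pose A := `|a0| + `|a1| + `|a2|.
have A0 : 0 <= A by rewrite !addr_ge0.
pose rr M w := r0 M w ^+ 2 + r1 M w ^+ 2 + r2 M w ^+ 2.
pose q M : R := Num.sqrt M%:R.
(* The term in [K] is the Taylor remainder. Where N > e, the two values of [g] differ by at most 2
   <= (2 / e) N, whatever the default value. The last term bounds the linearization remainders. *)
pose D M w := (Lip * q M * K + 2 / e) * N M w +
  Lip * A * ((q M)^-1 + q M * M%:R * rr M w).
have q2 M : q M ^+ 2 = M%:R by rewrite sqr_sqrtr// ler0n.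
have N0 M w : 0 <= N M w by rewrite !addr_ge0// sqr_ge0.
have rr0 M w : 0 <= rr M w by rewrite !addr_ge0// sqr_ge0.
have pointwise M w : (1 < M)%N ->
    `|g (G M w) - g ((q M)^-1 * \sum_(t < M) xi (W t w))| <= D M w.
  move=> M1; have M0 : 0 < M%:R :> R by rewrite ltr0n ltnW.
  have q0 : 0 < q M by rewrite sqrtr_gt0.
  have t1 : 0 <= Lip * A * ((q M)^-1 + q M * M%:R * rr M w).
    by rewrite !mulr_ge0 ?addr_ge0 ?invr_ge0 ?mulr_ge0 ?(ltW q0) ?(ltW Lip0).
  have [Ne|/ltW eN] := leP (N M w) e; last first.
    have h1 : `|g (G M w) - g ((q M)^-1 * \sum_(t < M) xi (W t w))| <= 2.
      apply: (le_trans (ler_normB _ _)).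
      by rewrite -[2]/(1 + 1); apply: lerD; exact: g1.
    apply: (le_trans h1); rewrite /D mulrDl.
    have : 2 <= 2 / e * N M w.
      by rewrite mulrAC ler_pdivlMr// ler_wpM2l.
    have : 0 <= Lip * q M * K * N M w.
      by rewrite !mulr_ge0// ltW.
    lra.
  apply: (le_trans (lip _ _)).
  (* Near the true parameters both estimated variances are positive, so the statistic is the ratio
     and not its default. *)
  have [x10 x20] := taylor (C M w) (V1 M w) (V2 M w) Ne.
  rewrite -/rho /= => tay.
  have GE : G M w - (q M)^-1 * (\sum_(t < M) xi (W t w)) =
      q M * (C M w / (Num.sqrt (V1 M w) * Num.sqrt (V2 M w)) - rho -
       (a0 * (C M w - theta kappa) + a1 * (V1 M w - theta kappa1)
        + a2 * (V2 M w - theta kappa2))) +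
      q M * (a0 * r0 M w + a1 * r1 M w + a2 * r2 M w).
    rewrite /G /corr_stat x10 x20 /= -/(q M).
    have -> : \sum_(t < M) xi (W t w) = a0 * (\sum_(t < M) z0 (W t w)) +
        a1 * (\sum_(t < M) z1 (W t w)) + a2 * (\sum_(t < M) z2 (W t w)).
      by rewrite !mulr_sumr -!big_split.
    rewrite /r0 /r1 /r2 -(q2 M).
    by apply: linearized_error; rewrite gt_eqF.
  have rle (a' r : R) : `|r| ^+ 2 <= rr M w ->
      `|a' * r| <= `|a'| * ((M%:R^-1 + M%:R * rr M w) / 2).
    move=> rrr; rewrite normrM ler_wpM2l// (le_trans (norm_le_mean_sqr r M0))//.
    by rewrite ler_wpM2r// lerD2l ler_wpM2l// ltW.
  have [s0 s1 s2] : [/\ `|r0 M w| ^+ 2 <= rr M w, `|r1 M w| ^+ 2 <= rr M w &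
      `|r2 M w| ^+ 2 <= rr M w].
    rewrite !real_normK ?num_real// /rr.
    by split; [rewrite -addrA lerDl|rewrite addrAC lerDr|rewrite lerDr];
      rewrite addr_ge0// sqr_ge0.
  have rem : `|a0 * r0 M w + a1 * r1 M w + a2 * r2 M w| <=
      A * ((M%:R^-1 + M%:R * rr M w) / 2).
    rewrite (le_trans (ler_normD _ _))// mulrDl lerD ?rle//.
    by rewrite (le_trans (ler_normD _ _))// mulrDl lerD ?rle.
  have -> : D M w = Lip * (q M * (K * N M w) + q M * (A * (M%:R^-1 + M%:R * rr M w)))
      + 2 / e * N M w.
    have qV : (q M)^-1 = q M * M%:R^-1.
      by rewrite -(q2 M) expr2 invfM mulrA divff ?mul1r// gt_eqF.
    by rewrite /D qV; ring.
  rewrite GE.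
  apply: (@le_trans _ _ (Lip * (q M * (K * N M w) +
      q M * (A * (M%:R^-1 + M%:R * rr M w))))); last first.
    by rewrite lerDl mulr_ge0// divr_ge0// ltW.
  rewrite ler_wpM2l ?(ltW Lip0)// (le_trans (ler_normD _ _))//.
  rewrite !normrM (gtr0_norm q0) lerD// ler_wpM2l ?(ltW q0)//.
  apply: (le_trans rem); rewrite ler_wpM2l// ler_pdivrMr// ler_peMr ?ler1n//.
  by rewrite addr_ge0 ?invr_ge0 ?mulr_ge0.
have bst (k : T' * T' -> R) (th : R) M : bounded_measurable k ->
    bounded_measurable (fun w => cov_stat W k M w - th).
  move=> bk; exact: bounded_measurableB (bounded_measurable_cov_stat mW bk M)
    (bounded_measurable_cst _).
have bL (z : T' -> R) M : bounded_measurable z ->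
    bounded_measurable (fun w => M%:R^-1 * (\sum_(t < M) z (W t w))).
  move=> bz; apply: bounded_measurableZ; apply: bounded_measurable_sum => t.
  exact: (bounded_measurable_comp bz (mW t)).
pose DD := D0 + D1 + D2.
(* Since E N <= DD / M and E rr <= DD / M^2, the weights sqrt M and M sqrt M leave DD / sqrt M in
   both cases. *)
pose C2 := (Lip * K + 2 / e) * DD + Lip * A * (1 + DD).
apply: (@cvg_le_invsqrt _ _ _ (C2 + C1)) => M M1.
have M0 : 0 < M%:R :> R by rewrite ltr0n ltnW.
have q0 : 0 < q M by rewrite sqrtr_gt0.
have q1 : 1 <= q M by rewrite -[1]sqrtr1 ler_wsqrtr// ler1n ltnW.
have bN0 := bounded_measurableX 2 (bst _ (theta kappa) M bkappa).
have bN1 := bounded_measurableX 2 (bst _ (theta kappa1) M bkappa1).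
have bN2 := bounded_measurableX 2 (bst _ (theta kappa2) M bkappa2).
have bN : bounded_measurable (N M).
  exact: bounded_measurableD (bounded_measurableD bN0 bN1) bN2.
have br0 := bounded_measurableX 2 (bounded_measurableB (bst _ (theta kappa) M bkappa) (bL _ M bz0)).
have br1 := bounded_measurableX 2 (bounded_measurableB (bst _ (theta kappa1) M bkappa1) (bL _ M bz1)).
have br2 := bounded_measurableX 2 (bounded_measurableB (bst _ (theta kappa2) M bkappa2) (bL _ M bz2)).
have brr : bounded_measurable (rr M).
  exact: bounded_measurableD (bounded_measurableD br0 br1) br2.
have EN : \int[P]_w N M w <= DD / M%:R.
  rewrite (bounded_integralD P (bounded_measurableD bN0 bN1) bN2).
  rewrite (bounded_integralD P bN0 bN1) /DD !mulrDl.
  by rewrite !lerD//; [case: (L0 _ M1)|case: (L1 _ M1)|case: (L2 _ M1)].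
have Err : \int[P]_w rr M w <= DD / M%:R ^+ 2.
  rewrite (bounded_integralD P (bounded_measurableD br0 br1) br2).
  rewrite (bounded_integralD P br0 br1) /DD !mulrDl.
  by rewrite !lerD//; [case: (L0 _ M1)|case: (L1 _ M1)|case: (L2 _ M1)].
have bc (x : R) : bounded_measurable (fun _ : Omega => x) by exact: bounded_measurable_cst.
have bqr := bounded_measurableZ (q M * M%:R) brr.
have bin := bounded_measurableD (bc (q M)^-1) bqr.
have bD1 := bounded_measurableZ (Lip * q M * K + 2 / e) bN.
have bD2 := bounded_measurableZ (Lip * A) bin.
have bD : bounded_measurable (D M) by exact: bounded_measurableD bD1 bD2.
have DD0 : 0 <= DD by rewrite !addr_ge0// ltW.
have ED : \int[P]_w D M w <= C2 / q M.
  rewrite (bounded_integralD P bD1 bD2) (bounded_integralZ P _ bN).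
  rewrite (bounded_integralZ P _ bin) (bounded_integralD P (bc _) bqr).
  rewrite bounded_integral_cst (bounded_integralZ P _ brr) /C2 [leRHS]mulrDl.
  apply: lerD.
    have k0 : 0 <= Lip * q M * K + 2 / e.
      by rewrite addr_ge0 ?divr_ge0 ?mulr_ge0 ?ltW.
    apply: (le_trans (ler_wpM2l k0 EN)).
    rewrite -(q2 M) ler_pdivlMr//.
    have -> : (Lip * q M * K + 2 / e) * (DD / q M ^+ 2) * q M =
        (Lip * K + 2 / e / q M) * DD by field; rewrite !gt_eqF.
    have e2 : 0 <= 2 / e by rewrite divr_ge0// ltW.
    by rewrite ler_wpM2r// lerD2l ler_pdivrMr// ler_peMr.
  have k1 : 0 <= Lip * A by rewrite mulr_ge0// ltW.
  rewrite -(mulrA (Lip * A)) ler_wpM2l// mulrDl mul1r lerD2l.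
  have k0 : 0 <= q M * M%:R by rewrite mulr_ge0// ltW.
  rewrite (le_trans (ler_wpM2l k0 Err))//.
  rewrite le_eqVlt; apply/orP; left; apply/eqP.
  by rewrite -(q2 M); field; rewrite gt_eqF.
have bgG : bounded_measurable (fun w => g (G M w)) by exact: (bounded_measurable_comp bg (mG M)).
have bgL : bounded_measurable (fun w => g ((q M)^-1 * \sum_(t < M) xi (W t w))).
  apply: (bounded_measurable_comp bg); apply: measurable_funM => //.
  by have [] : bounded_measurable (fun w => \sum_(t < M) xi (W t w));
    first by apply: bounded_measurable_sum => t; exact: (bounded_measurable_comp bxi (mW t)).
have h1 : `|\int[P]_w g (G M w) - \int[P]_w g ((q M)^-1 * \sum_(t < M) xi (W t w))| <= C2 / q M.
  rewrite -(bounded_integralB P bgG bgL); apply: le_trans ED.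
  apply: norm_bounded_integral_le => //; first exact: bounded_measurableB.
  by move=> w; exact: pointwise.
have h2 := clt M (ltnW M1).
rewrite mulrDl; apply: le_trans (lerD h1 h2).
by apply: le_trans (ler_normD _ _); rewrite addrA subrK.
Qed.

End correlation_estimator.

(** The conditional product formula is integrated over the whole space, with the full set at every
    index other than [a] and [b], where the conditional probability is 1. *)
Lemma cond_independent_pair (R : realType) (dT : measure_display)
    (T : measurableType dT) (d : measure_display) (Omega : measurableType d)
    (P : probability Omega R) (G : set (set Omega)) (J : finType)
    (Z : J -> Omega -> T) (Q : J -> Omega -> pprobability T R) (a b : J) :
  a != b -> G setT -> cond_independent P G Z ->
  (forall i, is_cond_law P G (Z i) (Q i)) ->
  forall A B, measurable A -> measurable B ->
  P (Z a @^-1` A `&` Z b @^-1` B) =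
    (\int[P]_w (fine (Q a w A) * fine (Q b w B))%:E)%E.
Proof.
move=> ab GT indZ lawZ A B mA mB.
pose C i := if i == a then A else if i == b then B else setT.
have mC i : measurable (C i) by rewrite /C; case: ifP => // _; case: ifP.
have [_ _ /(_ _ GT)] := indZ C (fun i w => fine (Q i w (C i))) mC
  (fun i => lawZ i (C i) (mC i)).
have -> : \bigcap_i (Z i @^-1` C i) `&` setT = Z a @^-1` A `&` Z b @^-1` B.
  rewrite setIT; apply/seteqP; split => [w h|w [hA hB] i _].
    by have := h a I; have := h b I; rewrite /C /= eqxx eq_sym (negbTE ab) eqxx.
  by rewrite /C /=; case: eqP => [->//|_]; case: eqP => [->//|].
move=> ->; apply: eq_integral => w _; congr EFin.
rewrite (bigD1 a)//= (bigD1 b) 1?eq_sym//= big1 ?mulr1.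
  by rewrite /C eqxx eq_sym (negbTE ab) eqxx.
move=> i /andP[ia ib]; rewrite /C (negbTE ia) (negbTE ib).
by rewrite (_ : Q i w setT = 1%E)//; exact: probability_setT.
Qed.

Theorem proposition9 (R : realType)
  (X : ptopologicalType) (Xpolish : polish R X)
  (Xlc : locally_compact [set: X])
  (k : borel X -> borel X -> R) (kker : is_kernel k) (H : rkhs k)
  (d : measure_display) (Omega : measurableType d) (P : probability Omega R)
  (Pt : 'I_2 -> Omega -> pprobability (borel X) R)
  (Pt_meas : forall i, measurable_fun [set: Omega] (Pt i))
  (Pt_var : forall i, 0 < kvar H P (Pt i))
  (Z : 'I_2 -> 'I_2 -> Omega -> borel X)
  (Z_meas : forall i j, measurable_fun [set: Omega] (Z i j))
  (Z_indep : cond_independent P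
     (generated_sigma_algebra (fun w => (Pt 0 w, Pt 1 w)))
     (fun ij : 'I_2 * 'I_2 => Z ij.1 ij.2))
  (Z_law : forall i j, is_cond_law P
     (generated_sigma_algebra (fun w => (Pt 0 w, Pt 1 w))) (Z i j) (Pt i))
  (d' : measure_display) (Omega' : measurableType d')
  (P' : probability Omega' R)
  (Y : nat -> 'I_2 -> 'I_2 -> Omega' -> borel X)
  (Y_meas : forall t i j, measurable_fun [set: Omega'] (Y t i j))
  (Y_indep : mutually_independent P' (fun t => vec4 (Y t)))
  (Y_law : forall t, same_law P' P (vec4 (Y t)) (vec4 Z))
  (c : nat -> Omega' -> R)
  (c_meas : forall M, measurable_fun [set: Omega'] (c M)) :
  exists s : R, 0 <= s /\
    cvg_in_distribution P'
      (fun M w => Num.sqrt M%:R *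
         (corr_est k M (fun t i j => Y t i j w) (c M w) -
          kcorr H P (Pt 0) (Pt 1)))
      (centred_gaussian s).
Proof.
have mvec4 (d0 : measure_display) (O : measurableType d0)
    (V : 'I_2 -> 'I_2 -> O -> borel X) :
    (forall i j, measurable_fun setT (V i j)) -> measurable_fun setT (vec4 V).
  by move=> mV; do 3 (apply: measurable_fun_pair => //).
have mW t := mvec4 _ _ (Y t) (Y_meas t).
have mZ := mvec4 _ _ Z Z_meas.
pose Q := law P mZ.
pose T4 := (borel X * borel X * borel X * borel X)%type.
have bk := kernel_bounded_measurable kker.
have bkappa (p q : T4 -> borel X) : measurable_fun setT p -> measurable_fun setT q ->
    bounded_measurable (fun z : T4 * T4 => k (p z.1) (q z.2)).
  move=> mp mq; apply: (bounded_measurable_comp bk (h := fun z => (p z.1, q z.2))).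
  apply: measurable_fun_pair.
    exact: (measurableT_comp mp measurable_fst).
  exact: (measurableT_comp mq measurable_snd).
pose G := generated_sigma_algebra (fun w => (Pt 0 w, Pt 1 w)).
have GT : G setT by exists setT => //; rewrite setTI preimage_setT.
(* The projections [p] and [q] read two distinct entries of the vector; the kernel covariance
   becomes the centring of [cov_stat], the independent copy being a second vector. *)
have theta (p q : T4 -> borel X) (a b : 'I_2 * 'I_2) :
    measurable_fun setT p -> measurable_fun setT q -> a != b ->
    (forall w, p (vec4 Z w) = Z a.1 a.2 w) -> (forall w, q (vec4 Z w) = Z b.1 b.2 w) ->
    kcov H P (Pt a.1) (Pt b.1) = \int[Q]_z k (p z) (q z) -
      \int[Q]_z \int[Q]_z' k (p z) (q z').
  move=> mp mq ab pE qE; have bpq := bkappa p q mp mq.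
  have Zab := cond_independent_pair (Q := fun i : 'I_2 * 'I_2 => Pt i.1) ab GT Z_indep
    (fun i => Z_law i.1 i.2).
  rewrite (kcovE kker H (Pt_meas a.1) (Pt_meas b.1) (Z_meas a.1 a.2) (Z_meas b.1 b.2) Zab).
  have bd : bounded_measurable (fun z : T4 => k (p z) (q z)).
    apply: (bounded_measurable_comp bpq (h := fun z => (z, z))).
    exact: measurable_fun_pair.
  rewrite (integral_law P mZ bd) (integral_law P mZ (bounded_measurable_integral2 _ bpq)).
  congr (_ - _); first by apply: eq_Rintegral => w _; rewrite pE qE.
  apply: eq_Rintegral => w _.
  rewrite (integral_law P mZ (bounded_measurable_pair2 (vec4 Z w) bpq)).
  by apply: eq_Rintegral => w' _; rewrite pE qE.
have m111 : measurable_fun setT (fun z : T4 => z.1.1.1).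
  by do 2 apply: (measurableT_comp measurable_fst); exact: measurable_fst.
have m112 : measurable_fun setT (fun z : T4 => z.1.1.2).
  by apply: (measurableT_comp measurable_snd); apply: (measurableT_comp measurable_fst).
have m12 : measurable_fun setT (fun z : T4 => z.1.2).
  exact: (measurableT_comp measurable_snd measurable_fst).
have m2 : measurable_fun setT (fun z : T4 => z.2) by exact: measurable_snd.
(* In [vec4] the first index varies fastest: the covariance pairs entries 1 and 2, the variances
   pair entries 1 and 3, then 2 and 4. *)
have t0 := theta _ _ (0, 0) (1, 0) m111 m112 isT (fun=> erefl) (fun=> erefl).
have t1 := theta _ _ (0, 0) (0, 1) m111 m12 isT (fun=> erefl) (fun=> erefl).
have t2 := theta _ _ (1, 0) (1, 1) m112 m2 isT (fun=> erefl) (fun=> erefl).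
have v1 := Pt_var 0; have v2 := Pt_var 1.
rewrite /kvar t1 in v1; rewrite /kvar t2 in v2.
have := corr_stat_clt (Q := law P mZ) mW Y_indep Y_law (bkappa _ _ m111 m112)
  (bkappa _ _ m111 m12) (bkappa _ _ m112 m2) v1 v2 c_meas.
by rewrite -t0 -t1 -t2.
Qed.
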